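(* Let $p\ge 2$ be an even integer such that $m_p<\infty$. For any $X\in\mathcal{L}_p^*$, $$\|I(X)\|_p\le \mathcal{C}_p\,[X]_p,$$ where $\|\cdot\|_p$ is the norm of $L^p(\Omega)$ and $[X]_p=\|X\|_{L^p(\Omega;L^2(\mathbb{R}))}+\|X\|_{L^p(\Omega\times\mathbb{R})}$.
   Context: Let $\mathbb{R}_0=\mathbb{R}\setminus\{0\}$, endowed with the distance $d(x,y)=|x^{-1}-y^{-1}|$, and let $\mathcal{B}_b(\mathbb{R})$, $\mathcal{B}_b(\mathbb{R}_0)$ be the classes of bounded Borel sets (bounded subsets of $\mathbb{R}_0$ are those bounded away from $0$). Let $\nu$ be a measure on $\mathbb{R}_0$; for $p\ge 1$ put $m_p=\int_{\mathbb{R}_0}|z|^p\,\nu(dz)$, and assume $m_2<\infty$. Let $N$ be a Poisson random measure on $\mathbb{R}\times\mathbb{R}_0$ with intensity $\mathfrak{m}(dx,dz)=dx\,\nu(dz)$ on a complete probability space $(\Omega,\mathcal{F},\mathbb{P})$, and $\widehat N=N-\mathfrak{m}$. Set $L(A)=\int_{A\times\mathbb{R}_0}z\,\widehat N(dx,dz)$ for $A\in\mathcal{B}_b(\mathbb{R})$ (usual $L^2$-integral with respect to $\widehat N$). Filtration: $\mathcal{F}_x=\sigma\{N([a,b]\times\Gamma):-\infty<a<b\le x,\ \Gamma\in\mathcal{B}_b(\mathbb{R}_0)\}\vee\mathcal{N}$, $x\in\mathbb{R}$, where $\mathcal{N}$ is the class of $\mathbb{P}$-negligible sets. Simple processes: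 $\mathcal{E}$ is the class of processes $X(x)=\sum_{i=1}^nY_i1_{(b_{i-1},b_i]}(x)$, $x\in\mathbb{R}$, with $-\infty<b_0<\dots<b_n<\infty$ and $Y_i$ bounded and $\mathcal{F}_{b_{i-1}}$-measurable. A process $\{X(x)\}_{x\in\mathbb{R}}$ is predictable if $(\omega,x)\mapsto X(\omega,x)$ is measurable with respect to the $\sigma$-field $\mathcal{P}=\sigma(\mathcal{E})$ on $\Omega\times\mathbb{R}$. Itô integral: for $X\in\mathcal{E}$ of the form $X(x)=\sum_{i=1}^nY_i1_{(b_{i-1},b_i]}(x)$, with $-\infty<b_0<\dots<b_n<\infty$ and $Y_i$ bounded and $\mathcal{F}_{b_{i-1}}$-measurable, and $K>0$, $I_K(X)=\sum_{i=1}^nY_iL((b_{i-1},b_i]\cap[-K,K])$. If $X$ is predictable with $[X]_{K,2}^2:=\mathbb{E}\int_{-K}^K|X(x)|^2dx<\infty$ for all $K>0$, then $I_K(X)$ is the $L^2(\Omega)$-limit of $I_K(X_m)$ for any simple processes $X_m$ with $[X_m-X]_{K,2}\to0$ for all $K>0$ (such a sequence exists and the limit does not depend on it). If $X$ is predictable with $\mathbb{E}\int_{\mathbb{R}}|X(x)|^2dx<\infty$, then $I(X)=\int_{\mathbb{R}}X(x)L(dx)$ is the $L^2(\Omega)$-limit of $I_K(X)$ as $K\to\infty$. $\mathcal{L}_p^*$ is the set of predictable processes $X$ with $[X]_p<\infty$; every such process satisfies $\mathbb{E}\int_{\mathbb{R}}|X(x)|^2dx<\infty$, so $I(X)$ is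 defined. Constant: $\mathcal{C}_p>0$ is given by $\mathcal{C}_p^p=2\,\mathcal{B}_p^p\,C_p^*\,(m_2^{p/2}\vee m_p)$, where $C_p^*$ is the number of partitions of $\{1,\dots,p\}$ all of whose blocks have at least two elements, and $\mathcal{B}_p>0$ is a constant depending only on $p$ for which Rosenthal's inequality $$\mathbb{E}\big[\max_{k\le n}|S_k|^p\big]\le\mathcal{B}_p^p\Big\{\mathbb{E}\Big[\Big(\sum_{i=1}^n\mathbb{E}[X_i^2|\mathcal{G}_{i-1}]\Big)^{p/2}\Big]+\sum_{i=1}^n\mathbb{E}|X_i|^p\Big\}$$ holds for every discrete-time martingale $(S_k)_{0\le k\le n}$ with respect to a filtration $(\mathcal{G}_k)_{0\le k\le n}$, with $S_0=0$ and increments $X_i=S_i-S_{i-1}\in L^p(\Omega)$. *)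

(* Defs.v *)
From HB Require Import structures.
From mathcomp Require Import all_boot all_order all_algebra.
From mathcomp Require Import all_classical all_reals all_analysis.
From mathcomp Require Import measurable_realfun.

Set Implicit Arguments.
Unset Strict Implicit.
Unset Printing Implicit Defensive.

Import Order.TTheory GRing.Theory Num.Theory.
Import numFieldNormedType.Exports.

Local Open Scope classical_set_scope.
Local Open Scope ring_scope.
Local Open Scope ereal_scope.

Notation plane R := (measurableTypeR R * measurableTypeR R)%type.

Section sub_sigma_algebras.
Context {R : realType} {d} {T : measurableType d} (P : probability T R).

Definition measurable_wrt (G : set (set T)) (f : T -> R) : Prop :=
  forall C : set R, measurable C -> G (f @^-1` C).

(* g is a version of E[f | G] *)
Definition is_condexp (G : set (set T)) (f g : T -> R) : Prop :=
  [/\ P.-integrable setT (EFin \o f), P.-integrable setT (EFin \o g),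
      measurable_wrt G g &
      forall A, G A -> \int[P]_(w in A) (g w)%:E = \int[P]_(w in A) (f w)%:E].

Definition is_filtration (n : nat) (G : nat -> set (set T)) : Prop :=
  (forall k, (k <= n)%N ->
     sigma_algebra setT (G k) /\ G k `<=` @measurable d T) /\
  (forall j k, (j <= k <= n)%N -> G j `<=` G k).

Definition is_martingale (n : nat) (G : nat -> set (set T)) (S : nat -> T -> R)
    : Prop :=
  [/\ is_filtration n G,
      forall k, (k <= n)%N ->
        measurable_wrt (G k) (S k) /\ P.-integrable setT (EFin \o S k) &
      forall k, (k < n)%N -> is_condexp (G k) (S k.+1) (S k)].

(* U converges to Z in L^2(Omega) along the filter F *)
Definition cvgL2 {I : Type} (F : set_system I) (U : I -> T -> R) (Z : T -> R)
    : Prop :=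
  [/\ measurable_fun setT Z, 'N[P]_2%:E[EFin \o Z] < +oo &
      (fun i => 'N[P]_2%:E[(fun w => (U i w - Z w)%:E)]) @ F --> 0].

End sub_sigma_algebras.

(* B is an admissible constant B_p in Rosenthal's inequality, for every
   probability space; V k is a version of E[X_{k+1}^2 | G_k].  The exponent p/2
   is p./2 because p is only used when it is even. *)
Definition rosenthal_constant {R : realType} (p : nat) (B : R) : Prop :=
  (0 < B)%R /\
  forall (d : measure_display) (T : measurableType d) (P : probability T R)
    (n : nat) (G : nat -> set (set T)) (S V : nat -> T -> R),
    is_martingale P n G S ->
    (forall w, S 0%N w = 0%R) ->
    (forall k, (k < n)%N ->
       'N[P]_(p%:R%:E)[(fun w => (S k.+1 w - S k w)%:E)] < +oo) ->
    (forall k, (k < n)%N ->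
       is_condexp P (G k) (fun w => ((S k.+1 w - S k w) ^+ 2)%R) (V k)) ->
    \int[P]_w (\big[Num.max/0%R]_(k < n.+1) (`|S k w| ^+ p))%:E <=
    (B ^+ p)%:E *
      (\int[P]_w ((\sum_(k < n) V k w) ^+ p./2)%:E +
       \sum_(k < n) \int[P]_w (`|S k.+1 w - S k w| ^+ p)%:E).

(* number of partitions of a p-element set into blocks of size at least 2 *)
Definition partitions_ge2 (p : nat) : nat :=
  #|[pred Q : {set {set 'I_p}} |
      finset.partition Q (finset.setTfor 'I_p)
      && [forall D in Q, 1 < #|pred_of_set D|]%N]|.

(* A measure on R \ {0} is encoded as a measure nu on R with nu {0} = 0. *)
Section constants.
Context {R : realType} (nu : {measure set (measurableTypeR R) -> \bar R}).

Definition moment (p : nat) : \bar R :=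
  \int[nu]_(z in [set z | (z : R) != 0%R]) (`|z : R| ^+ p)%:E.

(* For nu = 0 this p-th root is 0. *)
Definition constC (B : R) (p : nat) : R :=
  ((2 * B ^+ p * (partitions_ge2 p)%:R *
    Num.max (fine (moment 2) `^ (p%:R / 2)) (fine (moment p))) `^ p%:R^-1)%R.

End constants.

Section poisson.
Context {R : realType} {d} {T : measurableType d} (P : probability T R).

(* Unlike poisson_pmf of the library, correct also at rate r = 0. *)
Definition poisson_weight (r : R) (k : nat) : R :=
  (r ^+ k / k`!%:R * expR (- r))%R.

Definition poisson_random_measure {d'} {E : measurableType d'}
    (m : {measure set E -> \bar R}) (N : R.-ker T ~> E) : Prop :=
  [/\ forall A, measurable A -> m A < +oo -> forall k : nat,
        P [set w | N w A = k%:R%:E] = (poisson_weight (fine (m A)) k)%:E,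
      forall A, measurable A -> m A = +oo -> P [set w | N w A = +oo] = 1 &
      forall (n : nat) (A : 'I_n -> set E) (C : 'I_n -> set (\bar R)),
        (forall i, measurable (A i)) -> trivIset setT A ->
        (forall i, measurable (C i)) ->
        P (\bigcap_(i in setT) [set w | C i (N w (A i))]) =
        \prod_(i < n) P [set w | C i (N w (A i))]].

(* Simple integrands sum_j c_j 1_{B_j} on E, as lists of pairs (c_j, B_j);
   their integrals against N - m; the L^2 integral against N - m as the
   extension by L^2 limits. *)
Section compensated_integral.
Context {d'} {E : measurableType d'}.
Variables (m : {measure set E -> \bar R}) (N : R.-ker T ~> E).

Definition simple_fun (s : seq (R * set E)) (e : E) : R :=
  (\sum_(cB <- s) cB.1 * \1_(cB.2) e)%R.

Definition simple_admissible (s : seq (R * set E)) : Prop :=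
  forall j, (j < size s)%N ->
    let A := (nth (0%R, set0) s j).2 in measurable A /\ m A < +oo.

Definition simple_compensated (s : seq (R * set E)) (w : T) : R :=
  (\sum_(cB <- s) cB.1 * (fine (N w cB.2) - fine (m cB.2)))%R.

Definition is_compensated_integral (f : E -> R) (Y : T -> R) : Prop :=
  exists s : nat -> seq (R * set E),
    [/\ forall k, simple_admissible (s k),
        (fun k => 'N[m]_2%:E[(fun e => (simple_fun (s k) e - f e)%:E)])
          @ \oo --> 0 &
        cvgL2 P \oo (fun k => simple_compensated (s k)) Y].

End compensated_integral.
End poisson.

Section ito.
Context {R : realType} {d} {Omega : measurableType d}.
Variable P : probability Omega R.
Variable nu : {measure set (measurableTypeR R) -> \bar R}.
Variable N : R.-ker Omega ~> plane R.

(* dx nu(dz); the product \x^ only needs its first factor sigma-finite *)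
Definition intensity : {measure set (plane R) -> \bar R} :=
  (@lebesgue_measure R \x^ nu).

Definition bounded_borel (A : set R) : Prop :=
  measurable A /\ exists M : R, forall x, A x -> (`|x| <= M)%R.

(* bounded for the distance |x^-1 - y^-1| on R \ {0} *)
Definition bounded_borel0 (A : set R) : Prop :=
  measurable A /\ exists2 e : R, (0 < e)%R & forall x, A x -> (e <= `|x|)%R.

(* each L A is a version of the compensated integral of z over A x R_0 *)
Definition is_levy_noise (L : set R -> Omega -> R) : Prop :=
  forall A, bounded_borel A ->
    is_compensated_integral P intensity N
      (fun xz : plane R => (\1_A (xz.1 : R) * (xz.2 : R))%R) (L A).

Definition filtration (x : R) : set (set Omega) :=
  <<s [set D | exists a b : R, exists (Gam : set R) (C : set (\bar R)),
        [/\ (a < b)%R /\ (b <= x)%R, bounded_borel0 Gam, measurable C &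
            D = [set w | C (N w (`[a, b] `*` Gam))]]]
      `|` [set D | P.-negligible D] >>.

(* sum_(i < n) Y_i 1_(b_i, b_{i+1}] with Y_i bounded and F_{b_i}-measurable;
   Y_i here is Y_{i+1} in the usual numbering *)
Record simple_process := SimpleProcess {
  sp_size : nat;
  sp_knot : nat -> R;
  sp_coef : nat -> Omega -> R;
  sp_knot_lt : forall i, (i < sp_size)%N -> (sp_knot i < sp_knot i.+1)%R;
  sp_coef_bounded : forall i, (i < sp_size)%N ->
    exists M : R, forall w, (`|sp_coef i w| <= M)%R;
  sp_coef_measurable : forall i, (i < sp_size)%N ->
    measurable_wrt (filtration (sp_knot i)) (sp_coef i)
}.

Definition sp_fun (S : simple_process) (w : Omega) (x : R) : R :=
  (\sum_(i < sp_size S)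
     sp_coef S i w * \1_(`]sp_knot S i, sp_knot S i.+1]%classic) x)%R.

Definition predictable_sigma : set (set (Omega * R)) :=
  <<s [set D | exists (S : simple_process) (C : set R),
        measurable C /\ D = [set wx | C (sp_fun S wx.1 wx.2)]] >>.

Definition predictable (X : Omega -> R -> R) : Prop :=
  forall C : set R, measurable C ->
    predictable_sigma [set wx | C (X wx.1 wx.2)].

(* [X]_{K,2} *)
Definition normK2 (K : R) (X : Omega -> R -> R) : \bar R :=
  (\int[P]_w \int[lebesgue_measure]_(x in `[(- K)%R, K])
     (`|X w x| ^+ 2)%:E) `^ 2^-1.

(* [X]_p = |X|_{L^p(Omega; L^2(R))} + |X|_{L^p(Omega x R)} *)
Definition normp (p : nat) (X : Omega -> R -> R) : \bar R :=
  'N[P]_(p%:R%:E)[(fun w => 'N[@lebesgue_measure R]_2%:E[EFin \o X w])] +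
  'N[P \x @lebesgue_measure R]_(p%:R%:E)
     [(fun wx : Omega * measurableTypeR R => (X wx.1 wx.2)%:E)].

Definition Lpstar (p : nat) : set (Omega -> R -> R) :=
  [set X | predictable X /\ normp p X < +oo].

Variable L : set R -> Omega -> R.

Definition simple_integral (K : R) (S : simple_process) (w : Omega) : R :=
  (\sum_(i < sp_size S) sp_coef S i w *
     L (`]sp_knot S i, sp_knot S i.+1] `&` `[(- K)%R, K]) w)%R.

(* Z is a version of I_K(X) *)
Definition is_ito_integralK (K : R) (X : Omega -> R -> R) (Z : Omega -> R)
    : Prop :=
  exists S : nat -> simple_process,
    (forall K' : R, (0 < K')%R ->
       (fun k => normK2 K' (fun w x => (sp_fun (S k) w x - X w x)%R))
         @ \oo --> 0) /\
    cvgL2 P \oo (fun k => simple_integral K (S k)) Z.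

(* Z is a version of I(X) *)
Definition is_ito_integral (X : Omega -> R -> R) (Z : Omega -> R) : Prop :=
  exists I : R -> Omega -> R,
    (forall K : R, (0 < K)%R -> is_ito_integralK K X (I K)) /\
    cvgL2 P (pinfty_nbhs R) I Z.

End ito.

(* Main.v *)
(* Let X be simple with knots t_0 < ... < t_n.  The partial sums of
   I_K(X) = sum_i Y_i L(A_i) form a martingale for the sigma-algebras generated
   by N to the left of the knots, because L(A_i) is independent of the past.
   Rosenthal's inequality bounds the p-th moment of I_K(X) by
   sum_i E|Y_i|^p E|L(A_i)|^p plus the conditional-variance term.

   The Stein identity for Poisson variables shows that the moments of a
   compensated Poisson integral satisfy the cumulant recursion, whence
   E|L(A)|^p <= |A| (m_p + c|A|) for |A| <= 1.  Bisecting the knots changes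
   neither X nor its integral and lets the mesh tend to 0, which removes the
   term c|A|.  Only the one-block partition thus contributes, and the constant
   C_p^* enters through C_p^* >= 1 alone.

   For general X, the given simple processes S_k converge to X in L^2 only.
   Clipping their coefficients at a level M yields simple processes whose p-th
   norms converge to those of X clipped at M, hence stay controlled by those of
   X, while the isometry makes their integrals close to I_K(X) once M and then
   k are large.  Fatou's lemma gives the bound on [-K, K], and once more as K
   tends to infinity. *)

Require Import Defs.
From HB Require Import structures.
From mathcomp Require Import all_boot all_order all_algebra.
From mathcomp Require Import all_classical all_reals all_analysis.
From mathcomp Require Import measurable_realfun.
From mathcomp Require Import ring lra zify.

Set Implicit Arguments.
Unset Strict Implicit.
Unset Printing Implicit Defensive.

Import Order.TTheory GRing.Theory Num.Theory.
Import numFieldNormedType.Exports.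

Local Open Scope classical_set_scope.
Local Open Scope ring_scope.
Local Open Scope ereal_scope.

(** * Independence *)

(** Three obstacles shape the proof. Each [L A] is only an L^2 limit, and the approximations that
    define it have no controlled moments of order p. The isometry lets them be exchanged for step
    integrands on disjoint rectangles over A, with values dominated by |z|. Their moments obey an
    exact recursion, and Fatou's lemma carries the bounds to [L A]. The same exchange makes [L A]
    measurable with respect to the noise over A, hence independent of the past. With a = |A|, the
    cumulants of order 2 to p and the moments of order 1 to p are O(a); in the recursion for the
    p-th moment all terms are then O(a^2), except the cumulant of order p, which is at most a m_p.
    Convergence in L^2 says nothing about p-th powers. For coefficients bounded by M, the r-th power
    of a clipped value s exceeds that of x by at most r M^(r-1) |s - x|, and |s - x| <= dl + |s -
    x|^2 / dl turns this into squares; the constant dl is integrable because the window is finite.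
    As the constants grow with M, the level M is fixed first, then dl, then the index k. *)

Section independence.
Context {R : realType} {d} {T : measurableType d} (P : probability T R).

Definition indep (F G : set (set T)) :=
  forall A B, F A -> G B -> P (A `&` B) = P A * P B.

Lemma indepC F G : indep F G -> indep G F.
Proof. by move=> FG A B GA FB; rewrite setIC FG// muleC. Qed.

(** For fixed [B] in [G], the set functions P(A & B) and P(A) P(B) of [A] are finite measures that
    agree on the pi-system [F]. [F'] adjoins [setT], which serves as the exhausting sequence in the
    uniqueness theorem. *)
Lemma indep_g_sigmal F G : setI_closed F -> F `<=` measurable ->
  G `<=` measurable -> indep F G -> indep <<s F >> G.
Proof.
move=> IF mF mG FG A B FA GB.
pose k : {nonneg R} := NngNum (fine_ge0 (measure_ge0 P B)).
have mB : measurable B by exact: mG.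
have kE : (k%:num)%:E = P B by rewrite /k/= fineK// fin_num_measure.
pose m1 := mrestr P mB; pose m2 := mscale k P.
pose F' := F `|` [set setT].
have m12 C : F' C -> m1 C = m2 C.
  rewrite /m1 /m2 /mrestr /mscale /= kE => -[FC|->].
    by rewrite FG// muleC.
  by rewrite setTI probability_setT mule1.
have F'A : <<s F' >> A.
  by move: A FA; apply: sub_sigma_algebra2 => C FC; left.
have -> : P A * P B = m2 A by rewrite /m2 /mscale/= kE muleC.
change (m1 A = m2 A).
apply: (@g_sigma_algebra_measure_unique _ _ _ F' _ (fun=> setT)) => //.
- by move=> C [/mF//|->].
- by move=> i; right.
- by rewrite bigcup_const//; exists 0%N.
- move=> C D [FC|->] [FD|->]; rewrite ?setIT ?setTI; by [left; exact: IF|left|right].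
- move=> i; rewrite /m1 /mrestr.
  by apply: le_lt_trans (probability_le1 _ _) _; rewrite ?ltry//; exact: measurableI.
Qed.

Lemma indep_g_sigma F G : setI_closed F -> setI_closed G ->
  F `<=` measurable -> G `<=` measurable -> indep F G -> indep <<s F >> <<s G >>.
Proof.
move=> IF IG mF mG FG.
have mF' : <<s F >> `<=` @measurable _ T.
  by apply: smallest_sub => //; exact: sigma_algebra_measurable.
by apply/indepC/indep_g_sigmal => //; apply/indepC/indep_g_sigmal.
Qed.

Section product_expectation.
Variables (f g : T -> R).
Hypotheses (mf : measurable_fun setT f) (mg : measurable_fun setT g).
Hypothesis fg : forall A B : set R, measurable A -> measurable B ->
  P (f @^-1` A `&` g @^-1` B) = P (f @^-1` A) * P (g @^-1` B).

Let F : {mfun T >-> R} := HB.pack f (isMeasurableFun.Build _ _ _ _ f mf).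
Let G : {mfun T >-> R} := HB.pack g (isMeasurableFun.Build _ _ _ _ g mg).

Let mh : measurable_fun setT (fun w => (f w, g w)).
Proof. exact/measurable_fun_pair. Qed.
Let H : {mfun T >-> (R * R)%type} := HB.pack (fun w => (f w, g w)) (isMeasurableFun.Build _ _ _ _ _ mh).

(** By [fg] the joint law agrees with the product of the two laws on rectangles, hence everywhere.
    The expectations below then factor by Fubini's theorem. *)
Let joint X : measurable X -> (distribution P F \x distribution P G) X = distribution P H X.
Proof. by move=> mX; apply: product_measure_unique. Qed.

Let mnorm : measurable_fun setT (fun x : R => `|x|%:E).
Proof. by apply/measurable_EFinP; exact: normr_measurable. Qed.

Lemma indep_ge0_integralM : (forall w, 0 <= f w)%R -> (forall w, 0 <= g w)%R ->
  \int[P]_w (f w * g w)%:E = \int[P]_w (f w)%:E * \int[P]_w (g w)%:E.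
Proof.
move=> f0 g0.
(* The absolute values make the integrand non-negative on the whole plane, as Tonelli's theorem
   demands; on the values of [f] and [g] they change nothing. *)
pose phi (x : R * R) := (`|x.1| * `|x.2|)%:E : \bar R.
have phi0 x : 0 <= phi x by rewrite lee_fin mulr_ge0.
have mphi : measurable_fun setT phi.
  by apply/measurable_EFinP; apply: measurable_funM; apply: measurableT_comp.
transitivity (\int[distribution P H]_x phi x).
  rewrite ge0_integral_pushforward// preimage_setT.
  by apply: eq_integral => w _; rewrite /phi /= !ger0_norm.
transitivity (\int[distribution P F \x distribution P G]_x phi x).
  by apply: eq_measure_integral => A mA _; exact: (esym (joint mA)).
rewrite fubini_tonelli1//= /fubini_F.
transitivity (\int[distribution P F]_x (`|x|%:E * \int[P]_w (g w)%:E)).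
  apply: eq_integral => x _; rewrite /phi /=.
  under eq_integral do rewrite EFinM.
  rewrite ge0_integralZl//.
  congr (_ * _); rewrite ge0_integral_pushforward//.
  by rewrite preimage_setT; apply: eq_integral => w _ /=; rewrite ger0_norm.
rewrite ge0_integralZr//; last first.
  by apply: integral_ge0 => w _; rewrite lee_fin.
congr (_ * _); rewrite ge0_integral_pushforward//.
by rewrite preimage_setT; apply: eq_integral => w _ /=; rewrite ger0_norm.
Qed.

Hypotheses (intf : P.-integrable setT (EFin \o f))
  (intg : P.-integrable setT (EFin \o g)).

Let phi (x : R * R) := (x.1 * x.2)%:E : \bar R.

Let mphi : measurable_fun setT phi.
Proof.
by apply/measurable_EFinP; apply: measurable_funM; [exact: measurable_fst|exact: measurable_snd].
Qed.

Let intF : (distribution P F).-integrable setT (@EFin R).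
Proof. by apply: integrable_pushforward. Qed.

Let intG : (distribution P G).-integrable setT (@EFin R).
Proof. by apply: integrable_pushforward. Qed.

Let intphi : (distribution P F \x distribution P G).-integrable setT phi.
Proof.
apply/integrable12ltyP => //=.
rewrite /phi /=.
under eq_integral => x _.
  under eq_integral do rewrite normrM EFinM.
  rewrite ge0_integralZl//.
  over.
rewrite ge0_integralZr//; last first.
  by apply: integral_ge0 => w _; rewrite lee_fin.
move/integrableP : intF => [_ oF]; move/integrableP : intG => [_ oG].
by rewrite lte_mul_pinfty ?integral_ge0// ge0_fin_numE// integral_ge0.
Qed.

Let intphiH : (distribution P H).-integrable setT phi.
Proof.
have := intphi; move=> /integrableP[_ oo]; apply/integrableP; split => //.
rewrite (_ : \int[_]_x _ = \int[distribution P F \x distribution P G]_x `|phi x|)//.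
by apply: eq_measure_integral => A mA _; exact: (esym (joint mA)).
Qed.

Lemma indep_integrableM : P.-integrable setT (EFin \o (f \* g)%R).
Proof.
have /integrableP[_ oo] := intphiH; apply/integrableP; split => //.
  by apply/measurable_EFinP; exact: measurable_funM.
move: oo; rewrite ge0_integral_pushforward//.
exact: measurableT_comp.
Qed.

Lemma indep_RintegralM :
  (\int[P]_w (f w * g w) = \int[P]_w f w * \int[P]_w g w)%R.
Proof.
rewrite /Rintegral -fineM ?integrable_fin_num//; congr fine.
transitivity (\int[distribution P H]_x phi x).
  by rewrite integral_pushforward// preimage_setT; exact: indep_integrableM.
transitivity (\int[distribution P F \x distribution P G]_x phi x).
  by apply: eq_measure_integral => A mA _; exact: (esym (joint mA)).
rewrite -integral12_prod_meas1//.
transitivity (\int[distribution P F]_x (x%:E * \int[P]_w (g w)%:E)).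
  apply: eq_integral => x _; rewrite /fubini_F /phi /=.
  under eq_integral do rewrite EFinM.
  rewrite integralZl//; congr (_ * _).
  by rewrite integral_pushforward// preimage_setT.
have /fineK <- : \int[P]_w (g w)%:E \is a fin_num by exact: integrable_fin_num.
by rewrite integralZr// integral_pushforward// preimage_setT.
Qed.

End product_expectation.
End independence.

(** * The sigma-algebras generated by a Poisson random measure *)

Section poisson_sigma.
Context {R : realType} {d} {Omega : measurableType d} (P : probability Omega R).
Context {d'} {E : measurableType d'}.
Variables (m : {measure set E -> \bar R}) (N : R.-ker Omega ~> E).
Hypothesis prm : poisson_random_measure P m N.

(** The index is an arbitrary finite type, so that two families can be joined over [I + J] and atoms
    can be indexed by [{set I}]. *)
Definition cylinder (I : finType) (A : I -> set E) (C : I -> set (\bar R)) :=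
  [set w | forall i, C i (N w (A i))].

Lemma measurable_cylinder (I : finType) A C :
  (forall i : I, measurable (A i)) -> (forall i, measurable (C i)) ->
  measurable (cylinder A C).
Proof.
move=> mA mC; rewrite (_ : cylinder A C = \bigcap_(i in setT) ((N ^~ (A i)) @^-1` C i)).
  apply: fin_bigcap_measurable => // i _; rewrite -[X in measurable X]setTI.
  exact: measurable_kernel.
by apply/seteqP; split => w /= h i; [move=> _; exact: h|exact: h].
Qed.

Lemma cylinder_prod (I : finType) A C :
  (forall i : I, measurable (A i)) -> trivIset setT A ->
  (forall i, measurable (C i)) ->
  P (cylinder A C) = \prod_(i : I) P [set w | C i (N w (A i))].
Proof.
move=> mA tA mC; have [_ _ /(_ #|I| (A \o enum_val) (C \o enum_val))] := prm.
rewrite /= => h; rewrite [RHS](reindex (@enum_val I I)) /=; last first.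
  by exists enum_rank => i _; [exact: enum_valK|exact: enum_rankK].
rewrite -h//.
- congr (P _); apply/seteqP; split => w /= H i; first by move=> _; exact: H.
  by have := H (enum_rank i) Logic.I; rewrite enum_rankK.
- by move=> i j _ _ /(tA _ _ Logic.I Logic.I)/enum_val_inj.
Qed.

Definition cylinders (I : finType) (A : I -> set E) : set (set Omega) :=
  [set D | exists2 C : I -> set (\bar R), (forall i, measurable (C i)) & D = cylinder A C].

Lemma cylinders_setI_closed (I : finType) (A : I -> set E) : setI_closed (cylinders A).
Proof.
move=> _ _ [C mC ->] [C' mC' ->]; exists (fun i => C i `&` C' i).
  by move=> i; exact: measurableI.
by apply/seteqP; split => [w [h h'] i|w h]; [split|split => i; have [] := h i].
Qed.

Lemma cylinders_measurable (I : finType) (A : I -> set E) :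
  (forall i, measurable (A i)) -> cylinders A `<=` measurable.
Proof. by move=> mA _ [C mC ->]; exact: measurable_cylinder. Qed.

(** The two families together form one disjoint family over [I + J], for which the probability of a
    cylinder is a product; the pi-system argument extends this to the generated sigma-algebras. *)
Lemma indep_cylinders (I J : finType) (A : I -> set E) (B : J -> set E) :
  (forall i, measurable (A i)) -> (forall j, measurable (B j)) ->
  trivIset setT A -> trivIset setT B -> (forall i j, A i `&` B j = set0) ->
  indep P <<s cylinders A >> <<s cylinders B >>.
Proof.
move=> mA mB tA tB AB; apply: indep_g_sigma; do ?[exact: cylinders_setI_closed|exact: cylinders_measurable].
move=> _ _ [C mC ->] [C' mC' ->].
pose AA (x : I + J) := match x with inl i => A i | inr j => B j end.
pose CC (x : I + J) := match x with inl i => C i | inr j => C' j end.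
transitivity (P (cylinder AA CC)).
  congr (P _); apply/seteqP; split => [w [h h'] [i|j]|w h]; [exact: h|exact: h'|].
  by split => i; [exact: (h (inl i))|exact: (h (inr i))].
rewrite !cylinder_prod//; last 3 first.
- by case.
- move=> [i|j] [i'|j'] _ _ /=.
  + by move=> /(tA _ _ Logic.I Logic.I) ->.
  + by rewrite AB => -[].
  + by rewrite setIC AB => -[].
  + by move=> /(tB _ _ Logic.I Logic.I) ->.
- by case.
by rewrite big_sumType.
Qed.

Lemma kernel_cylinders (I : finType) (A : I -> set E) i :
  measurable_fun [set: g_sigma_algebraType (cylinders A)]
    (fun w : g_sigma_algebraType (cylinders A) => N w (A i)).
Proof.
move=> _ Y mY; rewrite setTI; apply: sub_sigma_algebra.
exists (fun j => if j == i then Y else setT).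
  by move=> j; case: ifP.
apply/seteqP; split => w /= h; last by have := h i; rewrite eqxx.
by move=> j; case: ifPn => // /eqP ->.
Qed.

(* The values of [N] on the [A i] are sums of its values on the atoms of the
   family. *)
Definition atom (U : set E) (I : finType) (A : I -> set E) (K : {set I}) : set E :=
  U `&` [set x | forall i, (i \in K) = `[< A i x >]].

Lemma trivIset_atom U (I : finType) (A : I -> set E) : trivIset setT (atom U A).
Proof.
by move=> K L _ _ [x [[_ xK] [_ xL]]]; apply/setP => i; rewrite xK xL.
Qed.

Lemma measurable_atom U (I : finType) (A : I -> set E) K : measurable U ->
  (forall i, measurable (A i)) -> measurable (atom U A K).
Proof.
move=> mU mA; apply: measurableI => //.
rewrite (_ : mkset _ = \bigcap_(i in setT) (if i \in K then A i else ~` A i)).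
  by apply: fin_bigcap_measurable => // i _; case: ifP => _ //; exact: measurableC.
apply/seteqP; split => x /= h i; first by move=> _; rewrite h; case: asboolP.
by have := h i Logic.I; case: ifPn => [_ /asboolP ->//|_ /asboolPn/negbTE ->].
Qed.

Lemma kernel_atom U (I : finType) (A : I -> set E) i w : measurable U ->
  (forall i, measurable (A i)) -> A i `<=` U ->
  N w (A i) = \sum_(K \in [set K : {set I} | i \in K]) N w (atom U A K).
Proof.
move=> mU mA AU; rewrite -measure_fin_bigcup//.
- congr (N w _); apply/seteqP; split => x.
    move=> Ax; exists [set j | `[< A j x >]]%SET => /=; first by rewrite inE; apply/asboolP.
    by split; [exact: AU|move=> j /=; rewrite inE].
  by move=> [K /= iK [_ /(_ i)]]; rewrite iK => /esym/asboolP.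
- exact: finite_finset.
- by move=> K L _ _; exact: trivIset_atom.
- by move=> K _; exact: measurable_atom.
Qed.

(** Poisson independence speaks of disjoint sets only. An event about overlapping sets is expressed
    through the atoms, which are disjoint and stay inside [U]. *)
Lemma cylinder_atoms U (I : finType) (A : I -> set E) C : measurable U ->
  (forall i, measurable (A i)) -> (forall i, A i `<=` U) ->
  (forall i, measurable (C i)) -> <<s cylinders (atom U A) >> (cylinder A C).
Proof.
move=> mU mA AU mC.
rewrite (_ : cylinder A C = \bigcap_(i in setT)
  ((fun w => \sum_(K \in [set K : {set I} | i \in K]) N w (atom U A K)) @^-1` C i)).
  apply: (@fin_bigcap_measurable _ (g_sigma_algebraType (cylinders (atom U A)))) => // i _.
  rewrite -[X in measurable X]setTI; apply: emeasurable_fsum => //.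
    exact: finite_finset.
  by move=> K; exact: kernel_cylinders.
by apply/seteqP; split => w /= h i; [move=> _; have := h i|have := h i Logic.I];
  rewrite (kernel_atom w mU mA (AU i)).
Qed.

Definition pcylinders (U : set E) : set (set Omega) :=
  [set D | exists (I : finType) (A : I -> set E) (C : I -> set (\bar R)),
    [/\ forall i, measurable (A i), forall i, A i `<=` U, forall i, measurable (C i) &
     D = cylinder A C]] `|` [set D | P.-negligible D].

(* Null sets are included so that L^2-limits remain measurable. *)
Definition sigmaN (U : set E) := <<s pcylinders U >>.

Lemma pcylinders_setI_closed U : setI_closed (pcylinders U).
Proof.
move=> D D' [|nD]; last by right; apply: negligibleS nD => x [].
move=> [I [A [C [mA AU mC ->]]]] [|nD]; last by right; apply: negligibleS nD => x [].
move=> [J [B [C' [mB BU mC' ->]]]]; left.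
exists (I + J)%type, (fun x => match x with inl i => A i | inr j => B j end),
  (fun x => match x with inl i => C i | inr j => C' j end).
split; [by case|by case|by case|].
apply/seteqP; split => [w [h h'] [i|j]|w h]; [exact: h|exact: h'|].
by split => i; [exact: (h (inl i))|exact: (h (inr i))].
Qed.

Hypothesis Pc : measure_is_complete P.

Lemma pcylinders_measurable U : pcylinders U `<=` measurable.
Proof.
by move=> D [[I [A [C [mA AU mC ->]]]]|/Pc//]; exact: measurable_cylinder.
Qed.

Lemma sigmaN_measurable U : sigmaN U `<=` measurable.
Proof.
apply: smallest_sub; last exact: pcylinders_measurable.
exact: sigma_algebra_measurable.
Qed.

(** A null event is independent of every event. Two cylinders over [U] and [V] are events of the
    respective atoms, and these are disjoint because [U] and [V] are. *)
Lemma indep_sigmaN U V : measurable U -> measurable V -> U `&` V = set0 ->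
  indep P (sigmaN U) (sigmaN V).
Proof.
move=> mU mV UV; apply: indep_g_sigma; do ?[exact: pcylinders_setI_closed|exact: pcylinders_measurable].
have null D D' : measurable D -> measurable D' -> P.-negligible D' -> P (D `&` D') = P D * P D'.
  move=> mD mD' nD; rewrite (_ : P D' = 0) ?mule0.
    by apply/negligibleP; [exact: measurableI|apply: negligibleS nD => x []].
  exact/negligibleP.
move=> D D' pD pD'; have mD := pcylinders_measurable pD; have mD' := pcylinders_measurable pD'.
case: pD' => [pD'|]; last exact: null.
case: pD => [pD|]; last by rewrite setIC muleC; exact: null.
move: pD pD' => [I [A [C [mA AU mC ->]]]] [J [B [C' [mB BU mC' ->]]]].
apply: (@indep_cylinders _ _ (atom U A) (atom V B)).
- by move=> K; exact: measurable_atom.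
- by move=> K; exact: measurable_atom.
- exact: trivIset_atom.
- exact: trivIset_atom.
- move=> K L; rewrite -subset0 -UV => x [[Ux _] [Vx _]]//.
- exact: cylinder_atoms.
- exact: cylinder_atoms.
Qed.

Lemma sub_sigmaN U V : U `<=` V -> sigmaN U `<=` sigmaN V.
Proof.
move=> UV; apply: sub_sigma_algebra2 => D [|]; last by right.
move=> [I [A [C [mA AU mC ->]]]]; left; exists I, A, C; split => // i.
exact: subset_trans UV.
Qed.

Lemma sigmaN_negligible U D : P.-negligible D -> sigmaN U D.
Proof. by move=> nD; apply: sub_sigma_algebra; right. Qed.

Lemma kernel_sigmaN U A C : measurable A -> A `<=` U -> measurable C ->
  sigmaN U [set w | C (N w A)].
Proof.
move=> mA AU mC; apply: sub_sigma_algebra; left.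
exists unit, (fun=> A), (fun=> C); split => //.
by apply/seteqP; split => w /= h //; exact: h tt.
Qed.

End poisson_sigma.

(** * Moments and cumulants *)

Section poisson_moments.
Context {R : realType} {d} {Omega : measurableType d} (P : probability Omega R).
Context {d'} {E : measurableType d'}.
Variables (m : {measure set E -> \bar R}) (N : R.-ker Omega ~> E).
Hypothesis prm : poisson_random_measure P m N.
Variable B : set E.
Hypotheses (mB : measurable B) (finB : m B < +oo).

Let lam := fine (m B).
Let X w := fine (N w B).

Let lam0 : (0 <= lam)%R. Proof. exact: fine_ge0. Qed.

Lemma measurable_count : measurable_fun setT X.
Proof. by apply: measurableT_comp => //; exact: measurable_kernel. Qed.

Lemma poisson_weight_ge0 (r : R) k : (0 <= r)%R -> (0 <= poisson_weight r k)%R.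
Proof. by move=> r0; rewrite /poisson_weight mulr_ge0 ?expR_ge0// divr_ge0// exprn_ge0. Qed.

Lemma poisson_weight_sum (r : R) : (0 <= r)%R -> \sum_(k <oo) (poisson_weight r k)%:E = 1.
Proof.
move=> r0; transitivity (\sum_(k <oo) ((expR (- r))%:E * (r ^+ k / k`!%:R)%:E)).
  by apply: eq_eseriesr => k _; rewrite /poisson_weight mulrC EFinM.
rewrite nneseriesZl; last by move=> k _; rewrite lee_fin divr_ge0// exprn_ge0.
have -> : \sum_(k <oo) (r ^+ k / k`!%:R)%:E = (expR r)%:E.
  rewrite expRE -EFin_lim; last first.
    rewrite /pseries/=; under eq_fun do rewrite mulrC.
    exact: is_cvg_series_exp_coeff.
  apply/congr_lim/funext => n/=; rewrite /pseries/= /series/= -sumEFin//.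
  by under eq_bigr do rewrite mulrC.
by rewrite -EFinM -expRD addNr expR0.
Qed.

Let Ev k := [set w | N w B = k%:R%:E].

Let mEv k : measurable (Ev k).
Proof.
rewrite (_ : Ev k = (N ^~ B) @^-1` [set k%:R%:E]); last by [].
by rewrite -[X in measurable X]setTI; exact: measurable_kernel.
Qed.

Let tEv : trivIset setT Ev.
Proof. by move=> i j _ _ [w []]; rewrite /Ev /= => -> -[/eqP]; rewrite eqr_nat => /eqP. Qed.

Let PEv k : P (Ev k) = (poisson_weight lam k)%:E.
Proof. by have [/(_ B mB finB k) ->] := prm. Qed.

Let PU : P (~` \bigcup_k Ev k) = 0.
Proof.
rewrite probability_setC; last exact: bigcupT_measurable.
rewrite measure_bigcup//= (_ : \sum_(k <oo | k \in setT) P (Ev k) = 1) ?subee//.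
rewrite (@eq_eseriesl _ _ xpredT); last by move=> k; rewrite in_setT.
by rewrite -(poisson_weight_sum lam0); apply: eq_eseriesr => k _; exact: PEv.
Qed.

(** The Poisson weights sum to 1, so the count is almost surely a natural number and [fine] loses
    nothing. *)
Lemma count_ae : {ae P, forall w, N w B = (X w)%:E}.
Proof.
exists (~` \bigcup_k Ev k); split => //.
  by apply: measurableC; exact: bigcupT_measurable.
by move=> w /=; apply: contra_not => -[k _ /=]; rewrite /X => ->.
Qed.

Lemma poisson_integral (g : R -> R) : measurable_fun setT g -> (forall x, 0 <= g x)%R ->
  \int[P]_w (g (X w))%:E = \sum_(k <oo) (g k%:R * poisson_weight lam k)%:E.
Proof.
move=> mg g0.
have mgX : measurable_fun setT (fun w => (g (X w))%:E).
  by apply/measurable_EFinP; apply: measurableT_comp => //; exact: measurable_count.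
have mU : measurable (\bigcup_k Ev k) by exact: bigcupT_measurable.
rewrite (@ge0_negligible_integral _ _ _ P setT (~` \bigcup_k Ev k))//; last 2 first.
  exact: measurableC.
  by move=> w _; rewrite lee_fin.
rewrite setTD setCK ge0_integral_bigcup//; last 2 first.
  exact: measurable_funS mgX.
  by move=> w _; rewrite lee_fin.
apply: eq_eseriesr => k _.
rewrite (eq_integral (cst (g k%:R)%:E)); last by move=> w; rewrite inE /X /= => ->.
by rewrite integral_cst//= PEv.
Qed.

(** The weights satisfy k w(k) = lam w(k - 1); the series on the left loses its term of index 0 and
    is shifted by one. *)
Lemma poisson_stein_ge0 (g : R -> R) : measurable_fun setT g -> (forall x, 0 <= g x)%R ->
  \int[P]_w (X w * g (X w))%:E = lam%:E * \int[P]_w (g (X w + 1)%R)%:E.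
Proof.
move=> mg g0.
have X0 w : (0 <= X w)%R by exact: fine_ge0.
(* The series formula wants a function that is non-negative on all of R, not only at the counts. *)
transitivity (\int[P]_w (`|X w| * g (X w))%:E).
  by apply: eq_integral => w _; rewrite ger0_norm.
rewrite (@poisson_integral (fun x => `|x| * g x)%R); last 2 first.
  by apply: measurable_funM => //; exact: normr_measurable.
  by move=> x; rewrite mulr_ge0.
rewrite (@poisson_integral (fun x => g (x + 1))%R)//; last first.
  by apply: measurableT_comp => //; exact: measurable_funD.
rewrite -nneseriesZl; last by move=> k _; rewrite lee_fin; apply: mulr_ge0 => //; exact: poisson_weight_ge0.
rewrite nneseries_recl//; last by move=> k _; rewrite lee_fin; apply: mulr_ge0; [exact: mulr_ge0|exact: poisson_weight_ge0].
rewrite normr0 !mul0r add0e -nneseries_addn; last first.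
  by move=> k; rewrite lee_fin; apply: mulr_ge0; [exact: mulr_ge0|exact: poisson_weight_ge0].
apply: eq_eseriesr => k _; rewrite addn1 -EFinM; congr EFin.
rewrite normr_nat natr1 /poisson_weight exprS factS natrM.
have : (k.+1%:R != 0 :> R)%R by rewrite pnatr_eq0.
have : (k`!%:R != 0 :> R)%R by rewrite pnatr_eq0 -lt0n fact_gt0.
move=> ? ?; set e := expR _; set gk := g _; field.
by apply/andP; split.
Qed.

(** Splitting off one factor X + c and applying the Stein identity to the summand with X lowers the
    exponent but raises the shift to 1 + c. The induction therefore runs over all shifts c >= 0. *)
Lemma count_shift_lty n (c : R) : (0 <= c)%R -> \int[P]_w ((X w + c) ^+ n)%:E < +oo.
Proof.
have X0 w : (0 <= X w)%R by exact: fine_ge0.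
have mX k (b : R) : measurable_fun setT (fun w => ((X w + b) ^+ k)%:E).
  apply/measurable_EFinP; apply: measurable_funX; apply: measurable_funD => //.
  exact: measurable_count.
elim: n c => [|n IH] c c0.
  under eq_integral do rewrite expr0.
  by rewrite integral_cst//= probability_setT mule1 ltry.
rewrite (eq_integral (fun w => (X w * (`|X w| + c) ^+ n)%:E + c%:E * ((X w + c) ^+ n)%:E)); last first.
  by move=> w _; rewrite ger0_norm// exprS mulrDl EFinD EFinM.
rewrite ge0_integralD//; last 4 first.
- by move=> w _; rewrite lee_fin mulr_ge0// exprn_ge0// addr_ge0.
- apply/measurable_EFinP; apply: measurable_funM; first exact: measurable_count.
  apply: measurable_funX; apply: measurable_funD => //; apply: measurableT_comp => //.
  exact: measurable_count.
- by move=> w _; rewrite -EFinM lee_fin mulr_ge0// exprn_ge0// addr_ge0.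
- by apply: emeasurable_funM => //; exact: mX.
rewrite ge0_integralZl//; last by move=> w _; rewrite lee_fin exprn_ge0// addr_ge0.
rewrite (@poisson_stein_ge0 (fun x => (`|x| + c) ^+ n)%R); last 2 first.
- apply: measurable_funX; apply: measurable_funD => //; exact: normr_measurable.
- by move=> x; rewrite exprn_ge0// addr_ge0.
have -> : \int[P]_w ((`|(X w + 1)%R| + c) ^+ n)%:E = \int[P]_w ((X w + (1 + c)) ^+ n)%:E.
  by apply: eq_integral => w _; rewrite ger0_norm ?addr_ge0// addrA.
apply: lte_add_pinfty.
- by rewrite lte_mul_pinfty ?lee_fin// IH// addr_ge0.
- by rewrite lte_mul_pinfty ?lee_fin// IH.
Qed.

Lemma integrable_count_shift n (a : R) : P.-integrable setT (fun w => ((X w + a) ^+ n)%:E).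
Proof.
have X0 w : (0 <= X w)%R by exact: fine_ge0.
apply/integrableP; split.
  apply/measurable_EFinP; apply: measurable_funX; apply: measurable_funD => //.
  exact: measurable_count.
apply: le_lt_trans (count_shift_lty n (normr_ge0 a)); apply: ge0_le_integral => //.
- do 2 apply: measurableT_comp => //; apply: measurable_funX; apply: measurable_funD => //.
  exact: measurable_count.
- apply/measurable_EFinP; apply: measurable_funX; apply: measurable_funD => //.
  exact: measurable_count.
- move=> w _; rewrite lee_fin normrX lerXn2r ?nnegrE ?addr_ge0//.
  by rewrite (le_trans (ler_normD _ _))// (ger0_norm (X0 w)).
Qed.

(** Multiplication by X >= 0 commutes with taking positive and negative parts, so the non-negative
    case applies to each part. *)
Lemma poisson_stein (g : R -> R) : measurable_fun setT g ->
  P.-integrable setT (fun w => (g (X w + 1)%R)%:E) ->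
  \int[P]_w (X w * g (X w))%:E = lam%:E * \int[P]_w (g (X w + 1)%R)%:E.
Proof.
move=> mg ig; have X0 w : (0 <= X w)%R by exact: fine_ge0.
rewrite integralE [in RHS]integralE muleBr//; last first.
  apply: fin_num_adde_defr; apply: integrable_fin_num => //.
  exact: integrable_funepos.
have posE (r : R) : maxe r%:E 0%E = (Num.max r 0)%:E by rewrite EFin_max.
congr (_ - _).
- transitivity (\int[P]_w (X w * Num.max (g (X w)) 0)%:E).
    by apply: eq_integral => w _; rewrite funeposE posE maxr_pMr// mulr0.
  rewrite (@poisson_stein_ge0 (fun x => Num.max (g x) 0)%R)//.
  - by congr (_ * _); apply: eq_integral => w _; rewrite funeposE posE.
  - exact: measurable_maxr.
  - by move=> x; rewrite le_max lexx orbT.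
- transitivity (\int[P]_w (X w * Num.max (- g (X w)) 0)%:E).
    by apply: eq_integral => w _; rewrite funenegE -EFinN posE maxr_pMr// mulr0 mulrN.
  rewrite (@poisson_stein_ge0 (fun x => Num.max (- g x) 0)%R)//.
  - by congr (_ * _); apply: eq_integral => w _; rewrite funenegE -EFinN posE.
  - by apply: measurable_maxr => //; exact: measurableT_comp.
  - by move=> x; rewrite le_max lexx orbT.
Qed.

End poisson_moments.

(** Both products are the trinomial coefficient n! / (i! k! (n - i - k)!), and both vanish when i +
    k > n. *)
Lemma mul_bin_swap n i k : ('C(n, i) * 'C(n - i, k) = 'C(n, k) * 'C(n - k, i))%N.
Proof.
have [lt|le] := ltnP n (i + k).
  have [ni|ni] := ltnP n i.
    by rewrite (bin_small ni) (@bin_small (n - k) i) ?muln0//; lia.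
  have [nk|nk] := ltnP n k.
    by rewrite (bin_small nk) (@bin_small (n - i) k) ?muln0//; lia.
  by rewrite (@bin_small (n - i) k) ?(@bin_small (n - k) i) ?muln0//; lia.
apply/eqP; rewrite -(eqn_pmul2r (fact_gt0 i)) -(eqn_pmul2r (fact_gt0 k)).
rewrite -(eqn_pmul2r (fact_gt0 (n - i - k))).
have h1 := @bin_fact n i; have h2 := @bin_fact (n - i) k.
have h3 := @bin_fact n k; have h4 := @bin_fact (n - k) i.
have e : (n - k - i = n - i - k)%N by lia.
rewrite e in h4.
apply/eqP; transitivity (n`!); [rewrite -h1 ?(leq_trans _ le) ?leq_addr// -h2; first by ring|
  rewrite -h3 ?(leq_trans _ le) ?leq_addl// -h4; first by ring]; lia.
Qed.

Lemma integral_lincomb {d} {T : measurableType d} {R : realType} (mu : {measure set T -> \bar R})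
    n (a : nat -> R) (F : nat -> T -> R) :
  (forall i, mu.-integrable setT (EFin \o F i)) ->
  mu.-integrable setT (fun w => (\sum_(i < n) a i * F i w)%:E)%R /\
  (\int[mu]_w (\sum_(i < n) a i * F i w) = \sum_(i < n) a i * \int[mu]_w F i w)%R.
Proof.
move=> iF; elim: n => [|n [IH1 IH2]].
  under [X in integrable _ _ X]eq_fun do rewrite big_ord0.
  split; first exact: integrable0.
  under eq_Rintegral do rewrite big_ord0.
  by rewrite /Rintegral integral0 big_ord0.
have i2 : mu.-integrable setT (EFin \o (fun w => a n * F n w)%R).
  exact: (integrableZl measurableT (a n) (iF n)).
under [X in integrable _ _ X]eq_fun do rewrite big_ord_recr EFinD/=.
split; first exact: integrableD.
under eq_Rintegral do rewrite big_ord_recr/=.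
by rewrite RintegralD// IH2 big_ord_recr/= RintegralZl.
Qed.

(** * Cumulants as coefficients of a moment recursion *)

Section cumulants.
Context {R : realType} {d} {T : measurableType d} (P : probability T R).
Local Open Scope ring_scope.

(* Recursion satisfied by the moments of Y when [kap k] is the cumulant of
   order k + 1. *)
Definition has_cumulants (Y : T -> R) (kap : nat -> R) :=
  (forall n, P.-integrable setT (fun w => (Y w ^+ n)%:E)) /\
  forall n, \int[P]_w (Y w ^+ n.+1) =
    \sum_(k < n.+1) 'C(n, k)%:R * kap k * \int[P]_w (Y w ^+ (n - k)).

Lemma has_cumulants0 : has_cumulants (fun=> 0) (fun=> 0).
Proof.
split=> n.
  exact: (finite_measure_integrable_cst P (0 ^+ n) measurableT).
rewrite big1; last by move=> i _; rewrite mulr0 mul0r.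
by under eq_Rintegral do rewrite expr0n; rewrite Rintegral_cst// mul0r.
Qed.

Lemma has_cumulantsZ Y kap (c : R) : has_cumulants Y kap ->
  has_cumulants (fun w => c * Y w) (fun k => c ^+ k.+1 * kap k).
Proof.
move=> [iY rec].
have E n : \int[P]_w ((c * Y w) ^+ n) = c ^+ n * \int[P]_w (Y w ^+ n).
  by under eq_Rintegral do rewrite exprMn; rewrite RintegralZl//; exact: iY.
split=> n.
  under [X in integrable _ _ X]eq_fun do rewrite exprMn EFinM.
  exact: integrableZl.
rewrite E rec mulr_sumr; apply: eq_bigr => k _.
have -> : c ^+ n.+1 = c ^+ k.+1 * c ^+ (n - k) by rewrite -exprD addSn subnKC// -ltnS.
by rewrite E; ring.
Qed.

Lemma sum_binomial_widen (n m : nat) (F : nat -> R) : (m <= n)%N ->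
  \sum_(k < m.+1) 'C(m, k)%:R * F k = \sum_(k < n.+1) 'C(m, k)%:R * F k.
Proof.
move=> mn; rewrite (big_ord_widen n.+1 (fun k => 'C(m, k)%:R * F k))// big_mkcond/=.
apply: eq_bigr => k _; case: ltnP => // mk.
by rewrite bin_small ?mul0r.
Qed.

(** The n-th moment of a sum of two independent variables with moments [M] and [M']; equivalently,
    the product of the exponential generating functions. *)
Let binomial_conv (M M' : nat -> R) n := \sum_(i < n.+1) 'C(n, i)%:R * (M (n - i)%N * M' i).

Let binomial_convC M M' n : binomial_conv M M' n = binomial_conv M' M n.
Proof.
rewrite /binomial_conv (reindex_inj rev_ord_inj)/=; apply: eq_bigr => i _.
have le : (i <= n)%N by rewrite -ltnS.
by rewrite subSS bin_sub// subKn// [M i * _]mulrC.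
Qed.

(** In exponential generating functions: if F' = k F, then F' G = k (F G). The double sum is
    rearranged by the symmetry of the trinomial coefficient. *)
Let binomial_conv_rec (M M' kap : nat -> R) n :
  (forall j, (j <= n)%N -> M j.+1 = \sum_(k < j.+1) 'C(j, k)%:R * kap k * M (j - k)%N) ->
  \sum_(i < n.+1) 'C(n, i)%:R * (M (n - i).+1 * M' i) =
  \sum_(k < n.+1) 'C(n, k)%:R * kap k * binomial_conv M M' (n - k).
Proof.
move=> rec.
transitivity (\sum_(i < n.+1) \sum_(k < n.+1) ('C(n, i) * 'C(n - i, k))%:R *
    (kap k * M (n - i - k)%N * M' i)).
  apply: eq_bigr => i _; rewrite rec ?leq_subr//.
  under eq_bigr do rewrite -mulrA.
  rewrite (sum_binomial_widen (fun k => kap k * M (n - i - k)%N) (leq_subr i n)).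
  by rewrite mulr_suml mulr_sumr; apply: eq_bigr => k _; rewrite natrM; ring.
rewrite exchange_big /=; apply: eq_bigr => k _.
rewrite /binomial_conv (sum_binomial_widen (fun i => M (n - k - i)%N * M' i) (leq_subr k n)).
rewrite mulr_sumr; apply: eq_bigr => i _; rewrite mul_bin_swap natrM -subnDA addnC subnDA.
by ring.
Qed.

(** The product rule (F G)' = F' G + F G' = (k + k') F G for the exponential generating functions F
    and G of the moments. One factor Y + Z of the power n + 1 is split, and each half is handled by
    [binomial_conv_rec]. *)
Lemma has_cumulantsD (Y Z : T -> R) kap kap' :
  measurable_fun setT Y -> measurable_fun setT Z ->
  (forall A B : set R, measurable A -> measurable B ->
    P (Y @^-1` A `&` Z @^-1` B) = (P (Y @^-1` A) * P (Z @^-1` B))%E) ->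
  has_cumulants Y kap -> has_cumulants Z kap' ->
  has_cumulants (fun w => Y w + Z w) (fun k => kap k + kap' k).
Proof.
move=> mY mZ YZ [iY recY] [iZ recZ].
pose pow (f : T -> R) i w := f w ^+ i.
have YZn i j A B : measurable A -> measurable B ->
    P (pow Y i @^-1` A `&` pow Z j @^-1` B) = (P (pow Y i @^-1` A) * P (pow Z j @^-1` B))%E.
  have mX k C : measurable C -> measurable ((fun x : R => x ^+ k) @^-1` C).
    by move=> mC; rewrite -[X in measurable X]setTI; exact: exprn_measurable.
  by move=> mA mB; exact: (YZ _ _ (mX i A mA) (mX j B mB)).
have mY' i : measurable_fun setT (fun w => Y w ^+ i) by exact: measurable_funX.
have mZ' i : measurable_fun setT (fun w => Z w ^+ i) by exact: measurable_funX.
have iYZ i j : P.-integrable setT (EFin \o (fun w => Y w ^+ i * Z w ^+ j)).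
  by apply: (indep_integrableM (mY' i) (mZ' j)); [exact: YZn|exact: iY|exact: iZ].
have eYZ i j : \int[P]_w (Y w ^+ i * Z w ^+ j) =
    \int[P]_w (Y w ^+ i) * \int[P]_w (Z w ^+ j).
  by apply: (indep_RintegralM (mY' i) (mZ' j)); [exact: YZn|exact: iY|exact: iZ].
pose M n := \int[P]_w (Y w ^+ n); pose M' n := \int[P]_w (Z w ^+ n).
have sumint n (a : nat -> R) (f g : nat -> nat) :
    P.-integrable setT (fun w => (\sum_(i < n) a i * (Y w ^+ f i * Z w ^+ g i))%:E) /\
    \int[P]_w (\sum_(i < n) a i * (Y w ^+ f i * Z w ^+ g i)) = \sum_(i < n) a i * (M (f i) * M' (g i)).
  have [h1 h2] := integral_lincomb n a (fun i => iYZ (f i) (g i)); split=> //.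
  by rewrite h2; apply: eq_bigr => i _; rewrite eYZ.
have expE n w : (Y w + Z w) ^+ n = \sum_(i < n.+1) 'C(n, i)%:R * (Y w ^+ (n - i) * Z w ^+ i).
  by rewrite exprDn; apply: eq_bigr => i _; rewrite mulr_natl.
(* With the binomial theorem in both orders, the extra factor raises the power n - i in either
   half. *)
have expE' n w : (Y w + Z w) ^+ n = \sum_(i < n.+1) 'C(n, i)%:R * (Y w ^+ i * Z w ^+ (n - i)).
  rewrite addrC exprDn; apply: eq_bigr => i _.
  by rewrite mulr_natl [Z w ^+ _ * _]mulrC.
have int n : \int[P]_w ((Y w + Z w) ^+ n) = binomial_conv M M' n.
  under eq_Rintegral do rewrite expE.
  by have [_ ->] := sumint n.+1 (fun i => 'C(n, i)%:R) (fun i => n - i)%N id.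
split=> n.
  under [X in integrable _ _ X]eq_fun do rewrite expE.
  by have [] := sumint n.+1 (fun i => 'C(n, i)%:R) (fun i => n - i)%N id.
transitivity (\sum_(i < n.+1) 'C(n, i)%:R * (M (n - i).+1 * M' i) +
    \sum_(i < n.+1) 'C(n, i)%:R * (M' (n - i).+1 * M i)).
  transitivity (\int[P]_w (\sum_(i < n.+1) 'C(n, i)%:R * (Y w ^+ (n - i).+1 * Z w ^+ i) +
     \sum_(i < n.+1) 'C(n, i)%:R * (Y w ^+ i * Z w ^+ (n - i).+1))).
    apply: eq_Rintegral => w _; rewrite exprS mulrDl {1}expE expE' !mulr_sumr.
    by congr (_ + _); apply: eq_bigr => i _; rewrite exprS; ring.
  have [i1 e1] := sumint n.+1 (fun i => 'C(n, i)%:R) (fun i => (n - i).+1)%N id.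
  have [i2 e2] := sumint n.+1 (fun i => 'C(n, i)%:R) id (fun i => (n - i).+1)%N.
  rewrite RintegralD//= e1 e2; congr (_ + _); apply: eq_bigr => i _.
  by rewrite [M i * _]mulrC.
rewrite (@binomial_conv_rec M M' kap); last by move=> j _; exact: recY.
rewrite (@binomial_conv_rec M' M kap'); last by move=> j _; exact: recZ.
rewrite -big_split/=; apply: eq_bigr => k _.
by rewrite int [binomial_conv M' _ _]binomial_convC; ring.
Qed.

End cumulants.

(** Every cumulant of a Poisson variable is its mean lam; centring removes the first, of index 0.
    The Stein identity for (x - lam)^n yields lam E(X + 1 - lam)^n, and the first term of its
    binomial expansion cancels against the term from the centring. *)
Lemma has_cumulants_poisson {R : realType} {d} {Omega : measurableType d}
    (P : probability Omega R) {d'} {E : measurableType d'}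
    (m : {measure set E -> \bar R}) (N : R.-ker Omega ~> E) (B : set E) :
  poisson_random_measure P m N -> measurable B -> m B < +oo ->
  has_cumulants P (fun w => fine (N w B) - fine (m B))%R
    (fun k => (k != 0)%:R * fine (m B))%R.
Proof.
move=> prm mB fB; split=> n; first exact: (integrable_count_shift prm).
set X := fun w => fine (N w B); set lam := fine (m B).
have iU c k : P.-integrable setT (fun w => ((X w + c) ^+ k)%:E).
  exact: (integrable_count_shift prm).
have i2 : P.-integrable setT (fun w => (lam * (X w - lam) ^+ n)%:E).
  by under [X in integrable _ _ X]eq_fun do rewrite EFinM; exact: integrableZl.
have i1 : P.-integrable setT (fun w => (X w * (X w - lam) ^+ n)%:E).
  rewrite (_ : (fun w => _) = (fun w => ((X w - lam) ^+ n.+1)%:E + (lam * (X w - lam) ^+ n)%:E)).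
    exact: integrableD.
  by apply/funext => w; rewrite -EFinD exprS mulrBl subrK.
have -> : (\int[P]_w (X w - lam) ^+ n.+1 = \int[P]_w (X w * (X w - lam) ^+ n) - lam * \int[P]_w (X w - lam) ^+ n)%R.
  rewrite -RintegralZl//; last exact: iU.
  rewrite -RintegralB//; apply: eq_Rintegral => w _.
  by rewrite exprS mulrBl.
have -> : (\int[P]_w (X w * (X w - lam) ^+ n) = lam * \int[P]_w (X w + 1 - lam) ^+ n)%R.
  have i3 : P.-integrable setT (fun w => ((X w + 1 - lam) ^+ n)%:E).
    by under [X in integrable _ _ X]eq_fun do rewrite -addrA.
  rewrite /Rintegral (poisson_stein prm mB fB (g := fun x => (x - lam) ^+ n)%R)//; last first.
    by apply: measurable_funX; exact: measurable_funB.
  by rewrite fineM//; exact: integrable_fin_num.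
have [_ e] := integral_lincomb n.+1 (fun k => 'C(n, k)%:R) (fun k => iU (- lam)%R (n - k)%N).
have -> : (\int[P]_w (X w + 1 - lam) ^+ n = \sum_(k < n.+1) 'C(n, k)%:R * \int[P]_w (X w - lam) ^+ (n - k))%R.
  rewrite -e; apply: eq_Rintegral => w _; rewrite addrAC exprDn; apply: eq_bigr => k _.
  by rewrite expr1n mulr1 mulr_natl.
rewrite [in LHS]big_ord_recl [RHS]big_ord_recl/= bin0 subn0 mul0r mulr0 mul0r add0r mul1r.
rewrite mulrDr addrAC subrr add0r mulr_sumr; apply: eq_bigr => k _.
by rewrite mul1r; ring.
Qed.

(** The term k = p - 1 of the recursion for [M p] is the cumulant itself, because [M 0 = 1]. Any
    other term multiplies a cumulant by a moment of positive order, and both are O(a). The constant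
    depends on [p] and [D] alone, hence is uniform in the set whose length will be [a]. *)
Lemma cumulant_moment_bound {R : realType} (p : nat) (D : R) : (0 < p)%N -> (0 <= D)%R ->
  exists2 c : R, (0 <= c)%R & forall (M kap : nat -> R) (a : R), (0 <= a <= 1)%R ->
    M 0%N = 1%R -> kap 0%N = 0%R ->
    (forall k, (k < p)%N -> `|kap k| <= a * D)%R ->
    (forall n, M n.+1 = \sum_(k < n.+1) 'C(n, k)%:R * kap k * M (n - k)%N)%R ->
    (`|M p - kap p.-1| <= c * a ^+ 2)%R.
Proof.
move=> p0 D0.
(* First the bound O(a) for all moments of order 1 to p, by induction on the largest order
   considered. The bound b + 1 used there also covers [M 0 = 1]. *)
have [b b0 bP] : exists2 b : R, (0 <= b)%R & forall (M kap : nat -> R) (a : R), (0 <= a <= 1)%R ->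
    M 0%N = 1%R -> kap 0%N = 0%R ->
    (forall k, (k < p)%N -> `|kap k| <= a * D)%R ->
    (forall n, M n.+1 = \sum_(k < n.+1) 'C(n, k)%:R * kap k * M (n - k)%N)%R ->
    forall n, (0 < n <= p)%N -> (`|M n| <= b * a)%R.
  move: (leqnn p); move: {1 4}p => q; elim: q => [_|q IH qp].
    by exists 0%R => // M kap a _ _ _ _ _ [|n].
  have [b b0 bP] := IH (ltnW qp).
  exists (b + \sum_(k < q.+1) 'C(q, k)%:R * D * (b + 1))%R.
    rewrite addr_ge0// sumr_ge0// => k _.
    by rewrite !mulr_ge0// addr_ge0.
  move=> M kap a a01 M0 k0 kD rec n /andP[n0].
  have /andP[a0 a1] := a01.
  have Mb j : (j <= q)%N -> (`|M j| <= b + 1)%R.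
    move=> jq; have [->|j0] := posnP j; first by rewrite M0 normr1 lerDr.
    rewrite (le_trans (bP _ _ _ a01 M0 k0 kD rec j _)) ?j0//.
    by rewrite (le_trans (ler_wpM2l b0 a1))// mulr1 lerDl.
  have S0 : (0 <= \sum_(k < q.+1) 'C(q, k)%:R * D * (b + 1) :> R)%R.
    by rewrite sumr_ge0// => k _; rewrite !mulr_ge0// addr_ge0.
  rewrite leq_eqVlt => /orP[/eqP ->|nq]; last first.
    rewrite (le_trans (bP _ _ _ a01 M0 k0 kD rec n _)) ?n0//.
    by rewrite ler_wpM2r// lerDl.
  rewrite rec (le_trans (ler_norm_sum _ _ _))//.
  rewrite mulrDl (@le_trans _ _ (\sum_(k < q.+1) 'C(q, k)%:R * D * (b + 1) * a)%R)//; last first.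
    by rewrite mulr_suml lerDr mulr_ge0.
  apply: ler_sum => k _; rewrite !normrM normr_nat -!mulrA ler_wpM2l//.
  have kp : (k < p)%N by rewrite (leq_trans (ltn_ord k)).
  rewrite (_ : D * ((b + 1) * a) = (a * D) * (b + 1))%R; last by ring.
  by rewrite ler_pM// ?kD// Mb// leq_subr.
case: p p0 bP => // q _ bP.
exists (\sum_(k < q) 'C(q, k)%:R * D * b)%R.
  by rewrite sumr_ge0// => k _; rewrite !mulr_ge0.
move=> M kap a a01 M0 k0 kD rec.
rewrite rec big_ord_recr/= binn subnn M0 mul1r mulr1 addrK.
rewrite (le_trans (ler_norm_sum _ _ _))// mulr_suml; apply: ler_sum => k _.
rewrite !normrM normr_nat -!mulrA ler_wpM2l//.
rewrite (_ : D * (b * a ^+ 2) = (a * D) * (b * a))%R; last by ring.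
rewrite ler_pM// ?kD// ?(ltn_trans (ltn_ord k))//.
by apply: (bP M kap a a01 M0 k0 kD rec); have := ltn_ord k; lia.
Qed.

(** * Absolute moments and limits in L^2 *)

Section absolute_moments.
Context {d} {T : measurableType d} {R : realType} (mu : {measure set T -> \bar R}).
Implicit Types (f g h : T -> R) (p : nat).

Definition absmom p f : \bar R := \int[mu]_x (`|f x| ^+ p)%:E.

Lemma absmom_ge0 p f : 0 <= absmom p f.
Proof. by apply: integral_ge0 => x _; rewrite lee_fin exprn_ge0. Qed.

Lemma measurable_abspow p f : measurable_fun setT f ->
  measurable_fun setT (fun x => (`|f x| ^+ p)%:E).
Proof.
move=> mf; apply/measurable_EFinP; apply: measurable_funX; exact: measurableT_comp.
Qed.

Lemma poweR_Lnorm_nat p f : (0 < p)%N -> 'N[mu]_(p%:R%:E)[EFin \o f] `^ p%:R = absmom p f.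
Proof.
move=> p0; rewrite poweR_Lnorm ?pnatr_eq0 -?lt0n//; apply: eq_integral => x _ /=.
by rewrite powR_mulrn.
Qed.

Lemma Lnorm_nat p f : (0 < p)%N -> 'N[mu]_(p%:R%:E)[EFin \o f] = absmom p f `^ (p%:R)^-1.
Proof.
move=> p0; rewrite -poweR_Lnorm_nat// -poweRrM divff ?pnatr_eq0 -?lt0n// poweRe1//.
exact: Lnorm_ge0.
Qed.

Lemma absmom2E f : absmom 2 f = \int[mu]_x (f x ^+ 2)%:E.
Proof. by apply: eq_integral => x _; rewrite real_normK// num_real. Qed.

Lemma absmom_small {I : Type} (F : set_system I) {FF : Filter F} p (u : I -> T -> R) (e : R) :
  (0 < p)%N -> (fun i => 'N[mu]_(p%:R%:E)[(fun x => (u i x)%:E)]) @ F --> 0 ->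
  (0 < e)%R -> \forall i \near F, absmom p (u i) <= e%:E.
Proof.
move=> p0 u0 e0.
have p_neq0 : (p%:R != 0 :> R)%R by rewrite pnatr_eq0 -lt0n.
have r0 : (0 < e `^ p%:R^-1)%R by exact: powR_gt0.
have : \forall i \near F, 'N[mu]_(p%:R%:E)[(fun x => (u i x)%:E)] < (e `^ p%:R^-1)%:E.
  have r0' : 0 < (e `^ p%:R^-1)%:E by rewrite lte_fin.
  exact: (u0 _ (open_ereal_lt' r0')).
apply: filterS => i /ltW ui; rewrite -poweR_Lnorm_nat//.
have -> : e%:E = ((e `^ p%:R^-1)%:E `^ p%:R)%E.
  by rewrite poweR_EFin -powRrM mulVf// powRr1// ltW.
apply: gt0_ler_poweR => //; rewrite in_itv/= ?leey ?andbT ?Lnorm_ge0//.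
by rewrite lee_fin ltW.
Qed.

Lemma absmom2D f g : measurable_fun setT f -> measurable_fun setT g ->
  absmom 2 (fun x => f x + g x)%R <= 2%:E * absmom 2 f + 2%:E * absmom 2 g.
Proof.
move=> mf mg; rewrite -!ge0_integralZl//; do ?[exact: measurable_abspow].
rewrite -ge0_integralD//; do ?[by apply: emeasurable_funM => //; exact: measurable_abspow].
apply: ge0_le_integral => //.
- by apply: measurable_abspow; exact: measurable_funD.
- by apply: emeasurable_funD; apply: emeasurable_funM => //; exact: measurable_abspow.
move=> x _; rewrite -!EFinM -EFinD lee_fin !real_normK ?num_real//.
rewrite -subr_ge0 (_ : _ - _ = (f x - g x) ^+ 2)%R ?sqr_ge0//; ring.
Qed.

Lemma absmomN p f : absmom p (fun x => - f x)%R = absmom p f.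
Proof. by apply: eq_integral => x _; rewrite normrN. Qed.

Lemma absmom2B f g : measurable_fun setT f -> measurable_fun setT g ->
  absmom 2 (fun x => f x - g x)%R <= 2%:E * absmom 2 f + 2%:E * absmom 2 g.
Proof.
move=> mf mg; rewrite -(absmomN 2 g); apply: absmom2D => //; exact: measurableT_comp.
Qed.

Lemma absmom2_tri f g h : measurable_fun setT f -> measurable_fun setT g -> measurable_fun setT h ->
  absmom 2 (fun x => f x - h x)%R <=
  2%:E * absmom 2 (fun x => f x - g x)%R + 2%:E * absmom 2 (fun x => g x - h x)%R.
Proof.
move=> mf mg mh; apply: le_trans; last by apply: absmom2D; exact: measurable_funB.
rewrite le_eqVlt; apply/orP; left; apply/eqP; apply: eq_integral => x _.
by rewrite addrA subrK.
Qed.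

Lemma absmom_eq0 p f : (0 < p)%N -> measurable_fun setT f ->
  (forall e : R, (0 < e)%R -> absmom p f <= e%:E) -> {ae mu, forall x, f x = 0%R}.
Proof.
move=> p0 mf fe.
have f0 : absmom p f = 0.
  apply/eqP; rewrite eq_le absmom_ge0 andbT; apply/lee_addgt0Pr => e e0.
  by rewrite add0e fe.
have /ae_eq_integral_abs : measurable_fun setT (fun x => (`|f x| ^+ p)%:E).
  exact: measurable_abspow.
move=> /(_ mu measurableT)[h _].
have : ae_eq mu setT (fun x => (`|f x| ^+ p)%:E) (cst 0).
  apply: h; rewrite -[RHS]f0; apply: eq_integral => x _ /=.
  by rewrite ger0_norm// exprn_ge0.
apply: filterS => x /(_ Logic.I) [] /eqP.
by rewrite expf_eq0 p0/= normr_eq0 => /eqP.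
Qed.

(** The errors are summable, so the series of squared distances has a finite integral; it is finite
    almost everywhere and its terms tend to 0. *)
Lemma ae_cvg_fast (Y : nat -> T -> R) (Z : T -> R) :
  (forall k, measurable_fun setT (Y k)) -> measurable_fun setT Z ->
  (forall k, absmom 2 (fun w => Y k w - Z w)%R <= (1 / (2 ^ k.+1)%:R)%:E) ->
  {ae mu, forall w, (fun k => Y k w) @ \oo --> Z w}.
Proof.
move=> mY mZ YZ.
pose f k w := (`|Y k w - Z w| ^+ 2)%:E.
have mf k : measurable_fun setT (f k).
  by apply: measurable_abspow; exact: measurable_funB.
have f0 k w : setT w -> 0 <= f k w by rewrite lee_fin exprn_ge0.
have intS : mu.-integrable setT (fun w => \sum_(k <oo) f k w).
  apply/integrableP; split.
    by apply: ge0_emeasurable_sum => // k w _ _; exact: f0.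
  rewrite (eq_integral (fun w => \sum_(k <oo) f k w)); last first.
    by move=> w _; rewrite gee0_abs//; apply: nneseries_ge0 => k _ _; exact: f0.
  rewrite integral_nneseries//; apply: (@le_lt_trans _ _ 1%:E); last by rewrite ltry.
  apply: le_trans (@epsilon_trick0 R 1 xpredT ler01).
  apply: lee_nneseries => [k _ _|k _]; [apply: integral_ge0 => w _; exact: f0|exact: YZ].
have := integrable_ae measurableT intS; apply: filterS => w /(_ Logic.I) wfin.
have /nneseries_tail_cvg : \sum_(0 <= k <oo) f k w < +oo.
  by rewrite ltey_eq wfin.
move=> /(_ (fun k _ => f0 k w Logic.I)) tail.
apply/cvgrPdist_lt => e e0.
have : \forall n \near \oo, \sum_(n <= k <oo) f k w < (e ^+ 2)%:E.
  have e20 : 0 < (e ^+ 2)%:E by rewrite lte_fin exprn_gt0.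
  exact: (tail _ (open_ereal_lt' e20)).
apply: filterS => n h.
have : f n w < (e ^+ 2)%:E.
  apply: le_lt_trans h; rewrite (nneseries_split n 1); last by move=> k _; exact: f0.
  by rewrite addn1 big_nat1 leeDl// nneseries_ge0// => k _ _; exact: f0.
by rewrite lte_fin distrC ltr_pXn2r ?nnegrE// ltW.
Qed.

Lemma fast_choice (Z : T -> R) (Q : (T -> R) -> Prop) : measurable_fun setT Z ->
  (forall e : R, (0 < e)%R -> exists Y, [/\ measurable_fun setT Y, Q Y &
    absmom 2 (fun w => Y w - Z w)%R <= e%:E]) ->
  exists Y : nat -> T -> R, [/\ forall k, measurable_fun setT (Y k), forall k, Q (Y k) &
    {ae mu, forall w, (fun k => Y k w) @ \oo --> Z w}].
Proof.
move=> mZ h.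
have /choice[Y hY] : forall k : nat, exists Y, [/\ measurable_fun setT Y, Q Y &
    absmom 2 (fun w => Y w - Z w)%R <= (1 / (2 ^ k.+1)%:R)%:E].
  by move=> k; apply: h; rewrite divr_gt0// ltr0n expn_gt0.
by exists Y; split => [k|k|]; [case: (hY k)..|apply: ae_cvg_fast => // k; case: (hY k)].
Qed.

(** Lower semicontinuity of the p-th moment under L^2 limits: approximations with errors 2^-(k+1)
    converge almost everywhere, and Fatou's lemma applies. Every moment bound reaches [L A], I_K(X)
    and I(X) in this way. *)
Lemma absmom_lsc p (Z : T -> R) (M : \bar R) : measurable_fun setT Z ->
  (forall e : R, (0 < e)%R -> exists Y, [/\ measurable_fun setT Y, absmom p Y <= M + e%:E &
    absmom 2 (fun w => Y w - Z w)%R <= e%:E]) ->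
  absmom p Z <= M.
Proof.
move=> mZ h; apply/lee_addgt0Pr => e e0.
have [|Y [mY MY YZ]] := @fast_choice Z (fun Y => absmom p Y <= M + e%:E) mZ.
  (* Two tolerances are met at once: [e] is the fixed slack in the moment bound, [e1] the distance,
     which must become small. *)
  move=> e1 e10; have e20 : (0 < Num.min e e1)%R by rewrite lt_min e0.
  have [Y [mY h1 h2]] := h _ e20; exists Y; split => //.
    by apply: (le_trans h1); rewrite leeD2l// lee_fin ge_min lexx.
  by apply: (le_trans h2); rewrite lee_fin ge_min lexx orbT.
have m k : measurable_fun setT (fun w => (`|Y k w| ^+ p)%:E) by exact: measurable_abspow.
have -> : absmom p Z = \int[mu]_w limn_einf (fun k => (`|Y k w| ^+ p)%:E).
  apply: ae_eq_integral => //; first exact: measurable_abspow.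
    rewrite (_ : (fun w => _) = (fun w => - limn_esup (fun k => - (`|Y k w| ^+ p)%:E))).
      apply: measurableT_comp => //; apply: measurable_fun_limn_esup => k.
      by apply: measurableT_comp => //; exact: m.
    by [].
  apply: filterS YZ => w YZw _.
  have : (fun k => (`|Y k w| ^+ p)%:E) @ \oo --> (`|Z w| ^+ p)%:E.
    apply: cvg_EFin; first exact: nearW.
    by apply: (@continuous_cvg _ _ _ _ _ _ (fun x : R => x ^+ p)%R);
      [exact: exprn_continuous|exact: cvg_norm].
  by move=> /cvg_limn_einf_sup[->].
have m0 k w : setT w -> 0 <= (`|Y k w| ^+ p)%:E by rewrite lee_fin exprn_ge0.
apply: le_trans (fatou mu measurableT m m0) _.
rewrite limn_einf_lim; apply: lime_le; first exact: is_cvg_einfs.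
by apply: nearW => n; apply: le_trans (MY n); apply: ereal_inf_lbound; exists n => /=.
Qed.

End absolute_moments.

Lemma measurable_wrtP {R : realType} {d} {T : measurableType d} (F : set (set T)) (f : T -> R) :
  measurable_wrt <<s F >> f <->
  measurable_fun [set: g_sigma_algebraType F] (f : g_sigma_algebraType F -> R).
Proof.
by split => [h _ C mC|h C mC]; [rewrite setTI; exact: h|rewrite -[X in _ X]setTI; exact: h].
Qed.

(** The upper limit [W] of a fast sequence is measurable for the generated sigma-algebra and equals
    [Z] off a null set; every subset of that null set belongs to the sigma-algebra. *)
Lemma measurable_wrt_closed {R : realType} {d} {T : measurableType d} (P : probability T R)
    (F : set (set T)) (Z : T -> R) :
  F `<=` measurable -> (forall D, P.-negligible D -> <<s F >> D) ->
  measurable_fun setT Z ->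
  (forall e : R, (0 < e)%R -> exists Y, [/\ measurable_fun setT Y, measurable_wrt <<s F >> Y &
    absmom P 2 (fun w => Y w - Z w)%R <= e%:E]) ->
  measurable_wrt <<s F >> Z.
Proof.
move=> mF nF mZ h C mC.
have [Y [mY FY [D [mD D0 DY]]]] := fast_choice mZ h.
pose W : g_sigma_algebraType F -> R := fun w => fine (limn_esup (fun k => (Y k w)%:E)).
have mW : measurable_fun setT W.
  apply: measurableT_comp => //; apply: measurable_fun_limn_esup => k.
  by apply/measurable_EFinP; exact: (proj1 (measurable_wrtP F (Y k)) (FY k)).
have WC : <<s F >> (W @^-1` C) by exact: (proj2 (measurable_wrtP F W) mW).
have nD A : A `<=` D -> <<s F >> A.
  by move=> AD; apply: nF; apply: negligibleS AD _; exists D; split.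
have ZW w : ~ D w -> Z w = W w.
  move=> Dw; have : (fun k => Y k w) @ \oo --> Z w by apply: contra_notP Dw => ?; exact: DY.
  move=> YZw.
  have : (fun k => (Y k w)%:E) @ \oo --> (Z w)%:E by apply: cvg_EFin => //; exact: nearW.
  by move=> /cvg_limn_einf_sup[_ e]; rewrite /W e.
rewrite (_ : Z @^-1` C = ((W @^-1` C) `\` D) `|` ((Z @^-1` C) `&` D)).
  apply: (@measurableU _ (g_sigma_algebraType F)).
    by apply: (@measurableD _ (g_sigma_algebraType F)) => //; exact: nD.
  by apply: nD => w [].
apply/seteqP; split => w /=.
  by move=> Cw; have [Dw|Dw] := pselect (D w); [right|left; rewrite -ZW].
by move=> [[+ Dw]|[]]//; rewrite -ZW.
Qed.

(** * Compensated simple functions *)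

Lemma integrable_mul_sqr {d} {T : measurableType d} {R : realType}
    (mu : {measure set T -> \bar R}) (f g : T -> R) :
  measurable_fun setT f -> measurable_fun setT g ->
  mu.-integrable setT (fun w => (f w ^+ 2)%:E) ->
  mu.-integrable setT (fun w => (g w ^+ 2)%:E) ->
  mu.-integrable setT (EFin \o (fun w => f w * g w)%R).
Proof.
move=> mf mg if2 ig2; apply: (le_integrable measurableT _ _ (integrableD measurableT if2 ig2)).
  by apply/measurable_EFinP; exact: measurable_funM.
move=> w _ /=; rewrite !lee_fin [leRHS]ger0_norm ?addr_ge0 ?sqr_ge0//.
rewrite ler_norml; apply/andP; split; rewrite -subr_ge0.
  rewrite (_ : _ - _ = 2^-1 * ((f w + g w) ^+ 2 + f w ^+ 2 + g w ^+ 2))%R; last by field.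
  by rewrite mulr_ge0// !addr_ge0 ?sqr_ge0.
rewrite (_ : _ - _ = 2^-1 * ((f w - g w) ^+ 2 + f w ^+ 2 + g w ^+ 2))%R; last by field.
by rewrite mulr_ge0// !addr_ge0 ?sqr_ge0.
Qed.

Lemma integrableD_EFin {d} {T : measurableType d} {R : realType}
    (mu : {measure set T -> \bar R}) (f g : T -> R) :
  mu.-integrable setT (EFin \o f) -> mu.-integrable setT (EFin \o g) ->
  mu.-integrable setT (EFin \o (fun w => f w + g w)%R).
Proof. by move=> i1 i2; exact: (integrableD measurableT i1 i2). Qed.

Section compensated.
Context {R : realType} {d} {Omega : measurableType d} (P : probability Omega R).
Context {d'} {E : measurableType d'}.
Variables (m : {measure set E -> \bar R}) (N : R.-ker Omega ~> E).
Hypothesis prm : poisson_random_measure P m N.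
Hypothesis Pc : measure_is_complete P.

Definition finm (B : set E) := measurable B /\ m B < +oo.

Lemma finmS A B : finm A -> measurable B -> B `<=` A -> finm B.
Proof.
move=> [mA fA] mB BA; split => //; apply: le_lt_trans fA.
by apply: le_measure; rewrite ?inE.
Qed.

Definition comp_count (B : set E) (w : Omega) : R := fine (N w B) - fine (m B).

Lemma comp_count_cumulants B : finm B ->
  has_cumulants P (comp_count B) (fun k => (k != 0)%:R * fine (m B))%R.
Proof. by move=> [mB fB]; exact: (has_cumulants_poisson prm). Qed.

Lemma measurable_comp_count B : measurable B -> measurable_fun setT (comp_count B).
Proof. by move=> mB; apply: measurable_funB => //; exact: measurable_count. Qed.

Lemma comp_count_mean B : finm B -> (\int[P]_w comp_count B w = 0)%R.
Proof.
move=> /comp_count_cumulants[_ /(_ 0%N)].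
by rewrite big_ord1 /= mul0r mulr0 mul0r.
Qed.

Lemma comp_count_var B : finm B -> (\int[P]_w (comp_count B w ^+ 2) = fine (m B))%R.
Proof.
move=> /comp_count_cumulants[_ /(_ 1%N)].
rewrite big_ord_recr big_ord1 /= mul0r mulr0 mul0r add0r !mul1r => ->.
under eq_Rintegral do rewrite expr0.
by rewrite Rintegral_cst//= probability_setT mulr1 mulr1.
Qed.

Lemma comp_count_wrt U B : measurable B -> B `<=` U ->
  measurable_wrt (sigmaN P N U) (comp_count B).
Proof.
move=> mB BU C mC.
apply: (@kernel_sigmaN _ _ _ _ _ _ _ U B ((fun x : \bar R => fine x - fine (m B))%R @^-1` C)) => //.
rewrite -[X in measurable X]setTI.
by apply: measurable_funB.
Qed.

Lemma indep_wrt U V (f g : Omega -> R) : measurable U -> measurable V -> U `&` V = set0 ->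
  measurable_wrt (sigmaN P N U) f -> measurable_wrt (sigmaN P N V) g ->
  forall A B : set R, measurable A -> measurable B ->
  P (f @^-1` A `&` g @^-1` B) = P (f @^-1` A) * P (g @^-1` B).
Proof.
by move=> mU mV UV hf hg A B mA mB; apply: (indep_sigmaN prm Pc mU mV UV); [exact: hf|exact: hg].
Qed.

(** Only almost everywhere: [fine] is not additive where a count is infinite. *)
Lemma comp_count_setU B B' : finm B -> finm B' -> B `&` B' = set0 ->
  {ae P, forall w, comp_count (B `|` B') w = comp_count B w + comp_count B' w}%R.
Proof.
move=> [mB fB] [mB' fB'] BB'.
have := count_ae prm mB fB; have := count_ae prm mB' fB'; apply: filterS2 => w h' h.
rewrite /comp_count !measureU// h h' /= !fineD ?ge0_fin_numE//.
- by rewrite opprD addrACA.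
- by rewrite h ltry.
- by rewrite h' ltry.
Qed.

Lemma comp_count_integrable2 B : finm B -> P.-integrable setT (fun w => (comp_count B w ^+ 2)%:E).
Proof. by move=> /comp_count_cumulants[/(_ 2%N)]. Qed.

Lemma comp_count_cov0 B B' : finm B -> finm B' -> B `&` B' = set0 ->
  (\int[P]_w (comp_count B w * comp_count B' w) = 0)%R.
Proof.
move=> fB fB' BB'; have [mB _] := fB; have [mB' _] := fB'.
rewrite (@indep_RintegralM _ _ _ P (comp_count B) (comp_count B')).
- by rewrite comp_count_mean// mul0r.
- exact: measurable_comp_count.
- exact: measurable_comp_count.
- by apply: (indep_wrt mB mB' BB'); exact: comp_count_wrt.
- by have [/(_ 1%N)] := comp_count_cumulants fB.
- by have [/(_ 1%N)] := comp_count_cumulants fB'.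
Qed.

(** Both counts are split along the intersection. Disjoint parts are uncorrelated, so only the
    variance of the common part survives. *)
Lemma comp_count_cov B B' : finm B -> finm B' ->
  (\int[P]_w (comp_count B w * comp_count B' w) = fine (m (B `&` B')))%R.
Proof.
move=> fB fB'; have [mB _] := fB; have [mB' _] := fB'.
have f0 : finm (B `&` B') by apply: (finmS fB) => //; exact: measurableI.
have f1 : finm (B `\` B') by apply: (finmS fB) => //; exact: measurableD.
have f2 : finm (B' `\` B) by apply: (finmS fB') => //; exact: measurableD.
pose u := comp_count (B `&` B'); pose v := comp_count (B `\` B'); pose v' := comp_count (B' `\` B).
have mu' : measurable_fun setT u by apply: measurable_comp_count; case: f0.
have mv : measurable_fun setT v by apply: measurable_comp_count; case: f1.
have mv' : measurable_fun setT v' by apply: measurable_comp_count; case: f2.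
have iu := comp_count_integrable2 f0.
have iv := comp_count_integrable2 f1.
have iv' := comp_count_integrable2 f2.
have B1 : {ae P, forall w, comp_count B w = u w + v w}%R.
  have := @comp_count_setU (B `&` B') (B `\` B') f0 f1.
  rewrite -(_ : B = (B `&` B') `|` (B `\` B')); last by rewrite setDE -setIUr setUv setIT.
  by apply; rewrite -subset0 => x [[_ ?] [_ ?]].
have B2 : {ae P, forall w, comp_count B' w = u w + v' w}%R.
  have := @comp_count_setU (B `&` B') (B' `\` B) f0 f2.
  rewrite -(_ : B' = (B `&` B') `|` (B' `\` B)); last by rewrite setDE setIC -setIUr setUv setIT.
  by apply; rewrite -subset0 => x [[? _] [_ ?]].
transitivity (\int[P]_w (u w ^+ 2 + (u w * v' w + (v w * u w + v w * v' w))))%R.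
  rewrite /Rintegral; congr fine; apply: ae_eq_integral => //.
  - by apply/measurable_EFinP; apply: measurable_funM; exact: measurable_comp_count.
  - apply/measurable_EFinP; apply: measurable_funD; first exact: measurable_funX.
    by do 2 (apply: measurable_funD; first exact: measurable_funM); exact: measurable_funM.
  - apply: filterS2 B1 B2 => w -> -> _; congr EFin; ring.
have i1 := integrable_mul_sqr mu' mv' iu iv'.
have i2 := integrable_mul_sqr mv mu' iv iu.
have i3 := integrable_mul_sqr mv mv' iv iv'.
rewrite RintegralD//; last by apply: integrableD_EFin => //; exact: integrableD_EFin.
rewrite RintegralD//; last exact: integrableD_EFin.
by rewrite RintegralD// comp_count_var// !comp_count_cov0// ?addr0// -subset0 => x /= [[? ?] [? ?]].
Qed.

Section simple.
Variable s : seq (R * set E).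
Let c j := (nth (0%R, set0) s j).1.
Let B j := (nth (0%R, set0) s j).2.

Lemma simple_compensatedE w :
  simple_compensated m N s w = (\sum_(j < size s) c j * comp_count (B j) w)%R.
Proof. by rewrite /simple_compensated (big_nth (0%R, set0)) big_mkord. Qed.

Lemma simple_funE e : simple_fun s e = (\sum_(j < size s) c j * \1_(B j) e)%R.
Proof. by rewrite /simple_fun (big_nth (0%R, set0)) big_mkord. Qed.

Let compensatedE : simple_compensated m N s =
  (fun w => \sum_(j < size s) c j * comp_count (B j) w)%R.
Proof. by apply/funext => w; exact: simple_compensatedE. Qed.

Let funE : simple_fun s = (fun e => \sum_(j < size s) c j * \1_(B j) e)%R.
Proof. by apply/funext => w; exact: simple_funE. Qed.

Hypothesis adm : simple_admissible m s.

Lemma simple_admissible_nth j : finm (B j).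
Proof.
have [js|sj] := ltnP j (size s); first exact: adm.
by rewrite /finm /B nth_default//=; split; rewrite ?measure0.
Qed.

Lemma measurable_simple_compensated : measurable_fun setT (simple_compensated m N s).
Proof.
rewrite compensatedE.
apply: measurable_sum => j; apply: measurable_funM => //.
by apply: measurable_comp_count; have [] := simple_admissible_nth j.
Qed.

Lemma measurable_simple_fun : measurable_fun setT (simple_fun s).
Proof.
rewrite funE.
apply: measurable_sum => j; apply: measurable_funM => //.
by apply: measurable_indic; have [] := simple_admissible_nth j.
Qed.

Lemma simple_compensated_wrt U : (forall j, (j < size s)%N -> B j `<=` U) ->
  measurable_wrt (sigmaN P N U) (simple_compensated m N s).
Proof.
move=> BU; apply: (proj2 (measurable_wrtP _ _)).
rewrite compensatedE.
apply: measurable_sum => j; apply: measurable_funM => //.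
apply: (proj1 (measurable_wrtP _ _)); apply: comp_count_wrt; last exact: BU.
by have [] := simple_admissible_nth j.
Qed.

(** The sets may overlap, so both squares are expanded into double sums; the two Gram matrices have
    the same entries m(B_i & B_j). *)
Let isometry_lty : absmom P 2 (simple_compensated m N s) = absmom m 2 (simple_fun s) /\
  absmom m 2 (simple_fun s) < +oo.
Proof.
pose M i j := fine (m (B i `&` B j)).
have fI i j : finm (B i `&` B j).
  apply: (finmS (simple_admissible_nth i)) => //; apply: measurableI;
  by have [] := simple_admissible_nth i; have [] := simple_admissible_nth j.
have iF i j : P.-integrable setT (EFin \o (fun w => comp_count (B i) w * comp_count (B j) w)%R).
  by apply: integrable_mul_sqr; [apply: measurable_comp_count; case: (simple_admissible_nth i)|
    apply: measurable_comp_count; case: (simple_admissible_nth j)|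
    apply: comp_count_integrable2; exact: simple_admissible_nth..].
have iG i j : m.-integrable setT (EFin \o (fun e => \1_(B i `&` B j) e : R)%R).
  apply/integrableP; split.
    by apply/measurable_EFinP/measurable_indic; have [] := fI i j.
  rewrite (eq_integral (fun x => (\1_(B i `&` B j) x)%:E)); last first.
    by move=> x _; rewrite /= ger0_norm.
  by have [mI fI'] := fI i j; rewrite integral_indic// setIT.
have HF i := integral_lincomb (size s) c (iF i).
have HG i := integral_lincomb (size s) c (iG i).
have [iF2 eF2] := integral_lincomb (size s) c (fun i => proj1 (HF i)).
have [iG2 eG2] := integral_lincomb (size s) c (fun i => proj1 (HG i)).
rewrite !absmom2E.
have simple2 e : (simple_fun s e ^+ 2 =
    \sum_(i < size s) c i * (\sum_(j < size s) c j * \1_(B i `&` B j) e))%R.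
  rewrite simple_funE expr2 mulr_suml; apply: eq_bigr => i _.
  by rewrite !mulr_sumr; apply: eq_bigr => j _; rewrite indicI /=; ring.
split; last by under eq_integral do rewrite simple2; exact: integrable_lty.
transitivity (\int[P]_w (\sum_(i < size s) c i * (\sum_(j < size s) c j * (comp_count (B i) w * comp_count (B j) w)))%R%:E).
  apply: eq_integral => w _; rewrite simple_compensatedE expr2 mulr_suml; congr EFin.
  apply: eq_bigr => i _; rewrite !mulr_sumr; apply: eq_bigr => j _; ring.
transitivity (\int[m]_e (\sum_(i < size s) c i * (\sum_(j < size s) c j * \1_(B i `&` B j) e))%R%:E); last first.
  by apply: eq_integral => e _; rewrite simple2.
rewrite -[LHS]fineK; last exact: integrable_fin_num.
rewrite -[RHS]fineK; last exact: integrable_fin_num.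
congr EFin; rewrite [LHS]eF2 [RHS]eG2; apply: eq_bigr => i _; congr (_ * _)%R.
have [_ ->] := HF i; have [_ ->] := HG i; apply: eq_bigr => j _; congr (_ * _)%R.
rewrite comp_count_cov; do ?[exact: simple_admissible_nth].
by have [mI fI'] := fI i j; rewrite /Rintegral integral_indic// setIT.
Qed.

Lemma isometry : absmom P 2 (simple_compensated m N s) = absmom m 2 (simple_fun s).
Proof. by case: isometry_lty. Qed.

Lemma simple_fun_lty : absmom m 2 (simple_fun s) < +oo.
Proof. by case: isometry_lty. Qed.

End simple.

Lemma simple_compensated_mean s : simple_admissible m s ->
  P.-integrable setT (EFin \o simple_compensated m N s) /\
  (\int[P]_w simple_compensated m N s w = 0)%R.
Proof.
move=> adm.
have i1 j : P.-integrable setT (EFin \o comp_count (nth (0%R, set0) s j).2).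
  by have [/(_ 1%N)] := comp_count_cumulants (simple_admissible_nth adm j).
have [h1 h2] := integral_lincomb (size s) (fun j => (nth (0%R, set0) s j).1) i1.
have e : simple_compensated m N s = (fun w => \sum_(j < size s) (nth (0%R, set0) s j).1 * comp_count (nth (0%R, set0) s j).2 w)%R.
  by apply/funext => w; rewrite simple_compensatedE.
rewrite e; split => //; rewrite h2 big1// => j _.
by rewrite comp_count_mean ?mulr0//; exact: simple_admissible_nth.
Qed.

Lemma simple_admissible_cat s t : simple_admissible m s -> simple_admissible m t ->
  simple_admissible m (s ++ t).
Proof.
move=> hs ht j; rewrite size_cat nth_cat => jst; case: ifPn => js; first exact: (hs _ js).
by apply: (ht (j - size s)%N); rewrite ltn_subLR// leqNgt.
Qed.

Definition simple_opp (s : seq (R * set E)) : seq (R * set E) := [seq (- x.1, x.2)%R | x <- s].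

Lemma simple_admissible_opp s : simple_admissible m s -> simple_admissible m (simple_opp s).
Proof.
move=> hs j; rewrite size_map => js; rewrite (nth_map (0%R, set0))//; exact: (hs _ js).
Qed.

Lemma simple_compensated_cat s t w :
  simple_compensated m N (s ++ t) w = (simple_compensated m N s w + simple_compensated m N t w)%R.
Proof. by rewrite /simple_compensated big_cat. Qed.

Lemma simple_fun_cat (s t : seq (R * set E)) e :
  simple_fun (s ++ t) e = (simple_fun s e + simple_fun t e)%R.
Proof. by rewrite /simple_fun big_cat. Qed.

Lemma simple_compensated_opp s w :
  simple_compensated m N (simple_opp s) w = (- simple_compensated m N s w)%R.
Proof.
by rewrite /simple_compensated big_map -sumrN; apply: eq_bigr => x _; rewrite mulNr.
Qed.

Lemma simple_fun_opp (s : seq (R * set E)) e : simple_fun (simple_opp s) e = (- simple_fun s e)%R.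
Proof. by rewrite /simple_fun big_map -sumrN; apply: eq_bigr => x _; rewrite mulNr. Qed.

(** A difference of simple integrands is again one, represented by concatenation with the opposite
    list, since overlapping sets are allowed. *)
Lemma isometryB s t : simple_admissible m s -> simple_admissible m t ->
  absmom P 2 (fun w => simple_compensated m N s w - simple_compensated m N t w)%R =
  absmom m 2 (fun e => simple_fun s e - simple_fun t e)%R.
Proof.
move=> hs ht.
transitivity (absmom P 2 (simple_compensated m N (s ++ simple_opp t))).
  by congr absmom; apply/funext => w; rewrite simple_compensated_cat simple_compensated_opp.
rewrite isometry; last by apply: simple_admissible_cat => //; exact: simple_admissible_opp.
by congr absmom; apply/funext => w; rewrite simple_fun_cat simple_fun_opp.
Qed.

Fixpoint simple_disjoint (s : seq (R * set E)) : Prop :=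
  if s is x :: s' then
    (forall j, (j < size s')%N -> (nth (0%R, set0) s' j).2 `&` x.2 = set0) /\ simple_disjoint s'
  else True.

(** Disjointness makes the summands independent, the head living on [B] and the tail on its
    complement, so the cumulants c^(k+1) m(B) add up. The factor [(k != 0)] records the zero
    mean. *)
Lemma simple_compensated_cumulants s : simple_admissible m s -> simple_disjoint s ->
  has_cumulants P (simple_compensated m N s)
    (fun k => (k != 0)%:R * \sum_(x <- s) x.1 ^+ k.+1 * fine (m x.2))%R.
Proof.
elim: s => [|[c B] s IH] adm; rewrite /simple_compensated.
  move=> _; under [X in has_cumulants _ X]eq_fun do rewrite big_nil.
  under [X in has_cumulants _ _ X]eq_fun do rewrite big_nil mulr0.
  exact: has_cumulants0.
move=> [/= dB ds].
have adms : simple_admissible m s by move=> j js; exact: (adm j.+1).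
have fB : finm B by exact: (adm 0%N).
under [X in has_cumulants _ X]eq_fun do rewrite big_cons.
rewrite (_ : (fun k => _) = (fun k => c ^+ k.+1 * ((k != 0)%:R * fine (m B)) +
  (k != 0)%:R * \sum_(x <- s) x.1 ^+ k.+1 * fine (m x.2)))%R; last first.
  by apply/funext => k; rewrite big_cons /=; ring.
apply: has_cumulantsD.
- by apply: measurable_funM => //; apply: measurable_comp_count; case: fB.
- exact: measurable_simple_compensated.
- apply: (@indep_wrt B (~` B)).
  + by case: fB.
  + by apply: measurableC; case: fB.
  + exact: setICr.
  + apply: (proj2 (measurable_wrtP _ _)); apply: measurable_funM => //.
    by apply: (proj1 (measurable_wrtP _ _)); apply: comp_count_wrt => //; case: fB.
  + apply: simple_compensated_wrt => // j js x Bx xB.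
    by have : ((nth (0%R, set0) s j).2 `&` B) x by []; rewrite dB.
- by apply: has_cumulantsZ; exact: comp_count_cumulants.
- exact: IH.
Qed.

End compensated.

(** * Approximation of z by step functions *)

Section step_functions.
Import HBNNSimple.
Context {R : realType}.

(** Simple functions increasing to |z|, multiplied by the sign of z, keep a finite range and the
    domination by |z|. *)
Lemma step_approx : exists g : nat -> R -> R,
  [/\ forall k, measurable_fun setT (g k), forall k, finite_set (range (g k)),
      forall k z, (`|g k z| <= `|z|)%R & forall z, (fun k => g k z) @ \oo --> z].
Proof.
have mabs : measurable_fun setT (fun z : R => `|z|%:E).
  by apply/measurable_EFinP; exact: normr_measurable.
have abs0 (x : R) : setT x -> 0 <= `|x|%:E by rewrite lee_fin.
pose h := nnsfun_approx measurableT mabs.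
exists (fun k z => h k z * Num.sg z)%R; split.
- move=> k; apply: measurable_funM => //.
  rewrite (_ : Num.sg = (fun z : R => \1_([set` `]0, +oo[%R]) z - \1_([set` `]-oo, 0[%R]) z)%R).
    by apply: measurable_funB; exact: measurable_indic.
  apply/funext => z; rewrite !indicE !mem_setE !in_itv/= andbT.
  by case: sgrP; rewrite ?ltxx ?subr0 ?sub0r//; move=> z0; rewrite ?z0 ?(lt_gtF z0) ?subr0 ?sub0r.
- move=> k; apply: (@sub_finite_set _ _ [set (x * y)%R | x in range (h k) & y in [set -1; 0; 1]%R]).
    move=> _ [z _ <-]; exists (h k z) => //; exists (Num.sg z) => //.
    by rewrite /=; case: sgrP; tauto.
  apply: finite_image2; first exact: fimfunP.
  by do ?[rewrite finite_setU; split]; exact: finite_set1.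
- move=> k z; rewrite normrM normr_sg.
  have hz : (h k z <= `|z|)%R by rewrite -lee_fin /h nnsfun_approxE; exact: le_approx.
  have h0 : (0 <= h k z)%R by [].
  by rewrite (ger0_norm h0); case: eqP => _; rewrite ?mulr1// mulr0 normr_ge0.
- move=> z; have hz : (fun k => h k z) @ \oo --> `|z|%R.
    by have /fine_cvgP[_] := @cvg_nnsfun_approx _ _ _ _ measurableT _ mabs abs0 z Logic.I.
  have e : (`|z| * Num.sg z = z)%R by rewrite mulrC -numEsg.
  by rewrite -[X in _ --> X]e; apply: cvgM => //; exact: cvg_cst.
Qed.

(** The value 0 is left out: its level set may have infinite mass, since [nu] may be infinite near
    0. *)
Definition step_values (g : R -> R) : seq R := [seq y <- finmap.enum_fset (fset_set (range g)) | y != 0%R].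

Lemma step_sum (g : R -> R) (F : R -> R) z : finite_set (range g) -> F 0%R = 0%R ->
  (\sum_(y <- step_values g) F y * \1_(g @^-1` [set y]) z = F (g z))%R.
Proof.
move=> fg F0; have ur : uniq (step_values g) by rewrite filter_uniq// finmap.fset_uniq.
have [g0|g0] := eqVneq (g z) 0%R.
  rewrite g0 F0 big_seq big1// => y; rewrite mem_filter => /andP[y0 _].
  by rewrite indicE memNset ?mulr0//= g0 => /esym/eqP; rewrite (negbTE y0).
have gr : g z \in step_values g.
  by rewrite mem_filter g0 in_fset_set// inE; exists z.
rewrite (bigD1_seq (g z))//= indicE mem_set// mulr1 big1 ?addr0// => y yg.
by rewrite indicE memNset ?mulr0//= => /esym/eqP; rewrite (negbTE yg).
Qed.

Lemma step_moment (nu : {measure set (measurableTypeR R) -> \bar R}) (g : R -> R) j :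
  (0 < j)%N -> measurable_fun setT g -> finite_set (range g) ->
  (forall z, `|g z| <= `|z|)%R ->
  \sum_(y <- step_values g) (`|y| ^+ j)%:E * nu (g @^-1` [set y]) <= absmom nu j (@id R).
Proof.
move=> j0 mg fg gz.
have mG y : measurable (g @^-1` [set y] : set (measurableTypeR R)).
  by rewrite -[X in measurable X]setTI; exact: mg.
apply: (@le_trans _ _ (\int[nu]_z (\sum_(y <- step_values g) (`|y| ^+ j * \1_(g @^-1` [set y]) z)%:E))).
  rewrite ge0_integral_sum//; last first.
    by move=> y; apply/measurable_EFinP; apply: measurable_funM => //; exact: measurable_indic.
  rewrite le_eqVlt; apply/orP; left; apply/eqP; apply: eq_bigr => y _.
  under eq_integral do rewrite EFinM.
  rewrite ge0_integralZl//; last by apply/measurable_EFinP; exact: measurable_indic.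
  by rewrite integral_indic// setIT.
under eq_integral do rewrite sumEFin step_sum ?normr0 ?expr0n ?gtn_eqF//.
apply: ge0_le_integral => //.
- exact: measurable_abspow.
- by apply: measurable_abspow; exact: measurable_id.
- by move=> z _; rewrite lee_fin lerXn2r ?nnegrE.
Qed.

End step_functions.

(** * The Levy noise *)

Section levy_noise.
Context {R : realType} {d} {Omega : measurableType d} (P : probability Omega R).
Variables (nu : {measure set (measurableTypeR R) -> \bar R}) (N : R.-ker Omega ~> plane R).
Variable L : set R -> Omega -> R.
Hypothesis Pc : measure_is_complete P.
Hypothesis nu2 : moment nu 2 < +oo.
Hypothesis prm : poisson_random_measure P (intensity nu) N.
Hypothesis levy : is_levy_noise P nu N L.

Lemma momentE p : (0 < p)%N -> moment nu p = absmom nu p (@id R).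
Proof.
move=> p0; rewrite /moment integral_mkcond; apply: eq_integral => z _.
rewrite patchE; case: ifPn => // /negP; rewrite inE /= => /negP; rewrite negbK => /eqP ->.
by rewrite normr0 expr0n gtn_eqF.
Qed.

Definition len (A : set R) : R := fine (@lebesgue_measure R A).

Lemma bounded_borel_lty (A : set R) : bounded_borel A -> @lebesgue_measure R A < +oo.
Proof.
move=> [mA [M AM]]; apply: (@le_lt_trans _ _ (@lebesgue_measure R `[(- M)%R, M]%classic)).
  by apply: le_measure; rewrite ?inE// => x /AM; rewrite ler_norml /= in_itv.
by rewrite lebesgue_measure_itv/= lte_fin; case: ifP => _; rewrite -?EFinB ltry.
Qed.

Lemma lenE (A : set R) : bounded_borel A -> @lebesgue_measure R A = (len A)%:E.
Proof. by move=> bA; rewrite /len fineK// ge0_fin_numE// bounded_borel_lty. Qed.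

Lemma len_ge0 A : (0 <= len A)%R. Proof. exact: fine_ge0. Qed.

Section rectangles.
Variables (A : set R) (g : R -> R).
Hypotheses (bA : bounded_borel A) (mg : measurable_fun setT g).
Hypotheses (fg : finite_set (range g)) (gz : forall z, (`|g z| <= `|z|)%R).

Let G y : set (measurableTypeR R) := g @^-1` [set y].
Let mG y : measurable (G y).
Proof. by rewrite -[X in measurable X]setTI; exact: mg. Qed.

Definition rect_list (r : seq R) : seq (R * set (plane R)) := [seq (y, A `*` G y) | y <- r].

Let rectE y : intensity nu (A `*` G y) = (len A)%:E * nu (G y).
Proof.
have [mA _] := bA; rewrite -lenE//; exact: product_measure2E.
Qed.

(** Chebyshev's inequality: y^2 nu(G y) is at most the second moment, and y is not 0. *)
Let nuG y : y \in step_values g -> nu (G y) < +oo.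
Proof.
move=> yr; have : (`|y| ^+ 2)%:E * nu (G y) < +oo.
  apply: le_lt_trans nu2; rewrite momentE//; apply: le_trans (step_moment nu _ mg fg gz) => //.
  by rewrite (big_rem y)//= leeDl// sume_ge0// => x _; rewrite mule_ge0// lee_fin exprn_ge0.
move: yr; rewrite mem_filter => /andP[y0 _].
rewrite !ltey; apply: contra_neq => ->; rewrite gt0_muley// lte_fin exprn_gt0// normr_gt0//.
Qed.

Lemma rect_admissible : simple_admissible (intensity nu) (rect_list (step_values g)).
Proof.
move=> j; rewrite size_map => jr; rewrite (nth_map 0%R)//=; split.
  by apply: measurableX => //; case: bA.
by rewrite rectE lte_mul_pinfty ?lee_fin ?len_ge0// nuG// mem_nth.
Qed.

Lemma rect_disjoint r : uniq r -> simple_disjoint (rect_list r).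
Proof.
elim: r => //= y r IH /andP[yr ur]; split; last exact: IH.
move=> j; rewrite size_map => jr; rewrite (nth_map 0%R)//=.
rewrite -subset0 => -[x z] [[/= _ e] [_ e']]; move: yr.
by rewrite -e' e mem_nth.
Qed.

Lemma rect_sub r j : (j < size (rect_list r))%N ->
  (nth (0%R, set0) (rect_list r) j).2 `<=` A `*` setT.
Proof.
by rewrite size_map => jr; rewrite (nth_map 0%R)//= => -[x z] [].
Qed.

Lemma rect_fun (e : plane R) :
  simple_fun (rect_list (step_values g)) e = (\1_A (e.1 : R) * g e.2)%R.
Proof.
rewrite /simple_fun big_map -(step_sum (F := id) e.2 fg)// mulr_sumr.
apply: eq_bigr => y _ /=; rewrite (_ : \1_(A `*` G y) e = \1_A (e.1 : R) * \1_(G y) e.2 :> R)%R.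
  by ring.
rewrite !indicE -natrM mulnb; congr (_%:R); congr nat_of_bool.
by apply/idP/andP => [/set_mem[Ax Gy]|[/set_mem Ax /set_mem Gy]];
  [split; exact/mem_set|exact/mem_set].
Qed.

Lemma rect_cumulant j : (0 < j)%N -> absmom nu j (@id R) < +oo ->
  (`|\sum_(x <- rect_list (step_values g)) x.1 ^+ j * fine (intensity nu x.2)| <=
   len A * fine (absmom nu j (@id R)))%R.
Proof.
move=> j0 nuj; apply: (le_trans (ler_norm_sum _ _ _)); rewrite big_map.
have -> : (\sum_(y <- step_values g) `|y ^+ j * fine (intensity nu (A `*` G y))| =
    len A * fine (\sum_(y <- step_values g) (`|y| ^+ j)%:E * nu (G y)))%R.
  rewrite [X in fine X]big_seq -sum_fine; last first.
    by move=> y yr; rewrite fin_numM// ge0_fin_numE ?nuG.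
  rewrite -big_seq mulr_sumr big_seq [RHS]big_seq; apply: eq_bigr => y yr.
  rewrite rectE normrM normrX !fineM// ?ge0_fin_numE ?nuG//=.
  by rewrite [`|len A * _|%R]ger0_norm ?mulr_ge0 ?len_ge0 ?fine_ge0//; ring.
rewrite ler_wpM2l ?len_ge0//; apply: fine_le.
- rewrite ge0_fin_numE; first exact: le_lt_trans (step_moment nu j0 mg fg gz) nuj.
  by apply: sume_ge0 => y _; rewrite mule_ge0// lee_fin exprn_ge0.
- by rewrite ge0_fin_numE ?absmom_ge0.
- exact: step_moment.
Qed.

End rectangles.

Definition zind (A : set R) (e : plane R) : R := (\1_A (e.1 : R) * (e.2 : R))%R.

Lemma measurable_zind A : measurable A -> measurable_fun setT (zind A).
Proof.
move=> mA; apply: measurable_funM.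
  by apply: (measurableT_comp (measurable_indic mA)); exact: measurable_fst.
exact: measurable_snd.
Qed.

Lemma levy_measurable A : bounded_borel A -> measurable_fun setT (L A).
Proof. by move=> /levy[s [_ _ []]]. Qed.

(** Nothing is known about this list beyond its two distances: its sets may overlap and may leave A
    x R. *)
Lemma levy_given A (e : R) : bounded_borel A -> (0 < e)%R ->
  exists s, [/\ simple_admissible (intensity nu) s,
    absmom (intensity nu) 2 (fun x => simple_fun s x - zind A x)%R <= e%:E &
    absmom P 2 (fun w => simple_compensated (intensity nu) N s w - L A w)%R <= e%:E].
Proof.
move=> /levy[s [adm cf [mL _ cY]]] e0.
have h1 := absmom_small (FF := eventually_filter) (ltn0Sn 1) cf e0.
have h2 := absmom_small (FF := eventually_filter) (ltn0Sn 1) cY e0.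
have [n _ h] := filterI h1 h2; have [hn1 hn2] := h n (leqnn n).
by exists (s n).
Qed.

End levy_noise.

Section absmom2_bounds.
Context {d} {T : measurableType d} {R : realType} (mu : {measure set T -> \bar R}).

Lemma absmom2D_le (f g : T -> R) (a b : R) : measurable_fun setT f -> measurable_fun setT g ->
  absmom mu 2 f <= a%:E -> absmom mu 2 g <= b%:E ->
  absmom mu 2 (fun x => f x + g x)%R <= (2 * a + 2 * b)%:E.
Proof.
move=> mf mg fa gb; apply: (le_trans (absmom2D mu mf mg)).
by rewrite (EFinD (2 * a)) (EFinM _ a) (EFinM _ b); apply: leeD; rewrite lee_pmul2l.
Qed.

Lemma absmom2B_le (f g : T -> R) (a b : R) : measurable_fun setT f -> measurable_fun setT g ->
  absmom mu 2 f <= a%:E -> absmom mu 2 g <= b%:E ->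
  absmom mu 2 (fun x => f x - g x)%R <= (2 * a + 2 * b)%:E.
Proof.
move=> mf mg fa gb; apply: (le_trans (absmom2B mu mf mg)).
by rewrite (EFinD (2 * a)) (EFinM _ a) (EFinM _ b); apply: leeD; rewrite lee_pmul2l.
Qed.

End absmom2_bounds.

Section probability_moments.
Context {R : realType} {d} {T : measurableType d} (P : probability T R).

Lemma absmom_even (Y : T -> R) p : ~~ odd p ->
  P.-integrable setT (fun w => (Y w ^+ p)%:E) ->
  absmom P p Y = (\int[P]_w (Y w ^+ p))%R%:E.
Proof.
move=> ep iY; rewrite /Rintegral fineK; last exact: integrable_fin_num.
by apply: eq_integral => w _; rewrite -normrX ger0_norm// exprn_even_ge0.
Qed.

Lemma absmom2_integrable (Y : T -> R) : measurable_fun setT Y -> absmom P 2 Y < +oo ->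
  P.-integrable setT (fun w => (Y w ^+ 2)%:E).
Proof.
move=> mY Y2; apply/integrableP; split.
  by apply/measurable_EFinP; exact: measurable_funX.
by rewrite (eq_integral (fun w => (`|Y w| ^+ 2)%:E))// => w _; rewrite -normrX.
Qed.

Lemma absmom2_integrable1 (Y : T -> R) : measurable_fun setT Y -> absmom P 2 Y < +oo ->
  P.-integrable setT (EFin \o Y).
Proof.
move=> mY Y2.
rewrite (_ : EFin \o Y = EFin \o (fun w => 1 * Y w)%R); last first.
  by apply/funext => w /=; rewrite mul1r.
apply: integrable_mul_sqr => //; last exact: absmom2_integrable.
by under [X in integrable _ _ X]eq_fun do rewrite expr1n; exact: finite_measure_integrable_cst.
Qed.

(** Integrates the pointwise bound |y| <= e + y^2 / e. *)
Lemma absmom1_le (Y : T -> R) (e : R) : measurable_fun setT Y -> (0 < e)%R ->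
  absmom P 2 Y <= (e ^+ 2)%:E -> \int[P]_w `|Y w|%:E <= (2 * e)%:E.
Proof.
move=> mY e0 Y2.
apply: (@le_trans _ _ (\int[P]_w (e%:E + (e^-1)%:E * (`|Y w| ^+ 2)%:E))).
  apply: ge0_le_integral => //.
  - by apply/measurable_EFinP; exact: measurableT_comp.
  - by apply: emeasurable_funD => //; apply: emeasurable_funM => //; exact: measurable_abspow.
  move=> w _; rewrite -EFinM -EFinD lee_fin.
  have := sqr_ge0 (`|Y w| - e); have := normr_ge0 (Y w); move: `|Y w|%R => y y0 h.
  rewrite -(ler_pM2l e0) mulrDr mulrA divff ?gt_eqF// mul1r; nra.
rewrite ge0_integralD//; last 3 first.
- by move=> w _; rewrite lee_fin ltW.
- by move=> w _; rewrite -EFinM lee_fin mulr_ge0 ?invr_ge0 ?(ltW e0)// exprn_ge0.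
- by apply: emeasurable_funM => //; exact: measurable_abspow.
rewrite integral_cst//= probability_setT mule1 ge0_integralZl//; last 2 first.
- exact: measurable_abspow.
- by rewrite lee_fin invr_ge0 ltW.
rewrite mulr_natl mulr2n EFinD leeD2l//.
apply: (@le_trans _ _ ((e^-1)%:E * (e ^+ 2)%:E)); first by rewrite lee_pmul2l ?lte_fin ?invr_gt0.
by rewrite -EFinM expr2 mulrA mulVf ?gt_eqF// mul1r.
Qed.

Lemma ae_absmom p (Y Z : T -> R) : measurable_fun setT Y -> measurable_fun setT Z ->
  {ae P, forall w, Y w = Z w} -> absmom P p Y = absmom P p Z.
Proof.
move=> mY mZ YZ; apply: ae_eq_integral => //; do ?exact: measurable_abspow.
by apply: filterS YZ => w -> _.
Qed.

End probability_moments.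

(** * Moments, measurability and additivity of the noise *)

Section levy_moments.
Context {R : realType} {d} {Omega : measurableType d} (P : probability Omega R).
Variables (nu : {measure set (measurableTypeR R) -> \bar R}) (N : R.-ker Omega ~> plane R).
Variable L : set R -> Omega -> R.
Hypothesis Pc : measure_is_complete P.
Hypothesis nu2 : moment nu 2 < +oo.
Hypothesis prm : poisson_random_measure P (intensity nu) N.
Hypothesis levy : is_levy_noise P nu N L.

Let m := intensity nu.

(** Read off from the approximations that define [L A]: a simple integrand has finite norm and lies
    at finite distance from [zind A]. No integral over the product has to be computed. *)
Lemma zind_lty A : bounded_borel A -> absmom m 2 (zind A) < +oo.
Proof.
move=> bA; have mA := measurable_zind (proj1 bA).
have [s [adm sf _]] := levy_given levy bA ltr01.
have ms := measurable_simple_fun adm.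
rewrite (_ : zind A = fun x => simple_fun s x - (simple_fun s x - zind A x))%R; last first.
  by apply/funext => x; rewrite subKr.
apply: le_lt_trans (absmom2B _ ms (measurable_funB ms mA)) _.
rewrite lte_add_pinfty ?lte_mul_pinfty ?lee_fin//; first exact: (simple_fun_lty prm Pc adm).
by apply: le_lt_trans sf _; rewrite ltry.
Qed.

(** The rectangle integrands 1_A(x) g_k(z) converge to 1_A(x) z in L^2(m), by domination. They are
    therefore close to a list given by the definition of [L A], and the isometry moves this
    closeness to the integrals. Unlike the given list, they are disjoint, lie over A and have
    controlled cumulants. *)
Lemma levy_good A (e : R) : bounded_borel A -> (0 < e)%R ->
  exists s, [/\ simple_admissible m s, simple_disjoint s,
    forall j, (j < size s)%N -> (nth (0%R, set0) s j).2 `<=` A `*` setT,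
    absmom P 2 (fun w => simple_compensated m N s w - L A w)%R <= e%:E &
    forall j, (0 < j)%N -> absmom nu j (@id R) < +oo ->
      (`|\sum_(x <- s) x.1 ^+ j * fine (m x.2)| <= len A * fine (absmom nu j (@id R)))%R].
Proof.
move=> bA e0; have mA := measurable_zind (proj1 bA).
have mLA := levy_measurable levy bA.
have [g [mg fg gz gcvg]] := @step_approx R.
pose r k := rect_list A (g k) (step_values (g k)).
have radm k : simple_admissible m (r k) by exact: rect_admissible.
(* The inequality (u + v)^2 <= 2 u^2 + 2 v^2 is used twice, and 2 (2 + 2) + 2 = 10. *)
have e10 : (0 < e / 10)%R by rewrite divr_gt0.
have [s [adm sf sL]] := levy_given levy bA e10.
have ms := measurable_simple_fun adm.
pose f k (x : plane R) := (`|simple_fun (r k) x - zind A x| ^+ 2)%:E.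
have rz k x : (`|simple_fun (r k) x| <= `|zind A x|)%R.
  by rewrite rect_fun// /zind !normrM ler_wpM2l.
have fcvg : \int[m]_x f k x @[k --> \oo] --> \int[m]_x (cst 0 x).
  apply: (dominated_cvg measurableT (g := fun x => 4%:E * (`|zind A x| ^+ 2)%:E)).
  - by move=> k; apply: measurable_abspow; apply: measurable_funB => //; exact: measurable_simple_fun.
  - move=> x _; rewrite /f.
    have : (fun k => simple_fun (r k) x - zind A x)%R @ \oo --> (zind A x - zind A x)%R.
      apply: cvgB; last exact: cvg_cst.
      rewrite (_ : (fun k => _) = fun k => \1_A (x.1 : R) * g k x.2)%R; last first.
        by apply/funext => k; rewrite rect_fun.
      by apply: cvgM; [exact: cvg_cst|exact: gcvg].
    rewrite subrr => h; have := cvgM (cvg_norm h) (cvg_norm h); rewrite normr0 mulr0 => h2.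
    by apply: cvg_EFin; [exact: nearW|exact: h2].
  - by [].
  - apply: integrableZl => //; apply/integrableP; split; first exact: measurable_abspow.
    rewrite (eq_integral (fun x => (`|zind A x| ^+ 2)%:E)); first exact: zind_lty.
    by move=> x _; rewrite /= ger0_norm ?exprn_ge0.
  - move=> k x _; rewrite -EFinM lee_fin ger0_norm ?exprn_ge0//.
    rewrite (_ : 4 * _ = (`|zind A x| + `|zind A x|) ^+ 2)%R; last by ring.
    rewrite lerXn2r ?nnegrE ?addr_ge0//.
    by rewrite (le_trans (ler_normB _ _))// lerD2r.
rewrite integral0 in fcvg.
have e10' : 0 < (e / 10)%:E by rewrite lte_fin.
have [k _ hk] := fcvg _ (open_ereal_lt' e10').
have {hk} rf : absmom m 2 (fun x => simple_fun (r k) x - zind A x)%R <= (e / 10)%:E.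
  by apply: ltW; exact: (hk k (leqnn k)).
exists (r k); split => //.
- by apply: rect_disjoint; rewrite filter_uniq// finmap.fset_uniq.
- by move=> j; exact: rect_sub.
- have mr := measurable_simple_fun (radm k).
  have mcr := measurable_simple_compensated N (radm k).
  have mcs := measurable_simple_compensated N adm.
  apply: (le_trans (absmom2_tri P mcr mcs mLA)).
  rewrite (isometryB prm Pc (radm k) adm).
  have h1 := absmom2_tri m mr mA ms.
  have h2 : absmom m 2 (fun x => zind A x - simple_fun s x)%R <= (e / 10)%:E.
    apply: le_trans sf; rewrite -absmomN le_eqVlt; apply/orP; left; apply/eqP.
    by congr absmom; apply/funext => x; rewrite opprB.
  apply: (@le_trans _ _ (2%:E * (2%:E * (e / 10)%:E + 2%:E * (e / 10)%:E) + 2%:E * (e / 10)%:E)).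
    apply: leeD; last by rewrite lee_pmul2l.
    rewrite lee_pmul2l//; apply: (le_trans h1); apply: leeD; by rewrite lee_pmul2l.
  by rewrite -!(EFinM, EFinD) lee_fin; lra.
- by move=> j j0 nuj; exact: rect_cumulant.
Qed.

(** For a good approximation the recursion reduces the second moment to the second cumulant, since
    the first one vanishes; [absmom_lsc] passes to the limit. *)
Lemma levy_var A : bounded_borel A ->
  absmom P 2 (L A) <= (len A * fine (moment nu 2))%:E.
Proof.
move=> bA; apply: absmom_lsc; first exact: (levy_measurable levy bA).
move=> e e0; have [s [adm ds _ sL kap]] := levy_good bA e0.
exists (simple_compensated m N s); split => //; first exact: measurable_simple_compensated.
have [iY rec] := simple_compensated_cumulants prm Pc adm ds.
rewrite absmom_even// rec big_ord_recr big_ord1 /=.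
rewrite mul0r mulr0 mul0r add0r !mul1r.
under eq_Rintegral do rewrite expr0.
rewrite Rintegral_cst//= probability_setT !mulr1 -EFinD lee_fin.
have nu2' := nu2; rewrite momentE// in nu2' *.
rewrite (le_trans (ler_norm _))// (le_trans (kap 2%N isT nu2'))// lerDl ltW//.
Qed.

(** [cumulant_moment_bound] is applied with a = |A| to good approximations. The constant [D] bounds
    all intermediate moments of [nu] at once, because |z|^j <= |z|^2 + |z|^p for 2 <= j <= p. *)
Lemma levy_moment p : (2 <= p)%N -> ~~ odd p -> moment nu p < +oo ->
  exists2 c : R, (0 <= c)%R & forall A, bounded_borel A -> (len A <= 1)%R ->
    absmom P p (L A) <= (len A * (fine (moment nu p) + c * len A))%:E.
Proof.
move=> p2 ep nup; have p0 : (0 < p)%N by exact: leq_trans p2.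
pose D := fine (moment nu 2 + moment nu p).
have nu20 : 0 <= moment nu 2 by rewrite momentE// absmom_ge0.
have nup0 : 0 <= moment nu p by rewrite momentE// absmom_ge0.
have nup' := nup; rewrite momentE// in nup'.
have Dfin : moment nu 2 + moment nu p < +oo by rewrite lte_add_pinfty.
have D0 : (0 <= D)%R by apply: fine_ge0; exact: adde_ge0.
have mid : measurable_fun setT (@id R : measurableTypeR R -> R) by exact: measurable_id.
have nuj j : (2 <= j <= p)%N -> absmom nu j (@id R) <= moment nu 2 + moment nu p.
  move=> /andP[j2 jp]; rewrite !momentE// /absmom -ge0_integralD//; do ?[by exact: measurable_abspow].
  apply: ge0_le_integral => //.
  - exact: measurable_abspow.
  - by apply: emeasurable_funD; exact: measurable_abspow.
  move=> z _; rewrite -EFinD lee_fin.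
  have [z1|z1] := lerP `|z|%R 1%R.
    by rewrite (le_trans (ler_wiXn2l _ _ j2))// lerDl exprn_ge0.
  by rewrite (le_trans (ler_weXn2l (ltW z1) jp))// lerDr exprn_ge0.
have [c c0 hc] := cumulant_moment_bound p0 D0.
exists c => // A bA A1; apply: absmom_lsc; first exact: (levy_measurable levy bA).
move=> e e0; have [s [adm ds _ sL kap]] := levy_good bA e0.
exists (simple_compensated m N s); split => //; first exact: measurable_simple_compensated.
have [iY rec] := simple_compensated_cumulants prm Pc adm ds.
rewrite absmom_even// -EFinD lee_fin.
have A01 : (0 <= len A <= 1)%R by rewrite len_ge0.
have M0 : (\int[P]_w (simple_compensated m N s w ^+ 0) = 1)%R.
  under eq_Rintegral do rewrite expr0.
  by rewrite Rintegral_cst//= probability_setT mulr1.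
have kD k : (k < p)%N ->
    (`|(k != 0)%:R * \sum_(x <- s) x.1 ^+ k.+1 * fine (m x.2)| <= len A * D)%R.
  move=> kp; case: eqP => [_|/eqP k0]; first by rewrite mul0r normr0 mulr_ge0// len_ge0.
  have jk : (2 <= k.+1 <= p)%N by rewrite kp ltnS lt0n k0.
  have jlty := le_lt_trans (nuj _ jk) Dfin.
  rewrite mul1r (le_trans (kap k.+1 isT jlty))// ler_wpM2l ?len_ge0//.
  apply: fine_le; last exact: nuj.
    by rewrite ge0_fin_numE// absmom_ge0.
  by rewrite ge0_fin_numE// adde_ge0.
have := hc (fun n => \int[P]_w (simple_compensated m N s w ^+ n))%R _ (len A) A01 M0 _ kD rec.
rewrite mul0r => /(_ erefl); rewrite prednK// => h.
(* Index p - 1 carries the cumulant of order p; as p >= 2, the factor that removes the mean is 1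
   here. *)
have pm1 : (p.-1 != 0)%N by case: p p2 {p0 ep nup nup' D Dfin D0 nuj hc iY rec kD h A1 nup0} => [|[|]].
rewrite pm1 mul1r in h.
have h2 := kap p p0 nup'; rewrite -(momentE nu p0) in h2.
apply: (le_trans (ler_norm _)).
rewrite -[X in (`|X| <= _)%R](subrK (\sum_(x <- s) x.1 ^+ p * fine (m x.2))%R).
rewrite (le_trans (ler_normD _ _))// (le_trans (lerD h h2))//.
by rewrite mulrDr addrC (_ : c * _ = len A * (c * len A))%R ?lerDl ?ltW//; ring.
Qed.

Lemma levy_integrable A : bounded_borel A -> P.-integrable setT (EFin \o L A).
Proof.
move=> bA; apply: absmom2_integrable1; first exact: (levy_measurable levy bA).
by apply: le_lt_trans (levy_var bA) _; rewrite ltry.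
Qed.

Lemma levy_mean A : bounded_borel A -> (\int[P]_w L A w = 0)%R.
Proof.
move=> bA; apply/eqP; rewrite -normr_le0; apply/ler_addgt0Pr => e e0; rewrite add0r.
(* An L^2 error of (e / 2)^2 gives an L^1 error of e by [absmom1_le]. *)
have e2 : (0 < (e / 2) ^+ 2)%R by rewrite exprn_gt0// divr_gt0.
have [s [adm ds _ sL kap]] := levy_good bA e2.
have [iY Y0] := simple_compensated_mean prm adm.
have mY := measurable_simple_compensated N adm.
have mLA := levy_measurable levy bA.
have iL := levy_integrable bA.
rewrite -[X in `|X|%R]opprK normrN -[X in `|X|%R]add0r -Y0 -RintegralB//.
have := le_normr_Rintegral measurableT (integrableB measurableT iY iL).
move=> /le_trans; apply.
rewrite -lee_fin fineK; last first.
  apply: integrable_fin_num => //; exact: (integrable_norm (integrableB measurableT iY iL)).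
have := absmom1_le (measurable_funB mY mLA) _ sL; rewrite divr_gt0// => /(_ isT).
by rewrite (_ : 2 * (e / 2) = e)%R//; field.
Qed.

(** Good approximations use counts of subsets of A x R only, and null sets belong to [sigmaN], which
    makes it closed under L^2 limits. *)
Lemma levy_wrt A U : bounded_borel A -> A `*` setT `<=` U ->
  measurable_wrt (sigmaN P N U) (L A).
Proof.
move=> bA AU; apply: (measurable_wrt_closed (P := P)).
- exact: pcylinders_measurable.
- by move=> D nD; exact: sigmaN_negligible.
- exact: (levy_measurable levy bA).
move=> e e0; have [s [adm ds sA sL kap]] := levy_good bA e0.
exists (simple_compensated m N s); split => //; first exact: measurable_simple_compensated.
by apply: simple_compensated_wrt => // j js; apply: subset_trans AU; exact: sA.
Qed.

Lemma bounded_borelU (A B : set R) : bounded_borel A -> bounded_borel B -> bounded_borel (A `|` B).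
Proof.
move=> [mA [a Aa]] [mB [b Bb]]; split; first exact: measurableU.
by exists (Num.max a b) => x [/Aa|/Bb] h; rewrite le_max h ?orbT.
Qed.

(** The three variables are versions fixed separately, so additivity can hold almost surely only.
    Their approximations are compared through the isometry, where it reduces to the additivity of
    indicators. *)
Lemma levy_add A B : bounded_borel A -> bounded_borel B -> A `&` B = set0 ->
  {ae P, forall w, L (A `|` B) w = L A w + L B w}%R.
Proof.
move=> bA bB AB; have bAB := bounded_borelU bA bB.
have mLA := levy_measurable levy bA; have mLB := levy_measurable levy bB.
have mLAB := levy_measurable levy bAB.
have mA := measurable_zind (proj1 bA); have mB := measurable_zind (proj1 bB).
have mAB := measurable_zind (proj1 bAB).
suff : {ae P, forall w, L (A `|` B) w - (L A w + L B w) = 0}%R.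
  by apply: filterS => w /eqP; rewrite subr_eq0 => /eqP.
apply: (@absmom_eq0 _ _ _ P 2) => //.
  by apply: measurable_funB => //; exact: measurable_funD.
(* The nested inequalities (u + v)^2 <= 2 u^2 + 2 v^2 give e / 10 for [iso] and 2 e / 5 in total. *)
move=> e e0; have e1 : (0 < e / 100)%R by rewrite divr_gt0.
have [s [sadm sf sL]] := levy_given levy bA e1.
have [t [tadm tf tL]] := levy_given levy bB e1.
have [u [uadm uf uL]] := levy_given levy bAB e1.
have stadm := simple_admissible_cat sadm tadm.
have mcs := measurable_simple_compensated N sadm; have ms := measurable_simple_fun sadm.
have mct := measurable_simple_compensated N tadm; have mt := measurable_simple_fun tadm.
have mcu := measurable_simple_compensated N uadm; have mu := measurable_simple_fun uadm.
have iso : absmom P 2 (fun w => simple_compensated m N (s ++ t) w - simple_compensated m N u w)%R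
    <= (e / 10)%:E.
  rewrite (isometryB prm Pc stadm uadm).
  have -> : (fun x => simple_fun (s ++ t) x - simple_fun u x)%R =
    (fun x => (simple_fun s x - zind A x) + ((simple_fun t x - zind B x) - (simple_fun u x - zind (A `|` B) x)))%R.
    apply/funext => x; rewrite simple_fun_cat /zind.
    have -> : \1_(A `|` B) (x.1 : R) = (\1_A (x.1 : R) + \1_B (x.1 : R))%R :> R.
      rewrite !indicE -natrD; congr (_%:R); rewrite in_setU.
      have [Ax|] := boolP ((x.1 : R) \in A); have [Bx|] := boolP ((x.1 : R) \in B) => //.
      have : (A `&` B) (x.1 : R) by split; exact/set_mem.
      by rewrite AB.
    by ring.
  apply: le_trans (absmom2D_le _ _ sf (absmom2B_le _ _ tf uf)) _;
    do ?[by do ?apply: measurable_funB].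
  by rewrite lee_fin; lra.
have -> : (fun w => L (A `|` B) w - (L A w + L B w))%R =
  (fun w => (((simple_compensated m N s w - L A w) + (simple_compensated m N t w - L B w)) -
   (simple_compensated m N u w - L (A `|` B) w)) -
   (simple_compensated m N (s ++ t) w - simple_compensated m N u w))%R.
  by apply/funext => w; rewrite simple_compensated_cat; ring.
have mst := measurable_simple_compensated N stadm.
apply: le_trans (absmom2B_le _ _ (absmom2B_le _ _ (absmom2D_le _ _ sL tL) uL) iso) _.
- by apply: measurable_funB; [apply: measurable_funD|]; apply: measurable_funB.
- exact: measurable_funB.
- by apply: measurable_funD; apply: measurable_funB.
- exact: measurable_funB.
- exact: measurable_funB.
- exact: measurable_funB.
by rewrite lee_fin; lra.
Qed.

End levy_moments.

(** * Elementary sums and Rosenthal's inequality *)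

Section bounded_products.
Context {R : realType} {d} {T : measurableType d} (mu : {measure set T -> \bar R}).

Definition bounded_rv (Y : T -> R) := exists M : R, forall w, (`|Y w| <= M)%R.

Lemma integrable_bounded_mul (Y Z : T -> R) : bounded_rv Y -> measurable_fun setT Y ->
  mu.-integrable setT (EFin \o Z) -> mu.-integrable setT (EFin \o (fun w => Y w * Z w)%R).
Proof.
move=> [M YM] mY iZ; have := integrableZl measurableT M iZ; apply: le_integrable => //.
  apply/measurable_EFinP; apply: measurable_funM => //.
  by apply/measurable_EFinP; exact: (measurable_int mu iZ).
move=> w _ /=; rewrite lee_fin !normrM ler_wpM2r// (le_trans (YM w))//.
exact: ler_norm.
Qed.

Lemma bounded_rvM (Y Z : T -> R) : bounded_rv Y -> bounded_rv Z ->
  bounded_rv (fun w => Y w * Z w)%R.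
Proof.
by move=> [M YM] [M' ZM]; exists (M * M')%R => w; rewrite normrM ler_pM.
Qed.

Lemma bounded_rv_indic (D : set T) : bounded_rv (\1_D : T -> R).
Proof.
by exists 1%R => w; rewrite ger0_norm// indicE; case: (_ \in _).
Qed.

End bounded_products.

Lemma measurable_bigmax {R : realType} {d} {T : measurableType d} {I : Type} (r : seq I)
    (F : I -> T -> R) (x : R) :
  (forall i, measurable_fun setT (F i)) ->
  measurable_fun setT (fun w => \big[Num.max/x]_(i <- r) F i w)%R.
Proof.
move=> mF; elim: r => [|i r IH].
  by under [X in measurable_fun _ X]eq_fun do rewrite big_nil; exact: measurable_cst.
by under [X in measurable_fun _ X]eq_fun do rewrite big_cons; exact: measurable_maxr.
Qed.

Section sub_sigma.
Context {R : realType} {d} {T : measurableType d}.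

Lemma sub_measurable_wrt (F G : set (set T)) (f : T -> R) : F `<=` G ->
  measurable_wrt F f -> measurable_wrt G f.
Proof. by move=> FG hf C /hf; exact: FG. Qed.

Lemma measurable_wrtM (F : set (set T)) (f g : T -> R) : measurable_wrt <<s F >> f ->
  measurable_wrt <<s F >> g -> measurable_wrt <<s F >> (fun w => f w * g w)%R.
Proof.
move=> hf hg; apply: (proj2 (measurable_wrtP _ _)).
by apply: measurable_funM; apply: (proj1 (measurable_wrtP _ _)).
Qed.

Lemma measurable_wrtD (F : set (set T)) (f g : T -> R) : measurable_wrt <<s F >> f ->
  measurable_wrt <<s F >> g -> measurable_wrt <<s F >> (fun w => f w + g w)%R.
Proof.
move=> hf hg; apply: (proj2 (measurable_wrtP _ _)).
by apply: measurable_funD; apply: (proj1 (measurable_wrtP _ _)).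
Qed.

Lemma measurable_wrtX (F : set (set T)) (f : T -> R) k : measurable_wrt <<s F >> f ->
  measurable_wrt <<s F >> (fun w => f w ^+ k)%R.
Proof.
move=> hf; apply: (proj2 (measurable_wrtP _ _)).
by apply: measurable_funX; apply: (proj1 (measurable_wrtP _ _)).
Qed.

Lemma measurable_wrt_norm (F : set (set T)) (f : T -> R) : measurable_wrt <<s F >> f ->
  measurable_wrt <<s F >> (fun w => `|f w|)%R.
Proof.
move=> hf; apply: (proj2 (measurable_wrtP _ _)).
by apply: measurableT_comp => //; apply: (proj1 (measurable_wrtP _ _)).
Qed.

Lemma measurable_wrt_cst (F : set (set T)) (c : R) : measurable_wrt <<s F >> (fun=> c).
Proof. by apply: (proj2 (measurable_wrtP _ _)). Qed.

Lemma measurable_wrt_indic (F : set (set T)) D : <<s F >> D ->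
  measurable_wrt <<s F >> (\1_D : T -> R).
Proof.
by move=> FD; apply: (proj2 (measurable_wrtP _ _)); apply: (@measurable_indic _ (g_sigma_algebraType F)).
Qed.

Lemma measurable_wrt_fun (F : set (set T)) (f : T -> R) : F `<=` measurable ->
  measurable_wrt F f -> measurable_fun setT f.
Proof. by move=> mF hf _ C mC; rewrite setTI; apply: mF; exact: hf. Qed.

End sub_sigma.

Section elementary.
Context {R : realType} {d} {Omega : measurableType d} (P : probability Omega R).
Variables (nu : {measure set (measurableTypeR R) -> \bar R}) (N : R.-ker Omega ~> plane R).
Variable L : set R -> Omega -> R.
Hypothesis Pc : measure_is_complete P.
Hypothesis nu2 : moment nu 2 < +oo.
Hypothesis prm : poisson_random_measure P (intensity nu) N.
Hypothesis levy : is_levy_noise P nu N L.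

Definition past (b : R) : set (plane R) := [set` `]-oo, b]%R] `*` setT.
Definition future (b : R) : set (plane R) := [set` `]b, +oo[%R] `*` setT.
Definition piece (K u v : R) : set R := [set` `]u, v]%R] `&` [set` `[(- K)%R, K]%R].

Lemma measurable_past b : measurable (past b).
Proof. by apply: measurableX. Qed.

Lemma measurable_future b : measurable (future b).
Proof. by apply: measurableX. Qed.

Lemma past_future b : past b `&` future b = set0.
Proof.
rewrite -subset0 => -[x z] [[/= + _] [/= + _]]; rewrite !in_itv/= andbT => h.
by rewrite ltNge h.
Qed.

Lemma past_le b c : (b <= c)%R -> past b `<=` past c.
Proof.
by move=> bc [x z] [/= + _]; rewrite in_itv/= => h; split => //=; rewrite in_itv/= (le_trans h).
Qed.

(** The coefficients may thus be treated as measurable for the noise on the whole left half-plane,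
    which contains the past values of [L] and is independent of the noise to the right. *)
Lemma filtration_past b : filtration P N b `<=` sigmaN P N (past b).
Proof.
apply: smallest_sub; first exact: smallest_sigma_algebra.
move=> D [|nD]; last exact: sigmaN_negligible.
move=> [a [b' [Gam [C [[ab bb] [mG _] mC ->]]]]]; apply: kernel_sigmaN => //.
  exact: measurableX.
move=> [x z] [/= + _]; rewrite in_itv/= => /andP[_ xb]; split => //=.
by rewrite in_itv/= (le_trans xb).
Qed.

Lemma bounded_piece K u v : bounded_borel (piece K u v).
Proof.
split; first exact: measurableI.
by exists K => x [_ /=]; rewrite in_itv/= ler_norml.
Qed.

Lemma len_piece K u v : (u <= v)%R -> (len (piece K u v) <= v - u)%R.
Proof.
move=> uv; rewrite -lee_fin -lenE; last exact: bounded_piece.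
apply: (@le_trans _ _ (@lebesgue_measure R [set` `]u, v]%R])).
  by apply: le_measure; rewrite ?inE//; [exact: measurableI|move=> x []].
rewrite lebesgue_measure_itv/= lte_fin; case: ltP => //.
by rewrite lee_fin subr_ge0.
Qed.

Lemma piece_split K u v x : (u <= x <= v)%R ->
  piece K u v = piece K u x `|` piece K x v /\ piece K u x `&` piece K x v = set0.
Proof.
move=> /andP[ux xv]; split.
  rewrite /piece -setIUl; congr (_ `&` _); apply/seteqP; split => y /=; rewrite !in_itv/=.
    move=> /andP[uy yv]; have [yx|yx] := lerP y x; [left|right]; rewrite ?in_itv/=.
      by rewrite uy.
    by rewrite yv.
  move=> [|] /andP[h1 h2]; apply/andP; split => //.
    exact: le_trans xv.
  exact: le_lt_trans h1.
rewrite -subset0 => y [[/= + _] [/= + _]]; rewrite !in_itv/= => /andP[_ h] /andP[h' _].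
by move: h'; rewrite ltNge h.
Qed.

Lemma len_piece_split K u v x : (u <= x <= v)%R ->
  len (piece K u v) = (len (piece K u x) + len (piece K x v))%R.
Proof.
move=> /(piece_split K)[e1 e2]; apply: EFin_inj.
rewrite EFinD -!lenE; do ?exact: bounded_piece.
rewrite e1 measureU//; [exact: (proj1 (bounded_piece _ _ _))..].
Qed.

Variable K : R.

Section one_partition.
Variables (n : nat) (t : nat -> R) (Y : nat -> Omega -> R) (dl : R).

(** [dl] bounds the mesh. Coinciding knots and the larger sigma-algebras [sigmaN] are allowed, so
    that the class is stable under bisection. *)
Definition elementary := [/\ forall k, (k < n)%N -> (t k <= t k.+1 <= t k + dl)%R,
  forall k, (k < n)%N -> bounded_rv (Y k) &
  forall k, (k < n)%N -> measurable_wrt (sigmaN P N (past (t k))) (Y k)].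

Let A k := piece K (t k) (t k.+1).

Definition elem_sum (k : nat) (w : Omega) : R := (\sum_(j < k) Y j w * L (A j) w)%R.
(** The integral of the r-th power over [-K, K] of the step process with coefficients [Y], as
    [inner_step] shows for r > 0. *)
Definition elem_norm (r : nat) (w : Omega) : R := (\sum_(j < n) `|Y j w| ^+ r * len (A j))%R.

Hypothesis elem : elementary.

Let tle k : (k < n)%N -> (t k <= t k.+1)%R.
Proof. by case: elem => h _ _ /h /andP[]. Qed.

Let tmono j k : (j <= k <= n)%N -> (t j <= t k)%R.
Proof.
move=> /andP[]; elim: k => [|k IH]; first by rewrite leqn0 => /eqP ->.
rewrite leq_eqVlt => /orP[/eqP ->//|]; rewrite ltnS => jk kn.
exact: le_trans (IH jk (ltnW kn)) (tle kn).
Qed.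

Let bY k : (k < n)%N -> bounded_rv (Y k). Proof. by case: elem => _ + _; exact. Qed.
Let wY k : (k < n)%N -> measurable_wrt (sigmaN P N (past (t k))) (Y k).
Proof. by case: elem => _ _; exact. Qed.

Let mY k : (k < n)%N -> measurable_fun setT (Y k).
Proof. by move=> kn; apply: measurable_wrt_fun (wY kn); exact: sigmaN_measurable. Qed.

Let bA k : bounded_borel (A k). Proof. exact: bounded_piece. Qed.
Let mL k : measurable_fun setT (L (A k)). Proof. exact: (levy_measurable levy (bA k)). Qed.

Let wL j k : (j < k <= n)%N -> measurable_wrt (sigmaN P N (past (t k))) (L (A j)).
Proof.
move=> jkn; apply: (levy_wrt Pc nu2 prm levy (bA j)).
move=> [x z] [[/= + _] _]; rewrite in_itv/= => /andP[_ xt].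
by split => //=; rewrite in_itv/= (le_trans xt)// tmono.
Qed.

Let wLf k : measurable_wrt (sigmaN P N (future (t k))) (L (A k)).
Proof.
apply: (levy_wrt Pc nu2 prm levy (bA k)).
by move=> [x z] [[/= + _] _]; rewrite in_itv/= => /andP[xt _]; split => //=; rewrite in_itv/= xt.
Qed.

Let wS k : (k <= n)%N -> measurable_wrt (sigmaN P N (past (t k))) (elem_sum k).
Proof.
move=> kn; have : forall j, (j <= k)%N -> measurable_wrt (sigmaN P N (past (t k))) (elem_sum j).
  elim=> [_|j IH jk]; rewrite /elem_sum.
    by under [X in measurable_wrt _ X]eq_fun do rewrite big_ord0; exact: measurable_wrt_cst.
  under [X in measurable_wrt _ X]eq_fun do rewrite big_ord_recr/=.
  apply: measurable_wrtD; first exact: (IH (ltnW jk)).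
  apply: measurable_wrtM; last by apply: wL; rewrite jk.
  apply: sub_measurable_wrt (wY (leq_trans jk kn)); apply: sub_sigmaN.
  by apply: past_le; apply: tmono; rewrite kn ltnW.
by apply.
Qed.

Let mS k : (k <= n)%N -> measurable_fun setT (elem_sum k).
Proof. by move=> kn; apply: measurable_wrt_fun (wS kn); exact: sigmaN_measurable. Qed.

Let L2 k : absmom P 2 (L (A k)) < +oo.
Proof. by apply: le_lt_trans (levy_var Pc nu2 prm levy (bA k)) _; rewrite ltry. Qed.

Let indL k (f g : Omega -> R) : measurable_wrt (sigmaN P N (past (t k))) f ->
  measurable_wrt (sigmaN P N (future (t k))) g ->
  forall C D : set R, measurable C -> measurable D ->
  P (f @^-1` C `&` g @^-1` D) = P (f @^-1` C) * P (g @^-1` D).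
Proof.
apply: (indep_wrt prm Pc); [exact: measurable_past|exact: measurable_future|].
exact: past_future.
Qed.

Let iL k : P.-integrable setT (EFin \o L (A k)).
Proof. exact: (levy_integrable Pc nu2 prm levy (bA k)). Qed.

Let increment_mean k (f : Omega -> R) : measurable_wrt (sigmaN P N (past (t k))) f ->
  P.-integrable setT (EFin \o f) -> (\int[P]_w (f w * L (A k) w) = 0)%R /\
  P.-integrable setT (EFin \o (fun w => f w * L (A k) w)%R).
Proof.
move=> wf if_; have mf := measurable_wrt_fun (@sigmaN_measurable _ _ _ _ _ _ _ Pc _) wf.
have ind := indL wf (wLf (k := k)).
split; last exact: (indep_integrableM mf (mL k) ind).
by rewrite (indep_RintegralM mf (mL k) ind)// (levy_mean Pc nu2 prm levy (bA k)) mulr0.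
Qed.

Let increment_abs k r (f : Omega -> R) : measurable_wrt (sigmaN P N (past (t k))) f ->
  absmom P r (fun w => f w * L (A k) w)%R = absmom P r f * absmom P r (L (A k)).
Proof.
move=> wf; have mf := measurable_wrt_fun (@sigmaN_measurable _ _ _ _ _ _ _ Pc _) wf.
have wf' : measurable_wrt (sigmaN P N (past (t k))) (fun w => `|f w| ^+ r)%R.
  by apply: measurable_wrtX; exact: measurable_wrt_norm.
have wl' : measurable_wrt (sigmaN P N (future (t k))) (fun w => `|L (A k) w| ^+ r)%R.
  by apply: measurable_wrtX; apply: measurable_wrt_norm; exact: wLf.
rewrite /absmom -(indep_ge0_integralM _ _ (indL wf' wl')).
- by apply: eq_integral => w _; rewrite normrM exprMn.
- by apply: measurable_funX; exact: measurableT_comp.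
- by apply: measurable_funX; exact: measurableT_comp.
- by move=> w; rewrite exprn_ge0.
- by move=> w; rewrite exprn_ge0.
Qed.

Let absmom_bounded r f : bounded_rv f -> measurable_fun setT f -> absmom P r f < +oo.
Proof.
move=> [M fM] mf; apply: (@le_lt_trans _ _ (\int[P]_w (cst (M ^+ r)%:E w))).
  apply: ge0_le_integral => //; first exact: measurable_abspow.
  by move=> w _; rewrite lee_fin lerXn2r ?nnegrE// (le_trans _ (fM w)).
by rewrite integral_cst//= probability_setT mule1 ltry.
Qed.

Let increment_lty k r : (k < n)%N -> absmom P r (L (A k)) < +oo ->
  absmom P r (fun w => Y k w * L (A k) w)%R < +oo.
Proof.
move=> kn Lr; rewrite increment_abs; last exact: wY.
apply: lte_mul_pinfty; rewrite ?absmom_ge0//.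
by rewrite ge0_fin_numE ?absmom_ge0//; apply: absmom_bounded; [exact: bY|exact: mY].
Qed.

(** Orthogonality of the increments: Y_k S_k is measurable for the past and integrable, and L(A_k)
    is centred and independent of the past, so the cross term vanishes. *)
Lemma elem_sum_isometry k : (k <= n)%N -> absmom P 2 (elem_sum k) < +oo /\
  absmom P 2 (elem_sum k) = \sum_(j < k) absmom P 2 (fun w => Y j w * L (A j) w)%R.
Proof.
elim: k => [_|k IH kn].
  rewrite big_ord0 /elem_sum.
  rewrite (_ : absmom _ _ _ = 0) ?ltry//.
  by rewrite /absmom; under eq_integral do rewrite big_ord0 normr0 expr0n; rewrite integral0.
have [S2 eS] := IH (ltnW kn).
have mSk := mS (ltnW kn).
have mYL : measurable_fun setT (fun w => Y k w * L (A k) w)%R by apply: measurable_funM => //; exact: mY.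
have YL2 := increment_lty kn (L2 k).
have iS2 := absmom2_integrable mSk S2.
have iYL2 := absmom2_integrable mYL YL2.
have iS := absmom2_integrable1 mSk S2.
have wSY : measurable_wrt (sigmaN P N (past (t k))) (fun w => Y k w * elem_sum k w)%R.
  by apply: measurable_wrtM; [exact: wY|exact: (wS (ltnW kn))].
have iSY : P.-integrable setT (EFin \o (fun w => Y k w * elem_sum k w)%R).
  by apply: integrable_bounded_mul => //; [exact: bY|exact: mY].
have [m0 im0] := increment_mean wSY iSY.
have S1E w : elem_sum k.+1 w = (elem_sum k w + Y k w * L (A k) w)%R.
  by rewrite /elem_sum big_ord_recr.
have e : absmom P 2 (elem_sum k.+1) = absmom P 2 (elem_sum k) + absmom P 2 (fun w => Y k w * L (A k) w)%R.
  rewrite !absmom2E.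
  transitivity (\int[P]_w ((elem_sum k w ^+ 2)%:E +
     (((Y k w * L (A k) w) ^+ 2)%:E + 2%:E * (Y k w * elem_sum k w * L (A k) w)%:E))).
    apply: eq_integral => w _; rewrite S1E -EFinM -!EFinD; congr EFin; ring.
  have i2 : P.-integrable setT (fun w => 2%:E * (Y k w * elem_sum k w * L (A k) w)%:E).
    exact: integrableZl.
  rewrite integralD//; last exact: integrableD.
  rewrite integralD// integralZl//.
  have -> : \int[P]_w (Y k w * elem_sum k w * L (A k) w)%:E = 0.
    rewrite -[LHS]fineK; first by move: m0; rewrite /Rintegral => ->.
    exact: integrable_fin_num.
  by rewrite mule0 adde0.
rewrite e big_ord_recr/= eS; split => //.
by rewrite -eS lte_add_pinfty.
Qed.

Let elem_norm_integral r : \sum_(j < n) absmom P r (Y j) * (len (A j))%:E = \int[P]_w (elem_norm r w)%:E.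
Proof.
transitivity (\int[P]_w (\sum_(j < n) (`|Y j w| ^+ r)%:E * (len (A j))%:E)).
  rewrite ge0_integral_sum//.
  - apply: eq_bigr => j _; rewrite ge0_integralZr ?lee_fin ?len_ge0//.
    by apply: measurable_abspow; exact: mY.
  - by move=> j; apply: emeasurable_funM => //; apply: measurable_abspow; exact: mY.
  - by move=> j w _; rewrite mule_ge0// lee_fin ?exprn_ge0 ?len_ge0.
apply: eq_integral => w _; rewrite /elem_norm -sumEFin.
by apply: eq_bigr => j _; rewrite EFinM.
Qed.

Let nu2E : moment nu 2 = (fine (moment nu 2))%:E.
Proof. by rewrite fineK// ge0_fin_numE// momentE// absmom_ge0. Qed.

Lemma elem_sum_l2 : absmom P 2 (elem_sum n) <= moment nu 2 * \int[P]_w (elem_norm 2 w)%:E.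
Proof.
have [_ ->] := elem_sum_isometry (leqnn n).
rewrite -elem_norm_integral nu2E ge0_sume_distrr; last first.
  by move=> j _; rewrite mule_ge0 ?absmom_ge0 ?lee_fin ?len_ge0.
apply: lee_sum => j _; rewrite increment_abs; last exact: wY.
rewrite muleCA lee_wpmul2l ?absmom_ge0//; apply: le_trans (levy_var Pc nu2 prm levy (bA j)) _.
by rewrite EFinM muleC.
Qed.

Let indic_integral D (f : Omega -> R) :
  \int[P]_(w in D) (f w)%:E = \int[P]_w (\1_D w * f w)%:E.
Proof.
rewrite integral_mkcond; apply: eq_integral => w _; rewrite patchE indicE.
by case: (_ \in _); rewrite ?mul1r ?mul0r.
Qed.

Let incrE k w : (elem_sum k.+1 w - elem_sum k w = Y k w * L (A k) w)%R.
Proof. by rewrite /elem_sum big_ord_recr/= addrAC subrr add0r. Qed.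

Let iSk k : (k <= n)%N -> P.-integrable setT (EFin \o elem_sum k).
Proof.
move=> kn; apply: absmom2_integrable1; first exact: mS.
by have [] := elem_sum_isometry kn.
Qed.

Let sgm k := fine (absmom P 2 (L (A k))).
Let sgmE k : absmom P 2 (L (A k)) = (sgm k)%:E.
Proof. by rewrite fineK// ge0_fin_numE ?absmom_ge0. Qed.
Let sgm0 k : (0 <= sgm k)%R. Proof. by rewrite fine_ge0 ?absmom_ge0. Qed.

Let G k := sigmaN P N (past (t k)).
Let mG k : G k `<=` measurable. Proof. exact: sigmaN_measurable. Qed.

Let martingale : is_martingale P n G elem_sum.
Proof.
split.
- split=> [k kn|j k jkn].
    by split; [exact: smallest_sigma_algebra|exact: mG].
  by apply: sub_sigmaN; apply: past_le; exact: tmono.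
- by move=> k kn; split; [exact: wS|exact: iSk].
- move=> k kn; split; [exact: iSk|exact: (iSk (ltnW kn))|exact: (wS (ltnW kn))|].
  move=> D GD; rewrite [LHS]indic_integral [RHS]indic_integral.
  have mD := mG GD.
  have i1 : P.-integrable setT (EFin \o (fun w => \1_D w * elem_sum k w)%R).
    by apply: integrable_bounded_mul; [exact: bounded_rv_indic|exact: measurable_indic|exact: (iSk (ltnW kn))].
  have w2 : measurable_wrt (sigmaN P N (past (t k))) (fun w => \1_D w * Y k w)%R.
    by apply: measurable_wrtM; [exact: measurable_wrt_indic|exact: wY].
  have b2 : bounded_rv (fun w => \1_D w * Y k w)%R.
    by apply: bounded_rvM; [exact: bounded_rv_indic|exact: bY].
  have m2 : measurable_fun setT (fun w => \1_D w * Y k w)%R by exact: (measurable_wrt_fun (@mG k) w2).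
  have i2 : P.-integrable setT (EFin \o (fun w => \1_D w * Y k w)%R).
    apply: absmom2_integrable1 => //; exact: absmom_bounded.
  have [e0 i3] := increment_mean w2 i2.
  transitivity (\int[P]_w ((\1_D w * elem_sum k w)%:E + (\1_D w * Y k w * L (A k) w)%:E)).
    rewrite integralD//.
    have -> : \int[P]_w (\1_D w * Y k w * L (A k) w)%:E = 0.
      rewrite -[LHS]fineK; first by move: e0; rewrite /Rintegral => ->.
      exact: integrable_fin_num.
    by rewrite adde0.
  apply: eq_integral => w _; rewrite -EFinD; congr EFin.
  by rewrite -[elem_sum k.+1 w](subrK (elem_sum k w)) incrE; ring.
Qed.

(** As L(A_k) is independent of the past, conditioning leaves Y_k^2 and replaces L(A_k)^2 by its
    mean. *)
Let condvar k : (k < n)%N ->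
  is_condexp P (G k) (fun w => (elem_sum k.+1 w - elem_sum k w) ^+ 2)%R (fun w => Y k w ^+ 2 * sgm k)%R.
Proof.
move=> kn.
have mYL : measurable_fun setT (fun w => Y k w * L (A k) w)%R by apply: measurable_funM => //; exact: mY.
have YL2 := increment_lty kn (L2 k).
have wY2 : measurable_wrt (G k) (fun w => Y k w ^+ 2)%R by apply: measurable_wrtX; exact: wY.
split.
- rewrite (_ : EFin \o _ = fun w => ((Y k w * L (A k) w) ^+ 2)%:E).
    exact: absmom2_integrable.
  by apply/funext => w /=; rewrite incrE.
- have := integrableZr measurableT (sgm k) (absmom2_integrable (mY kn) (absmom_bounded 2 (bY kn) (mY kn))).
  by [].
- by apply: measurable_wrtM => //; exact: measurable_wrt_cst.
move=> D GD; have mD := mG GD; rewrite [LHS]indic_integral [RHS]indic_integral.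
have wf : measurable_wrt (sigmaN P N (past (t k))) (fun w => \1_D w * Y k w ^+ 2)%R.
  by apply: measurable_wrtM => //; exact: measurable_wrt_indic.
have wg : measurable_wrt (sigmaN P N (future (t k))) (fun w => L (A k) w ^+ 2)%R.
  by apply: measurable_wrtX; exact: wLf.
have mf : measurable_fun setT (fun w => \1_D w * Y k w ^+ 2)%R by exact: (measurable_wrt_fun (@mG k) wf).
have f0 w : (0 <= \1_D w * Y k w ^+ 2)%R by rewrite mulr_ge0 ?sqr_ge0.
transitivity (\int[P]_w (\1_D w * Y k w ^+ 2)%:E * \int[P]_w (L (A k) w ^+ 2)%:E).
  rewrite -absmom2E sgmE -ge0_integralZr//.
  - by apply: eq_integral => w _; rewrite mulrA EFinM.
  - exact/measurable_EFinP.
  - by move=> w _; rewrite lee_fin; exact: f0.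
  - by rewrite lee_fin sgm0.
rewrite -(indep_ge0_integralM _ _ (indL wf wg))//.
- by apply: eq_integral => w _; rewrite incrE; congr EFin; ring.
- exact: measurable_funX.
- by move=> w; rewrite sqr_ge0.
Qed.

(** The conditional variances are bounded through [levy_var]. In the sum of p-th moments, |A_k| <=
    [dl] turns the correction c |A_k| into the uniform error [c * dl]. *)
Lemma elem_rosenthal p (B c : R) : (2 <= p)%N -> ~~ odd p -> rosenthal_constant p B ->
  moment nu p < +oo -> (0 <= c)%R -> (dl <= 1)%R ->
  (forall A, bounded_borel A -> (len A <= 1)%R ->
    absmom P p (L A) <= (len A * (fine (moment nu p) + c * len A))%:E) ->
  absmom P p (elem_sum n) <= (B ^+ p)%:E *
   (\int[P]_w ((fine (moment nu 2) * elem_norm 2 w) ^+ p./2)%:E +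
    (fine (moment nu p) + c * dl)%:E * \int[P]_w (elem_norm p w)%:E).
Proof.
move=> p2 ep [B0 ros] nup c0 dl1 Lp; have p0 : (0 < p)%N by exact: leq_trans p2.
have m20 : (0 <= fine (moment nu 2))%R by rewrite fine_ge0// momentE// absmom_ge0.
have mp0 : (0 <= fine (moment nu p))%R by rewrite fine_ge0// momentE// absmom_ge0.
have lA k : (k < n)%N -> (len (A k) <= dl)%R.
  move=> kn; rewrite (le_trans (len_piece K (tle kn)))//.
  by case: elem => /(_ k kn) /andP[_]; rewrite lerBlDl addrC.
have Lp_lty k : (k < n)%N -> absmom P p (L (A k)) < +oo.
  move=> kn; apply: le_lt_trans (Lp _ (bA k) _) _; last by rewrite ltry.
  by rewrite (le_trans (lA k kn)).
have mmax : measurable_fun setT (fun w => \big[Num.max/0%R]_(k < n.+1) (`|elem_sum k w| ^+ p))%R.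
  apply: measurable_bigmax => k; apply: measurable_funX; apply: measurableT_comp => //.
  by apply: mS; rewrite -ltnS.
apply: (@le_trans _ _ (\int[P]_w (\big[Num.max/0%R]_(k < n.+1) (`|elem_sum k w| ^+ p))%:E)).
  apply: ge0_le_integral => //.
  - by apply: measurable_abspow; exact: mS.
  - by apply/measurable_EFinP; exact: mmax.
  - by move=> w _; rewrite lee_fin; exact: (le_bigmax _ (fun k : 'I_n.+1 => `|elem_sum k w| ^+ p)%R ord_max).
apply: (le_trans (ros _ _ P n G elem_sum _ martingale _ _ condvar)).
- by move=> w; rewrite /elem_sum big_ord0.
- move=> k kn; rewrite (_ : (fun w => _) = EFin \o (fun w => Y k w * L (A k) w)%R).
    by rewrite Lnorm_nat// poweR_lty// increment_lty// Lp_lty.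
  by apply/funext => w /=; rewrite incrE.
apply: lee_wpmul2l; first by rewrite lee_fin exprn_ge0// ltW.
have mYr r (j : 'I_n) : measurable_fun setT (fun w => `|Y j w| ^+ r)%R.
  by apply: measurable_funX; apply: measurableT_comp => //; exact: mY.
have mnorm2 : measurable_fun setT (elem_norm 2).
  by apply: measurable_sum => j; apply: measurable_funM.
have mV : measurable_fun setT (fun w => \sum_(k < n) Y k w ^+ 2 * sgm k)%R.
  by apply: measurable_sum => j; apply: measurable_funM => //; apply: measurable_funX; exact: mY.
apply: leeD.
  have V0 w : (0 <= \sum_(k < n) Y k w ^+ 2 * sgm k)%R.
    by apply: sumr_ge0 => k _; rewrite mulr_ge0 ?sqr_ge0.
  apply: ge0_le_integral => //.
  - by move=> w _; rewrite lee_fin exprn_ge0.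
  - by apply/measurable_EFinP; exact: measurable_funX.
  - by apply/measurable_EFinP; apply: measurable_funX; exact: measurable_funM.
  move=> w _; rewrite lee_fin.
  have VS : (\sum_(k < n) Y k w ^+ 2 * sgm k <= fine (moment nu 2) * elem_norm 2 w)%R.
    rewrite /elem_norm mulr_sumr; apply: ler_sum => k _.
    rewrite real_normK ?num_real// mulrCA ler_wpM2l ?sqr_ge0// mulrC.
    by rewrite -lee_fin -sgmE; exact: (levy_var Pc nu2 prm levy (bA k)).
  by rewrite lerXn2r ?nnegrE// (le_trans (V0 w)).
rewrite -elem_norm_integral ge0_sume_distrr; last first.
  by move=> j _; rewrite mule_ge0 ?absmom_ge0 ?lee_fin ?len_ge0.
apply: lee_sum => k _.
have -> : \int[P]_w (`|elem_sum k.+1 w - elem_sum k w| ^+ p)%:E = absmom P p (fun w => Y k w * L (A k) w)%R.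
  by apply: eq_integral => w _; rewrite incrE.
rewrite increment_abs; last exact: wY.
rewrite muleCA lee_wpmul2l ?absmom_ge0//.
have lk := lA k (ltn_ord k).
apply: le_trans (Lp _ (bA k) (le_trans lk dl1)) _.
by rewrite -EFinM lee_fin mulrC ler_wpM2r ?len_ge0// lerD2l ler_wpM2l.
Qed.

End one_partition.
End elementary.

Lemma sum_double {V : nmodType} (F : nat -> V) n :
  (\sum_(k < n.*2) F k = \sum_(i < n) (F i.*2 + F i.*2.+1))%R.
Proof.
elim: n => [|n IH]; first by rewrite !big_ord0.
by rewrite doubleS !big_ord_recr/= IH addrA.
Qed.

(** * Bisection of the knots *)

Section refinement.
Context {R : realType} {d} {Omega : measurableType d} (P : probability Omega R).
Variables (nu : {measure set (measurableTypeR R) -> \bar R}) (N : R.-ker Omega ~> plane R).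
Variable L : set R -> Omega -> R.
Hypothesis Pc : measure_is_complete P.
Hypothesis nu2 : moment nu 2 < +oo.
Hypothesis prm : poisson_random_measure P (intensity nu) N.
Hypothesis levy : is_levy_noise P nu N L.
Variable K : R.

Section bisection.
Variables (n : nat) (t : nat -> R) (Y : nat -> Omega -> R) (dl : R).
Hypothesis elem : elementary P N n t Y (2 * dl).

Definition bisect_knot k : R := if odd k then ((t k./2 + t k./2.+1) / 2)%R else t k./2.
Definition bisect_coef k := Y k./2.

Let knot_even i : bisect_knot i.*2 = t i.
Proof. by rewrite /bisect_knot odd_double doubleK. Qed.
Let knot_odd i : bisect_knot i.*2.+1 = ((t i + t i.+1) / 2)%R.
Proof. by rewrite /bisect_knot /= odd_double /= uphalf_double. Qed.
Let coef_even i : bisect_coef i.*2 = Y i.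
Proof. by rewrite /bisect_coef doubleK. Qed.
Let coef_odd i : bisect_coef i.*2.+1 = Y i.
Proof. by rewrite /bisect_coef /= uphalf_double. Qed.

Let half_lt k : (k < n.*2)%N -> (k./2 < n)%N.
Proof. by lia. Qed.

Let mid i : (i < n)%N -> (t i <= (t i + t i.+1) / 2 <= t i.+1)%R.
Proof. by move=> iin; case: elem => /(_ i iin) /andP[h _] _ _; apply/andP; split; lra. Qed.

(** Both halves of an interval keep its coefficient; measurable for the past of the left knot, it is
    so for that of the midpoint too. *)
Lemma bisect_elementary : elementary P N n.*2 bisect_knot bisect_coef dl.
Proof.
have [h1 h2 h3] := elem; split=> k kn.
- have kn2 := half_lt kn; have /andP[h h'] := h1 _ kn2.
  rewrite -(odd_double_half k); case: (odd k); rewrite ?add1n ?add0n.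
    by rewrite -doubleS knot_odd knot_even; apply/andP; split; lra.
  by rewrite knot_odd knot_even; apply/andP; split; lra.
- exact: (h2 _ (half_lt kn)).
- apply: sub_measurable_wrt (h3 _ (half_lt kn)); apply: sub_sigmaN; apply: past_le.
  by rewrite /bisect_knot; case: odd => //; case/andP: (mid (half_lt kn)).
Qed.

Lemma bisect_norm r w :
  elem_norm K n.*2 bisect_knot bisect_coef r w = elem_norm K n t Y r w.
Proof.
rewrite /elem_norm (sum_double (fun j => `|bisect_coef j w| ^+ r *
  len (piece K (bisect_knot j) (bisect_knot j.+1)))%R); apply: eq_bigr => i _.
rewrite -doubleS knot_odd !knot_even coef_even coef_odd -mulrDr -len_piece_split//.
exact: mid.
Qed.

(** Additivity of [L] holds off a null set for each interval; the finitely many null sets are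
    collected. *)
Lemma bisect_sum : {ae P, forall w,
  elem_sum L K bisect_knot bisect_coef n.*2 w = elem_sum L K t Y n w}.
Proof.
have h : {ae P, forall w, forall i, (i < n)%N -> L (piece K (t i) (t i.+1)) w =
    (L (piece K (t i) ((t i + t i.+1) / 2)) w + L (piece K ((t i + t i.+1) / 2) (t i.+1)) w)%R}.
  apply/ae_foralln => i; have [iin|ni] := ltnP i n; last by apply: aeW.
  have [e1 e2] := piece_split K (mid iin).
  have := levy_add Pc prm levy (bounded_piece K _ _) (bounded_piece K _ _) e2.
  by rewrite -e1; apply: filterS => w -> _.
apply: filterS h => w h.
rewrite /elem_sum (sum_double (fun j => bisect_coef j w *
  L (piece K (bisect_knot j) (bisect_knot j.+1)) w)%R); apply: eq_bigr => i _.
by rewrite -doubleS knot_odd !knot_even coef_even coef_odd -mulrDr h.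
Qed.

End bisection.

Lemma measurable_elem_sum n t Y dl : elementary P N n t Y dl -> measurable_fun setT (elem_sum L K t Y n).
Proof.
move=> [_ _ wY]; apply: measurable_sum => j; apply: measurable_funM.
  by apply: measurable_wrt_fun (wY _ (ltn_ord j)); exact: sigmaN_measurable.
exact: (levy_measurable levy (bounded_piece _ _ _)).
Qed.

Lemma bounded_elem_norm n t Y dl r : elementary P N n t Y dl ->
  \int[P]_w (elem_norm K n t Y r w)%:E < +oo.
Proof.
move=> [_ bY wY].
have mYr (j : 'I_n) : measurable_fun setT (fun w => `|Y j w| ^+ r * len (piece K (t j) (t j.+1)))%R.
  apply: measurable_funM => //; apply: measurable_funX; apply: measurableT_comp => //.
  by apply: measurable_wrt_fun (wY _ (ltn_ord j)); exact: sigmaN_measurable.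
under eq_integral do rewrite /elem_norm -sumEFin.
rewrite ge0_integral_sum//.
- apply: lte_sum_pinfty => j _; have [M YM] := bY _ (ltn_ord j).
  apply: (@le_lt_trans _ _ (\int[P]_w (cst (M ^+ r * len (piece K (t j) (t j.+1)))%:E w))).
    apply: ge0_le_integral => //.
    - by move=> w _; rewrite lee_fin mulr_ge0 ?exprn_ge0 ?len_ge0.
    - exact/measurable_EFinP.
    - move=> w _; rewrite lee_fin ler_wpM2r ?len_ge0// lerXn2r ?nnegrE//.
      exact: le_trans (YM w).
  by rewrite integral_cst//= probability_setT mule1 ltry.
- by move=> j; exact/measurable_EFinP.
- by move=> j w _; rewrite lee_fin mulr_ge0 ?exprn_ge0 ?len_ge0.
Qed.

(** In [refined], mesh 2^r eta is brought down to eta by r bisections, which leave both sides of the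
    estimate unchanged. The remaining error is proportional to eta, and eta is arbitrary. *)
Lemma elem_bound p (B : R) n t Y dl : (2 <= p)%N -> ~~ odd p -> rosenthal_constant p B ->
  moment nu p < +oo -> elementary P N n t Y dl ->
  absmom P p (elem_sum L K t Y n) <= (B ^+ p)%:E *
   (\int[P]_w ((fine (moment nu 2) * elem_norm K n t Y 2 w) ^+ p./2)%:E +
    moment nu p * \int[P]_w (elem_norm K n t Y p w)%:E).
Proof.
move=> p2 ep ros nup elem; have p0 : (0 < p)%N by exact: leq_trans p2.
have [B0 _] := ros.
have nupE : moment nu p = (fine (moment nu p))%:E.
  by rewrite fineK// ge0_fin_numE// momentE// absmom_ge0.
have [c c0 Lp] := levy_moment Pc nu2 prm levy p2 ep nup.
have refined (eta : R) r : (0 < eta <= 1)%R -> forall n t Y, elementary P N n t Y (2 ^+ r * eta)%R ->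
   absmom P p (elem_sum L K t Y n) <= (B ^+ p)%:E *
   (\int[P]_w ((fine (moment nu 2) * elem_norm K n t Y 2 w) ^+ p./2)%:E +
    (fine (moment nu p) + c * eta)%:E * \int[P]_w (elem_norm K n t Y p w)%:E).
  move=> /andP[eta0 eta1]; elim: r => [|r IH] {elem} n' t' Y' elem.
    by rewrite expr0 mul1r in elem; exact: (elem_rosenthal Pc nu2 prm levy K elem p2 ep ros nup c0 eta1 Lp).
  rewrite exprS -mulrA in elem.
  have elem' := bisect_elementary elem.
  have := IH _ _ _ elem'.
  under eq_integral do rewrite (bisect_norm elem).
  under [X in _ * (_ + _ * X)]eq_integral do rewrite (bisect_norm elem).
  by rewrite (ae_absmom p (measurable_elem_sum elem') (measurable_elem_sum elem) (bisect_sum elem)).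
set I := \int[P]_w (elem_norm K n t Y p w)%:E.
have IE : I = (fine I)%:E.
  rewrite fineK// ge0_fin_numE; first exact: bounded_elem_norm elem.
  apply: integral_ge0 => w _; rewrite lee_fin; apply: sumr_ge0 => j _.
  by rewrite mulr_ge0 ?exprn_ge0 ?len_ge0.
have I0 : (0 <= fine I)%R.
  apply: fine_ge0; apply: integral_ge0 => w _; rewrite lee_fin; apply: sumr_ge0 => j _.
  by rewrite mulr_ge0 ?exprn_ge0 ?len_ge0.
apply/lee_addgt0Pr => e e0.
pose b := (B ^+ p * c * fine I)%R.
have b0 : (0 <= b)%R by rewrite !mulr_ge0// exprn_ge0// ltW.
(* The mesh must be at most 1 for the moment bound of [L], and b eta <= e makes the error
   negligible; b + 1 avoids a division by 0. *)
pose eta := (Num.min 1 (e / (b + 1)))%R.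
have eta0 : (0 < eta)%R by rewrite lt_min ltr01 divr_gt0// ltr_wpDl.
have eta1 : (eta <= 1)%R by rewrite ge_min lexx.
have [r rdl] : exists r, (dl <= 2 ^+ r * eta)%R.
  have q0 : (0 <= `|dl| / eta)%R by rewrite divr_ge0// ltW.
  exists (Num.bound (`|dl| / eta)); rewrite -ler_pdivrMr//.
  apply: (@le_trans _ _ (`|dl| / eta)%R); first by rewrite ler_pM2r ?invr_gt0// ler_norm.
  apply: ltW; apply: (lt_le_trans (archi_boundP q0)).
  by rewrite -natrX ler_nat ltnW// ltn_expl.
have elem' : elementary P N n t Y (2 ^+ r * eta)%R.
  case: elem => h1 h2 h3; split => // k kn; have /andP[h h'] := h1 k kn.
  by rewrite h (le_trans h')// lerD2l.
have eta01 : (0 < eta <= 1)%R by rewrite eta0.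
apply: le_trans (refined _ r eta01 _ _ _ elem') _.
rewrite -/I IE nupE EFinD muleDl ?fin_num_adde_defr// addeA muleDr; last 2 first.
- by [].
- by rewrite fin_num_adde_defl.
rewrite leeD2l// -!EFinM lee_fin.
rewrite (_ : B ^+ p * (c * eta * fine I) = b * eta)%R; last by rewrite /b; ring.
apply: (@le_trans _ _ (b * (e / (b + 1)))%R).
  by rewrite ler_wpM2l// ge_min lexx orbT.
rewrite mulrCA ger_pMr// ler_pdivrMr ?mul1r ?lerDl// ltr_wpDl//.
Qed.

End refinement.

(** * Truncation of the approximating processes *)

Section processes.
Context {R : realType} {d} {Omega : measurableType d} (P : probability Omega R).

Definition jointly_measurable (f : Omega -> R -> R) :=
  measurable_fun setT (fun wx : Omega * measurableTypeR R => f wx.1 wx.2).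

Implicit Types (f g : Omega -> R -> R) (K : R) (r : nat).

Definition window K : set (measurableTypeR R) := [set` `[(- K)%R, K]%R].

Definition inner K r f (w : Omega) : \bar R :=
  \int[@lebesgue_measure R]_(x in window K) (`|f w x| ^+ r)%:E.

Lemma measurable_window K : measurable (window K).
Proof. exact: measurable_itv. Qed.

Lemma jointly_section f w : jointly_measurable f ->
  measurable_fun setT (f w : measurableTypeR R -> R).
Proof. by move=> mf; have := measurableT_comp mf (pair1_measurable w). Qed.

Lemma inner_ge0 K r f w : 0 <= inner K r f w.
Proof. by apply: integral_ge0 => x _; rewrite lee_fin exprn_ge0. Qed.

Lemma innerE K r f w : inner K r f w =
  \int[@lebesgue_measure R]_x (\1_(window K) x * `|f w x| ^+ r)%:E.
Proof.
rewrite /inner integral_mkcond; apply: eq_integral => x _; rewrite patchE indicE.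
by case: (_ \in _); rewrite ?mul1r ?mul0r.
Qed.

Lemma jointly_abspow f r : jointly_measurable f ->
  measurable_fun setT (fun wx : Omega * measurableTypeR R => (`|f wx.1 wx.2| ^+ r)%:E).
Proof. by move=> mf; exact: (measurable_abspow r mf). Qed.

Lemma jointly_window K : measurable_fun setT
  (fun wx : Omega * measurableTypeR R => \1_(window K) wx.2 : R).
Proof. by apply: (measurableT_comp (measurable_indic (measurable_window K))). Qed.

Lemma measurable_inner K r f : jointly_measurable f -> measurable_fun setT (inner K r f).
Proof.
move=> mf; rewrite (_ : inner K r f = fubini_F (@lebesgue_measure R)
  (fun wx : Omega * measurableTypeR R => (\1_(window K) wx.2 * `|f wx.1 wx.2| ^+ r)%:E)).
  apply: measurable_fun_fubini_tonelli_F; last first.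
    by move=> wx; rewrite lee_fin mulr_ge0// exprn_ge0.
  apply/measurable_EFinP; apply: measurable_funM; first exact: jointly_window.
  by apply/measurable_EFinP; exact: jointly_abspow.
by apply/funext => w; rewrite innerE.
Qed.

Lemma inner_product K r f : jointly_measurable f ->
  \int[P]_w inner K r f w = \int[P \x @lebesgue_measure R]_wx
    (\1_(window K) wx.2 * `|f wx.1 wx.2| ^+ r)%:E.
Proof.
move=> mf.
have mg : measurable_fun setT (fun wx : Omega * measurableTypeR R =>
    (\1_(window K) wx.2 * `|f wx.1 wx.2| ^+ r)%:E).
  apply/measurable_EFinP; apply: measurable_funM; first exact: jointly_window.
  by apply/measurable_EFinP; exact: jointly_abspow.
have g0 (wx : Omega * measurableTypeR R) : 0 <= (\1_(window K) wx.2 * `|f wx.1 wx.2| ^+ r)%:E.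
  by rewrite lee_fin mulr_ge0// exprn_ge0.
rewrite (fubini_tonelli1 _ mg g0).
by apply: eq_integral => w _; rewrite innerE.
Qed.

Lemma inner_cst K (c : R) : (0 <= K)%R ->
  \int[@lebesgue_measure R]_(x in window K) c%:E = (c * (2 * K))%:E.
Proof.
move=> K0; rewrite integral_cst//; last exact: measurable_window.
rewrite [X in _ * X](lebesgue_measure_itv `[(- K)%R, K]%R)/= lte_fin; case: ltP => [_|h].
  by rewrite -EFinB -EFinM; congr EFin; ring.
have -> : K = 0%R by apply/eqP; rewrite eq_le K0 andbT; lra.
by rewrite mule0 !mulr0.
Qed.

(** Integrates a pointwise bound over the window. The constant [b] costs b (2 K), which is why
    clipping is analysed on a finite window. *)
Lemma le_inner_affine K r s f g w (a b c : R) : (0 <= K)%R -> (0 <= b)%R -> (0 <= a)%R -> (0 <= c)%R ->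
  jointly_measurable f -> jointly_measurable g -> forall h, jointly_measurable h ->
  (forall x, `|f w x| ^+ r <= a * `|h w x| ^+ r + (b + c * `|g w x| ^+ s))%R ->
  inner K r f w <= a%:E * inner K r h w + ((b * (2 * K))%:E + c%:E * inner K s g w).
Proof.
move=> K0 b0 a0 c0 mf mg h mh fgh.
have mw := measurable_window K.
have m r' f' : jointly_measurable f' -> measurable_fun (window K) (fun x => (`|f' w x| ^+ r')%:E).
  move=> mf'; apply: measurable_funTS; apply: measurable_abspow; exact: jointly_section.
rewrite -(inner_cst b K0) /inner -!ge0_integralZl//; do ?[exact: m].
rewrite -ge0_integralD//; last 2 first.
- by move=> x _; rewrite -EFinM lee_fin mulr_ge0// exprn_ge0.
- by apply: emeasurable_funM => //; exact: m.
rewrite -ge0_integralD//; last 4 first.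
- by move=> x _; rewrite -EFinM lee_fin mulr_ge0// exprn_ge0.
- by apply: emeasurable_funM => //; exact: m.
- by move=> x _; rewrite -EFinM -EFinD lee_fin addr_ge0// mulr_ge0// exprn_ge0.
- by apply: emeasurable_funD => //; apply: emeasurable_funM => //; exact: m.
apply: ge0_le_integral => //.
- exact: m.
- apply: emeasurable_funD; first by apply: emeasurable_funM => //; exact: m.
  by apply: emeasurable_funD => //; apply: emeasurable_funM => //; exact: m.
- by move=> x _; rewrite -!EFinM -!EFinD lee_fin.
Qed.

End processes.

Section step_processes.
Context {R : realType} {d} {Omega : measurableType d} (P : probability Omega R).
Variables (n : nat) (t : nat -> R).
Hypothesis tle : forall k, (k < n)%N -> (t k <= t k.+1)%R.
Local Open Scope ring_scope.

Definition step_process (Y : nat -> Omega -> R) (w : Omega) (x : R) : R :=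
  \sum_(i < n) Y i w * \1_([set` `]t i, t i.+1]]) x.

Let tmono j k : (j <= k <= n)%N -> t j <= t k.
Proof.
move=> /andP[]; elim: k => [|k IH]; first by rewrite leqn0 => /eqP ->.
rewrite leq_eqVlt => /orP[/eqP ->//|]; rewrite ltnS => jk kn.
exact: le_trans (IH jk (ltnW kn)) (tle kn).
Qed.

(** The intervals are disjoint, so at most one term is nonzero at x, and phi(0) = 0 takes care of
    the others. This serves both powers and clipping. *)
Lemma step_process_comp (phi : R -> R) Y w x : phi 0 = 0 ->
  phi (step_process Y w x) = \sum_(i < n) phi (Y i w) * \1_([set` `]t i, t i.+1]]) x.
Proof.
move=> phi0; rewrite /step_process.
have [/existsP[i xi]|/existsPn nx] := boolP [exists i : 'I_n, x \in `]t i, t i.+1]]; last first.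
  by rewrite !big1 ?phi0// => i _; rewrite indicE memNset ?mulr0//=; exact/negP/nx.
have other j : j != i -> \1_([set` `]t j, t j.+1]]) x = 0 :> R.
  move=> ji; rewrite indicE memNset//= => xj.
  move: xi xj; rewrite !in_itv/= => /andP[h1 h2] /andP[h3 h4].
  have [ij|ij|/val_inj e] := ltngtP (i : nat) j; last by rewrite e eqxx in ji.
    have := @tmono i.+1 j; rewrite ij ltnW// => /(_ isT) h.
    by have := lt_le_trans h3 (le_trans h2 h); rewrite ltxx.
  have := @tmono j.+1 i; rewrite ij ltnW// => /(_ isT) h.
  by have := lt_le_trans h1 (le_trans h4 h); rewrite ltxx.
have one : \1_([set` `]t i, t i.+1]]) x = 1 :> R by rewrite indicE mem_set.
rewrite [in LHS](bigD1 i)//= [in RHS](bigD1 i)//= one !mulr1.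
by rewrite !big1 ?addr0// => j ji; rewrite other ?mulr0.
Qed.

Lemma inner_step K r Y w : (0 < r)%N ->
  (inner K r (step_process Y) w = (elem_norm K n t Y r w)%:E)%E.
Proof.
move=> r0; rewrite /inner.
under eq_integral do rewrite (step_process_comp (phi := fun y => `|y| ^+ r)) ?normr0 ?expr0n ?gtn_eqF// -sumEFin.
have mI (i : 'I_n) : measurable ([set` `]t i, t i.+1]] : set (measurableTypeR R)).
  exact: measurable_itv.
have mw := measurable_window K.
rewrite ge0_integral_sum//.
- rewrite /elem_norm -sumEFin; apply: eq_bigr => i _.
  under eq_integral do rewrite EFinM.
  rewrite ge0_integralZl//.
  + rewrite integral_indic// EFinM -lenE//; exact: bounded_piece.
  + by apply: measurable_funTS; apply/measurable_EFinP; exact: measurable_indic.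
- move=> i; apply: measurable_funTS; apply/measurable_EFinP; apply: measurable_funM => //.
Qed.

Lemma jointly_step Y : (forall i, (i < n)%N -> measurable_fun setT (Y i)) ->
  jointly_measurable (step_process Y).
Proof.
move=> mY; apply: measurable_sum => i; apply: measurable_funM.
  by apply: measurableT_comp => //; exact: mY.
have mI : measurable ([set` `]t i, t i.+1]] : set (measurableTypeR R)) by exact: measurable_itv.
exact: (measurableT_comp (measurable_indic mI)).
Qed.

End step_processes.

Section clipation.
Context {R : realType}.
Local Open Scope ring_scope.
Implicit Types (M x y : R).

Definition clip M x : R := Num.max (- M) (Num.min M x).

Lemma clip_bound M x : 0 <= M -> `|clip M x| <= M.
Proof.
by move=> M0; rewrite /clip ler_norml le_max lexx/= ge_max ge_min lexx/= andbT; lra.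
Qed.

Lemma clip_le M x : 0 <= M -> `|clip M x| <= `|x|.
Proof.
move=> M0; rewrite /clip; case: (lerP M x) => h1; case: (lerP (- M) _) => h2;
  rewrite ler_norml; case: (ger0P x) => h3; apply/andP; split; lra.
Qed.

Lemma clip0 M : 0 <= M -> clip M 0 = 0.
Proof. by move=> M0; apply/eqP; rewrite -normr_le0 (le_trans (clip_le 0 M0)) ?normr0. Qed.

Lemma clip_id M x : `|x| <= M -> clip M x = x.
Proof.
by rewrite ler_norml => /andP[h1 h2]; rewrite /clip (min_idPr h2) (max_idPr h1).
Qed.

Lemma clipE M x : 0 <= M -> clip M x = if x < - M then - M else if M < x then M else x.
Proof.
by move=> M0; rewrite /clip; case: (ltP x (- M)) => h1; case: (ltP M x) => h2;
  case: (lerP (- M) _) => h3; lra.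
Qed.

Lemma clip_lip M x y : 0 <= M -> `|clip M x - clip M y| <= `|x - y|.
Proof.
move=> M0; rewrite !clipE//.
by case: (ltP x (- M)) => h1; case: (ltP M x) => h2; case: (ltP y (- M)) => h3;
  case: (ltP M y) => h4; rewrite ler_norml; case: (ger0P (x - y)) => h5;
  apply/andP; split; lra.
Qed.

Lemma clip_diff M x : 0 <= M -> `|clip M x - x| <= `|x|.
Proof.
move=> M0; rewrite clipE//.
by case: (ltP x (- M)) => h1; case: (ltP M x) => h2; rewrite ler_norml;
  case: (ger0P x) => h5; apply/andP; split; lra.
Qed.

Lemma measurable_clip M : measurable_fun setT (clip M).
Proof. by rewrite /clip; apply: measurable_maxr => //; apply: measurable_minr. Qed.

(** If b < a, both lie below M, and a^q - b^q factors as (a - b) times a sum of q terms, each at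
    most M^(q-1). No bound on [b] is assumed, so a clipped value can be compared with an unclipped
    one. *)
Lemma expr_diff_le (a b u M : R) q : 0 <= a <= M -> 0 <= b -> 0 <= u -> a <= b + u ->
  a ^+ q <= b ^+ q + q%:R * M ^+ q.-1 * u.
Proof.
move=> /andP[a0 aM] b0 u0 abu; have M0 := le_trans a0 aM.
have [ab|ba] := lerP a b.
  by rewrite -[leLHS]addr0 lerD// ?lerXn2r// !mulr_ge0// exprn_ge0.
rewrite addrC -lerBlDr subrXX mulrC.
apply: ler_pM; rewrite ?subr_ge0 ?(ltW ba)//; last by lra.
  by apply: sumr_ge0 => i _; rewrite mulr_ge0 ?exprn_ge0.
rewrite mulr_natl -[X in _ *+ X]card_ord -sumr_const; apply: ler_sum => i _.
have iq := ltn_ord i.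
have -> : M ^+ q.-1 = M ^+ (q.-1 - i) * M ^+ i by rewrite -exprD subnK//; lia.
by rewrite ler_pM ?exprn_ge0// lerXn2r ?nnegrE//; lra.
Qed.

End clipation.

Lemma ereal_expr_diff_le {R : realType} (A R0 : R) (b u : \bar R) q : (0 < q)%N ->
  (0 <= A <= R0)%R -> (0 < R0)%R -> 0 <= b -> 0 <= u -> A%:E <= b + u ->
  (A ^+ q)%:E <= b `^ q%:R + (q%:R * R0 ^+ q.-1)%:E * u.
Proof.
move=> q0 A0R R0gt; have qn0 : (q%:R != 0 :> R)%R by rewrite pnatr_eq0 -lt0n.
have c0 : (0 < q%:R * R0 ^+ q.-1)%R by rewrite mulr_gt0 ?ltr0n// exprn_gt0.
case: b => [b| |]//; last first.
  by move=> _ u0 _; rewrite poweRyr// addye ?leey// gt_eqF// (lt_le_trans _ (mule_ge0 _ u0)) ?ltNyr// lee_fin ltW.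
case: u => [u| |]//; last by move=> _ _ _; rewrite gt0_muley ?lte_fin// addey ?leey.
rewrite !lee_fin => b0 u0 Abu.
by rewrite powR_mulrn//; exact: expr_diff_le.
Qed.

Section simple_processes.
Context {R : realType} {d} {Omega : measurableType d} (P : probability Omega R).
Variables (nu : {measure set (measurableTypeR R) -> \bar R}) (N : R.-ker Omega ~> plane R).
Variable L : set R -> Omega -> R.
Hypothesis Pc : measure_is_complete P.

Lemma measurable_wrt_comp (F : set (set Omega)) (f : Omega -> R) (phi : R -> R) :
  measurable_fun setT phi -> measurable_wrt F f -> measurable_wrt F (phi \o f).
Proof.
by move=> mphi hf C mC; apply: (hf (phi @^-1` C)); rewrite -[X in measurable X]setTI; exact: mphi.
Qed.

(** One mesh bound, the crude sum of all gaps, serves every [phi]: clipping, the identity and their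
    difference. *)
Lemma simple_process_elementary (S : simple_process P N) : exists dl : R,
  forall phi : R -> R, measurable_fun setT phi -> (forall y, `|phi y| <= `|y|)%R ->
  elementary P N (sp_size S) (sp_knot S) (fun i w => phi (sp_coef S i w)) dl.
Proof.
exists (\sum_(k < sp_size S) `|sp_knot S k.+1 - sp_knot S k|)%R => phi mphi phile; split => k kn.
- rewrite ltW ?sp_knot_lt//= -lerBlDl (le_trans (ler_norm _))//.
  by rewrite (bigD1 (Ordinal kn))//= lerDl sumr_ge0.
- have [M YM] := sp_coef_bounded kn; exists M => w; exact: le_trans (phile _) (YM w).
- apply: (measurable_wrt_comp mphi).
  by apply: sub_measurable_wrt (sp_coef_measurable kn); exact: filtration_past.
Qed.

Lemma jointly_sp_fun (S : simple_process P N) : jointly_measurable (sp_fun S).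
Proof.
apply: (@jointly_step _ _ _ (sp_size S) (sp_knot S) (sp_coef S)) => i iin.
apply: (@measurable_wrt_fun _ _ _ (sigmaN P N (past (sp_knot S i)))); first exact: sigmaN_measurable.
by apply: sub_measurable_wrt (sp_coef_measurable iin); exact: filtration_past.
Qed.

(** The predictable sigma-field is generated by simple processes, which are jointly measurable. *)
Lemma jointly_predictable (X : Omega -> R -> R) : predictable P N X -> jointly_measurable X.
Proof.
move=> pX _ C mC; rewrite setTI.
have sub : predictable_sigma P N `<=`
    (measurable : set (set (Omega * measurableTypeR R))).
  apply: smallest_sub; first exact: sigma_algebra_measurable.
  move=> _ [S [D [mD ->]]]; rewrite -[X in measurable X]setTI.
  exact: (jointly_sp_fun S measurableT mD).
exact: (sub _ (pX C mC)).
Qed.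

End simple_processes.

Section clipped_integrals.
Context {R : realType} {d} {Omega : measurableType d} (P : probability Omega R).
Variables (nu : {measure set (measurableTypeR R) -> \bar R}) (N : R.-ker Omega ~> plane R).
Variable L : set R -> Omega -> R.
Hypothesis Pc : measure_is_complete P.
Hypothesis nu2 : moment nu 2 < +oo.
Hypothesis prm : poisson_random_measure P (intensity nu) N.
Hypothesis levy : is_levy_noise P nu N L.
Variables (p : nat) (B : R).
Hypotheses (p2 : (2 <= p)%N) (ep : ~~ odd p) (nup : moment nu p < +oo).
Hypothesis ros : rosenthal_constant p B.
Variables (X : Omega -> R -> R) (K : R).
Hypotheses (mX : jointly_measurable X) (K0 : (0 < K)%R).

Let q := p./2.
Let m2 := fine (moment nu 2).
Let mp := fine (moment nu p).
Let m20 : (0 <= m2)%R. Proof. by rewrite fine_ge0// momentE// absmom_ge0. Qed.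
Let p0 : (0 < p)%N. Proof. exact: leq_trans p2. Qed.
Let mp0 : (0 <= mp)%R. Proof. by rewrite fine_ge0// momentE// absmom_ge0. Qed.
Let q0 : (0 < q)%N. Proof. by rewrite half_gt0. Qed.
Let nu2E : moment nu 2 = m2%:E.
Proof. by rewrite fineK// ge0_fin_numE// momentE// absmom_ge0. Qed.
Let nupE : moment nu p = mp%:E.
Proof. by rewrite fineK// ge0_fin_numE// momentE// absmom_ge0. Qed.
Let K0' : (0 <= K)%R. Proof. exact: ltW. Qed.

Definition processB (f g : Omega -> R -> R) w x := (f w x - g w x)%R.
Definition process_clip (M : R) (f : Omega -> R -> R) w x := clip M (f w x).

Let jointlyB f g : jointly_measurable f -> jointly_measurable g -> jointly_measurable (processB f g).
Proof. by move=> mf mg; exact: measurable_funB. Qed.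

Let jointly_clip M f : jointly_measurable f -> jointly_measurable (process_clip M f).
Proof. by move=> mf; exact: (measurableT_comp (measurable_clip M) mf). Qed.

Section one_process.
Variables (S : simple_process P N) (M dl : R).
Hypotheses (M0 : (0 <= M)%R) (dl0 : (0 < dl)%R).

Let mS := jointly_sp_fun Pc S.
Let D := \int[P]_w inner K 2 (processB (sp_fun S) X) w.
Let n := sp_size S.
Let t := sp_knot S.
Let tY := fun i w => clip M (sp_coef S i w).

Let tle k : (k < n)%N -> (t k <= t k.+1)%R.
Proof. by move=> kn; rewrite ltW// sp_knot_lt. Qed.

Let clip_step w x : process_clip M (sp_fun S) w x = step_process n t tY w x.
Proof. by rewrite /process_clip /sp_fun (step_process_comp tle)// clip0. Qed.

(** After [expr_diff_le], the bound |s - x| <= dl + |s - x|^2 / dl trades the first power for the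
    square, the only quantity that the approximation makes small. *)
Let clip_power r s x : (`|clip M s| ^+ r <= 1 * `|x| ^+ r +
  (r%:R * M ^+ r.-1 * dl + r%:R * M ^+ r.-1 * dl^-1 * `|s - x| ^+ 2))%R.
Proof.
rewrite mul1r (_ : _ + _ * `|s - x| ^+ 2 = r%:R * M ^+ r.-1 * (dl + dl^-1 * `|s - x| ^+ 2))%R; last by ring.
have h : (0 <= `|clip M s| <= M)%R by rewrite normr_ge0 clip_bound.
have y0 := normr_ge0 (s - x)%R.
apply: le_trans (expr_diff_le r h (normr_ge0 x) y0 _) _.
  rewrite -[clip M s](subrK (clip M x)) addrC (le_trans (ler_normD _ _))//.
  by rewrite lerD// ?clip_le// clip_lip.
rewrite lerD2l; apply: ler_wpM2l; first by rewrite mulr_ge0// exprn_ge0.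
move: `|s - x|%R y0 => y y0.
rewrite -(ler_pM2l dl0) mulrDr mulrA divff ?gt_eqF// mul1r.
by have := sqr_ge0 (y - dl); nra.
Qed.

Let coef r := (r%:R * M ^+ r.-1)%R.
Let coef0 r : (0 <= coef r)%R. Proof. by rewrite mulr_ge0// exprn_ge0. Qed.
(** The integral over the window of dl + |S - X|^2 / dl. Its mean is at most dl (2 K + 1) once D <=
    dl^2. *)
Let err w : \bar R := (dl * (2 * K))%:E + (dl^-1)%:E * inner K 2 (processB (sp_fun S) X) w.

Let err0 w : 0 <= err w.
Proof.
by rewrite adde_ge0 ?mule_ge0 ?inner_ge0 ?lee_fin ?invr_ge0 ?mulr_ge0// ltW.
Qed.

Let minner r (f : Omega -> R -> R) : jointly_measurable f -> measurable_fun setT (inner K r f).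
Proof. exact: measurable_inner. Qed.

Let merr : measurable_fun setT err.
Proof.
by apply: emeasurable_funD => //; apply: emeasurable_funM => //; apply: minner; exact: jointlyB.
Qed.

Let int_err : \int[P]_w err w = (dl * (2 * K))%:E + (dl^-1)%:E * D.
Proof.
have mB := minner 2 (jointlyB mS mX).
rewrite ge0_integralD//.
- rewrite integral_cst//= probability_setT mule1 ge0_integralZl//.
  + by move=> w _; exact: inner_ge0.
  + by rewrite lee_fin invr_ge0 ltW.
- by move=> w _; rewrite lee_fin !mulr_ge0// ltW.
- by move=> w _; rewrite mule_ge0 ?inner_ge0// lee_fin invr_ge0 ltW.
- exact: emeasurable_funM.
Qed.

Let inner_clip r w : inner K r (process_clip M (sp_fun S)) w <= inner K r X w + (coef r)%:E * err w.
Proof.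
have c1 : (0 <= coef r * dl)%R by rewrite mulr_ge0// ltW.
have c2 : (0 <= coef r * dl^-1)%R by rewrite mulr_ge0// invr_ge0 ltW.
have h := le_inner_affine (r := r) (s := 2) (f := process_clip M (sp_fun S)) (g := processB (sp_fun S) X)
  (w := w) K0' c1 ler01 c2 (jointly_clip M mS) (jointlyB mS mX) mX.
apply: (le_trans (h _)); first by move=> x; exact: clip_power.
rewrite mul1e (_ : (coef r)%:E * err w = (coef r * dl * (2 * K))%:E +
  (coef r * dl^-1)%:E * inner K 2 (processB (sp_fun S) X) w)//.
rewrite /err; set i := inner _ _ _ _.
rewrite muleDr ?fin_num_adde_defr// muleA -!EFinM.
by congr (_%:E + _); ring.
Qed.

(** A ceiling for the squared L^2 norm of the clipped process on the window; the summand 1 makes it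
    positive. *)
Let R0 := (M ^+ 2 * (2 * K) + 1)%R.

Let clip_elem_norm r w : (0 < r)%N ->
  (elem_norm K n t tY r w)%:E = inner K r (process_clip M (sp_fun S)) w.
Proof.
move=> r0; rewrite -(inner_step tle)//; congr inner.
by apply/funext => w'; apply/funext => x; rewrite clip_step.
Qed.

Let norm2_le w : (0 <= elem_norm K n t tY 2 w <= R0)%R.
Proof.
apply/andP; split; first by apply: sumr_ge0 => j _; rewrite mulr_ge0 ?exprn_ge0 ?len_ge0.
rewrite -lee_fin clip_elem_norm//.
have M20 : (0 <= M ^+ 2)%R by rewrite exprn_ge0.
have h := le_inner_affine (r := 2) (s := 2) (f := process_clip M (sp_fun S)) (g := X)
  (w := w) K0' M20 (lexx 0%R) (lexx 0%R) (jointly_clip M mS) mX mX.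
apply: (le_trans (h _)).
  by move=> x; rewrite !mul0r addr0 add0r lerXn2r ?nnegrE// clip_bound.
by rewrite !mul0e adde0 add0e lee_fin /R0 lerDl.
Qed.

(** [elem_bound] applied to the clipped coefficients, with both norms compared to those of the
    unclipped [X]. The power q = p/2 of the squared L^2 norm is handled like a power of a number,
    with ceiling [R0]. All errors are multiples of the mean of [err]. *)
Lemma clip_p_bound :
  absmom P p (elem_sum L K t tY n) <= (B ^+ p)%:E * (
    (m2 ^+ q)%:E * (\int[P]_w (inner K 2 X w `^ q%:R) +
       (q%:R * R0 ^+ q.-1 * coef 2)%:E * ((dl * (2 * K))%:E + (dl^-1)%:E * D)) +
    mp%:E * (\int[P]_w inner K p X w + (coef p)%:E * ((dl * (2 * K))%:E + (dl^-1)%:E * D))).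
Proof.
have [B0 _] := ros.
have R0gt : (0 < R0)%R by rewrite ltr_wpDl// mulr_ge0 ?exprn_ge0// mulr_ge0.
have [dl' elem] := simple_process_elementary S.
have {}elem : elementary P N n t tY dl'.
  by apply: elem; [exact: measurable_clip|move=> y; exact: clip_le].
apply: (le_trans (elem_bound Pc nu2 prm levy K p2 ep ros nup elem)).
apply: lee_wpmul2l; first by rewrite lee_fin exprn_ge0// ltW.
have mtr := jointly_clip M mS.
have mn2 : measurable_fun setT (elem_norm K n t tY 2).
  apply/measurable_EFinP; rewrite (_ : EFin \o _ = inner K 2 (process_clip M (sp_fun S))); first exact: minner.
  by apply/funext => w /=; rewrite clip_elem_norm.
have mpow : measurable_fun setT (fun w => inner K 2 X w `^ q%:R).
  exact: (measurableT_comp (measurable_poweR _) (minner 2 mX)).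
rewrite -int_err nupE; apply: leeD.
  under eq_integral do rewrite exprMn EFinM.
  rewrite ge0_integralZl//; last 3 first.
  - by apply/measurable_EFinP; exact: measurable_funX.
  - by move=> w _; rewrite lee_fin exprn_ge0//; case/andP: (norm2_le w).
  - by rewrite lee_fin exprn_ge0.
  apply: lee_wpmul2l; first by rewrite lee_fin exprn_ge0.
  rewrite -ge0_integralZl//; last by rewrite lee_fin !mulr_ge0// exprn_ge0// ltW.
  rewrite -ge0_integralD//; last 3 first.
  - by move=> w _; exact: poweR_ge0.
  - by move=> w _; rewrite mule_ge0// lee_fin !mulr_ge0// exprn_ge0// ltW.
  - exact: emeasurable_funM.
  apply: ge0_le_integral => //.
  - by move=> w _; rewrite lee_fin exprn_ge0//; case/andP: (norm2_le w).
  - by apply/measurable_EFinP; exact: measurable_funX.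
  - by apply: emeasurable_funD => //; exact: emeasurable_funM.
  move=> w _; rewrite EFinM -muleA; apply: ereal_expr_diff_le => //.
  - exact: inner_ge0.
  - by rewrite mule_ge0// lee_fin.
  - by rewrite clip_elem_norm//; exact: inner_clip.
apply: lee_wpmul2l; first by rewrite lee_fin.
rewrite -ge0_integralZl//; last by rewrite lee_fin.
rewrite -ge0_integralD//; last 4 first.
- by move=> w _; exact: inner_ge0.
- exact: minner.
- by move=> w _; rewrite mule_ge0// lee_fin.
- exact: emeasurable_funM.
apply: ge0_le_integral => //.
- by move=> w _; rewrite clip_elem_norm// inner_ge0.
- rewrite (_ : (fun w => _) = inner K p (process_clip M (sp_fun S))); first exact: minner.
  by apply/funext => w /=; rewrite clip_elem_norm.
- by apply: emeasurable_funD; [exact: minner|exact: emeasurable_funM].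
by move=> w _; rewrite clip_elem_norm//; exact: inner_clip.
Qed.

(** The difference of the two integrals is the elementary sum with coefficients [clip M y - y], so
    the L^2 bound for elementary sums applies. *)
Lemma clip_l2_bound :
  absmom P 2 (fun w => elem_sum L K t tY n w - simple_integral L K S w)%R <=
  m2%:E * (2%:E * \int[P]_w inner K 2 (processB X (process_clip M X)) w + 8%:E * D).
Proof.
have [dl' elem] := simple_process_elementary S.
pose phi := fun y : R => (clip M y - y)%R.
have mphi : measurable_fun setT phi by apply: measurable_funB => //; exact: measurable_clip.
have {}elem : elementary P N n t (fun i w => phi (sp_coef S i w)) dl'.
  by apply: elem => // y; exact: clip_diff.
have -> : (fun w => elem_sum L K t tY n w - simple_integral L K S w)%R =
    elem_sum L K t (fun i w => phi (sp_coef S i w)) n.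
  apply/funext => w; rewrite /elem_sum /simple_integral -sumrB.
  by apply: eq_bigr => i _; rewrite /phi mulrBl.
apply: (le_trans (elem_sum_l2 Pc nu2 prm levy K elem)).
rewrite nu2E; apply: lee_wpmul2l; first by rewrite lee_fin.
have mB := jointlyB mS mX.
have mXc := jointlyB mX (jointly_clip M mX).
have mf : jointly_measurable (fun w x => phi (sp_fun S w x)) by exact: (measurableT_comp mphi mS).
have normE : (fun w => (elem_norm K n t (fun i w => phi (sp_coef S i w)) 2 w)%:E) =
    inner K 2 (fun w x => phi (sp_fun S w x)).
  apply/funext => w; rewrite -(inner_step tle)//; congr inner.
  apply/funext => w'; apply/funext => x; rewrite /sp_fun (step_process_comp tle)//.
  by rewrite /phi clip0// subrr.
rewrite normE /D -!ge0_integralZl//; do ?[exact: minner|by move=> w _; exact: inner_ge0].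
have m1 (r : R) (f : Omega -> R -> R) : jointly_measurable f -> measurable_fun setT (fun w => r%:E * inner K 2 f w).
  by move=> mf'; apply: emeasurable_funM => //; exact: minner.
rewrite -ge0_integralD//; do ?[exact: m1|by move=> w _; rewrite mule_ge0 ?inner_ge0].
apply: ge0_le_integral => //.
- by move=> w _; apply: integral_ge0 => x _; rewrite lee_fin exprn_ge0.
- exact: minner.
- by apply: emeasurable_funD; exact: m1.
move=> w _.
have c8 : (0 <= 8 :> R)%R by [].
have c2 : (0 <= 2 :> R)%R by [].
apply: (le_trans (le_inner_affine (r := 2) (s := 2) (w := w) K0' (lexx 0%R) c2 c8 mf mB mXc _)).
  move=> x; rewrite add0r /phi /processB /process_clip.
  set y := sp_fun S w x; set z := X w x.
  (* Both [clip M] and the identity are 1-Lipschitz, whence the 2; squaring b + 2 c gives at most 2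
     b^2 + 8 c^2. *)
  have h : (`|clip M y - y| <= `|z - clip M z| + 2 * `|y - z|)%R.
    rewrite (_ : clip M y - y = (clip M y - clip M z) + ((clip M z - z) + (z - y)))%R; last by ring.
    rewrite (le_trans (ler_normD _ _))// (le_trans (lerD (clip_lip y z M0) (ler_normD _ _)))//.
    by rewrite distrC [(`|clip M z - z|)%R]distrC; lra.
  have a0 := normr_ge0 (clip M y - y)%R.
  move: `|clip M y - y|%R `|z - clip M z|%R `|y - z|%R (normr_ge0 (z - clip M z)%R) (normr_ge0 (y - z)%R) h a0 => a b c b0 cc0 h a0.
  have h2 : (a ^+ 2 <= (b + 2 * c) ^+ 2)%R by rewrite lerXn2r ?nnegrE// addr_ge0// mulr_ge0.
  apply: (le_trans h2); rewrite -subr_ge0 (_ : _ - _ = (b - 2 * c) ^+ 2)%R ?sqr_ge0//; ring.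
by rewrite mul0r add0e.
Qed.

End one_process.

End clipped_integrals.

(** * The bound on a window [-K, K] *)

Section ito_window.
Context {R : realType} {d} {Omega : measurableType d} (P : probability Omega R).

(** Dominated convergence on the product space: at each point the difference vanishes for large
    levels, and it is dominated by |X|. *)
Lemma clip_tail (X : Omega -> R -> R) (K e : R) : jointly_measurable X ->
  \int[P]_w inner K 2 X w < +oo -> (0 < e)%R ->
  exists2 M : R, (0 <= M)%R & \int[P]_w inner K 2 (processB X (process_clip M X)) w <= e%:E.
Proof.
move=> mX Xoo e0.
have mD M : jointly_measurable (processB X (process_clip M X)).
  by apply: measurable_funB => //; exact: (measurableT_comp (measurable_clip M) mX).
pose mu := P \x @lebesgue_measure R.
pose F k (wx : Omega * measurableTypeR R) :=
  (\1_(window K) wx.2 * `|processB X (process_clip k%:R X) wx.1 wx.2| ^+ 2)%:E.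
have mg f : jointly_measurable f -> measurable_fun setT (fun wx : Omega * measurableTypeR R =>
    (\1_(window K) wx.2 * `|f wx.1 wx.2| ^+ 2)%:E).
  move=> mf; apply/measurable_EFinP; apply: measurable_funM; first exact: jointly_window.
  by apply/measurable_EFinP; exact: jointly_abspow.
have Fcvg : \int[mu]_wx F k wx @[k --> \oo] --> \int[mu]_wx (cst 0 wx).
  apply: (dominated_cvg measurableT
    (g := fun wx => (\1_(window K) wx.2 * `|X wx.1 wx.2| ^+ 2)%:E)).
  - by move=> k; exact: (mg _ (mD _)).
  - move=> [w x] _; apply: cvg_near_cst; have := nbhs_infty_ger `|X w x|%R.
    apply: filterS => k hk; rewrite /F /= /processB /process_clip clip_id// subrr.
    by rewrite normr0 expr0n mulr0.
  - by [].
  - apply/integrableP; split; first exact: mg.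
    rewrite (eq_integral (fun wx => (\1_(window K) wx.2 * `|X wx.1 wx.2| ^+ 2)%:E)).
      by rewrite -inner_product.
    by move=> wx _; rewrite /= ger0_norm// mulr_ge0// exprn_ge0.
  - move=> k wx _; rewrite lee_fin ger0_norm ?mulr_ge0 ?exprn_ge0//.
    rewrite ler_wpM2l// lerXn2r ?nnegrE// /processB /process_clip distrC clip_diff//.
rewrite integral0 in Fcvg.
have e0' : 0 < e%:E by rewrite lte_fin.
have [k _ hk] := Fcvg _ (open_ereal_lt' e0').
exists k%:R => //; apply: ltW; rewrite inner_product//; exact: (hk k (leqnn k)).
Qed.

Variables (nu : {measure set (measurableTypeR R) -> \bar R}) (N : R.-ker Omega ~> plane R).
Variable L : set R -> Omega -> R.
Hypothesis Pc : measure_is_complete P.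
Hypothesis nu2 : moment nu 2 < +oo.
Hypothesis prm : poisson_random_measure P (intensity nu) N.
Hypothesis levy : is_levy_noise P nu N L.
Variables (p : nat) (B : R).
Hypotheses (p2 : (2 <= p)%N) (ep : ~~ odd p) (nup : moment nu p < +oo).
Hypothesis ros : rosenthal_constant p B.
Variables (X : Omega -> R -> R).
Hypothesis mX : jointly_measurable X.

Lemma normK2_small (S : nat -> simple_process P N) (K e : R) :
  (fun k => normK2 P K (fun w x => (sp_fun (S k) w x - X w x)%R)) @ \oo --> 0 -> (0 < e)%R ->
  \forall k \near \oo, \int[P]_w inner K 2 (processB (sp_fun (S k)) X) w <= e%:E.
Proof.
move=> cv e0; have r0 : 0 < (e `^ 2^-1)%:E by rewrite lte_fin powR_gt0.
have : \forall k \near \oo, normK2 P K (fun w x => (sp_fun (S k) w x - X w x)%R) < (e `^ 2^-1)%:E.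
  exact: (cv _ (open_ereal_lt' r0)).
apply: filterS => k /ltW.
rewrite /normK2 -/(processB (sp_fun (S k)) X).
set D := (X in X `^ _ <= _) => h.
change (D <= e%:E).
have D0 : 0 <= D by apply: integral_ge0 => w _; apply: integral_ge0 => x _; rewrite lee_fin exprn_ge0.
have e2 (x : \bar R) : 0 <= x -> x = (x `^ 2^-1) `^ 2.
  by move=> x0; rewrite -poweRrM mulVf// poweRe1.
rewrite (e2 D D0) (e2 e%:E) ?lee_fin ?(ltW e0)// poweR_EFin.
by apply: gt0_ler_poweR => //; rewrite in_itv/= ?leey ?poweR_ge0// lee_fin powR_ge0.
Qed.

(** By [absmom_lsc] it suffices to find variables near [Z] in L^2 whose p-th moments nearly satisfy
    the bound: the integrals of the clipped approximations. *)
Lemma ito_window_bound (K : R) (Z : Omega -> R) : (0 < K)%R ->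
  \int[P]_w inner K 2 X w < +oo ->
  is_ito_integralK P N L K X Z ->
  absmom P p Z <= (B ^+ p)%:E *
    ((fine (moment nu 2) ^+ p./2)%:E * \int[P]_w (inner K 2 X w `^ (p./2)%:R) +
     (fine (moment nu p))%:E * \int[P]_w inner K p X w).
Proof.
move=> K0 X2 [S [/(_ K K0) cS [mZ _ cZ]]].
apply: absmom_lsc => // e e0.
set m2 := fine (moment nu 2); set mp := fine (moment nu p); set q := p./2.
have [B0 _] := ros; have p0 : (0 < p)%N by exact: leq_trans p2.
have m20 : (0 <= m2)%R by rewrite fine_ge0// momentE// absmom_ge0.
have mp0 : (0 <= mp)%R by rewrite fine_ge0// momentE// absmom_ge0.
(* With e / 16 here and e / 64 for [D], both over m2 + 1, clipping costs 2 m2 (2/16 + 8/64) e / (m2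
   + 1) <= e / 2; the distance e / 4 to [Z] costs the other half. *)
have e1 : (0 < e / (16 * (m2 + 1)))%R by rewrite divr_gt0// mulr_gt0// ltr_wpDl.
have [M M0 tail] := clip_tail mX X2 e1.
pose c2 := (q%:R * (M ^+ 2 * (2 * K) + 1) ^+ q.-1 * (2%:R * M ^+ 1))%R.
pose cp := (p%:R * M ^+ p.-1)%R.
have c20 : (0 <= c2)%R.
  by rewrite !mulr_ge0// exprn_ge0// addr_ge0// !mulr_ge0// ?exprn_ge0// ltW.
have cp0 : (0 <= cp)%R by rewrite mulr_ge0// exprn_ge0.
pose c := (B ^+ p * (m2 ^+ q * c2 + mp * cp))%R.
have c0 : (0 <= c)%R.
  by rewrite mulr_ge0 ?exprn_ge0 ?(ltW B0)// addr_ge0// mulr_ge0// exprn_ge0.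
(* With D <= dl^2 the error in the p-th moment is at most c dl (2 K + 1), which this choice keeps
   below e. As [c] involves M, the level is fixed before [dl], and the index k comes last. *)
pose dl := (e / ((c + 1) * (2 * K + 1)))%R.
have K1 : (0 < 2 * K + 1)%R by lra.
have c1 : (0 < c + 1)%R by lra.
have dl0 : (0 < dl)%R by rewrite divr_gt0// mulr_gt0.
have e2 : (0 < e / (64 * (m2 + 1)))%R by rewrite divr_gt0// mulr_gt0// ltr_wpDl.
have e3 : (0 < Num.min (dl ^+ 2) (e / (64 * (m2 + 1))))%R by rewrite lt_min exprn_gt0.
have e4 : (0 < e / 4)%R by rewrite divr_gt0.
have hD := normK2_small cS e3.
have hZ := absmom_small (FF := eventually_filter) (ltn0Sn 1) cZ e4.
have [k _ hk] := filterI hD hZ; have [{}hD {}hZ] := hk k (leqnn k) => {hk}.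
set D := \int[P]_w _ in hD.
have D0 : 0 <= D by apply: integral_ge0 => w _; exact: inner_ge0.
have hD1 : D <= (dl ^+ 2)%:E by apply: (le_trans hD); rewrite lee_fin ge_min lexx.
have hD2 : D <= (e / (64 * (m2 + 1)))%:E by apply: (le_trans hD); rewrite lee_fin ge_min lexx orbT.
have [dl' elem] := simple_process_elementary (S k).
have mY := measurable_elem_sum Pc levy K (elem _ (measurable_clip M) (fun y => clip_le y M0)).
have mI := measurable_elem_sum Pc levy K (elem id (@measurable_id _ _ _) (fun y => lexx _)).
exists (elem_sum L K (sp_knot (S k)) (fun i w => clip M (sp_coef (S k) i w)) (sp_size (S k))).
split => //.
- apply: (le_trans (clip_p_bound Pc nu2 prm levy p2 ep nup ros mX K0 (S k) M0 dl0)).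
  rewrite -/D -/m2 -/mp -/q -/c2 -/cp.
  set TA := \int[P]_w (_ `^ _); set TB := \int[P]_w inner K p X w.
  set er := _ + _ * D.
  have TA0 : 0 <= TA by apply: integral_ge0 => w _; exact: poweR_ge0.
  have TB0 : 0 <= TB by apply: integral_ge0 => w _; exact: inner_ge0.
  have er_le : er <= (dl * (2 * K + 1))%:E.
    rewrite /er mulrDr mulr1 EFinD leeD2l//.
    apply: (@le_trans _ _ ((dl^-1)%:E * (dl ^+ 2)%:E)); first by rewrite lee_pmul2l// lte_fin invr_gt0.
    by rewrite -EFinM lee_fin expr2 mulrA mulVf ?gt_eqF// mul1r.
  have m2q0 : (0 <= m2 ^+ q)%R by rewrite exprn_ge0.
  have Bp0 : (0 <= B ^+ p)%R by rewrite exprn_ge0// ltW.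
  apply: (@le_trans _ _ ((B ^+ p)%:E * ((m2 ^+ q)%:E * (TA + (c2 * (dl * (2 * K + 1)))%:E) +
      mp%:E * (TB + (cp * (dl * (2 * K + 1)))%:E)))).
    apply: lee_wpmul2l; first by rewrite lee_fin.
    have k1 (a : R) : (0 <= a)%R -> a%:E * er <= (a * (dl * (2 * K + 1)))%:E.
      by move=> a0; rewrite (EFinM a); apply: lee_wpmul2l.
    apply: leeD; apply: lee_wpmul2l; rewrite ?lee_fin//; apply: leeD => //; exact: k1.
  have y0 : (0 <= dl * (2 * K + 1))%R by rewrite mulr_ge0// ltW.
  have dist (a : R) (T : \bar R) (b : R) : (0 <= b)%R -> 0 <= T ->
      a%:E * (T + b%:E) = a%:E * T + (a * b)%:E.
    by move=> b0 T0; rewrite muleDr ?EFinM// fin_num_adde_defl.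
  have z1 := mulr_ge0 c20 y0; have z2 := mulr_ge0 cp0 y0.
  rewrite (dist _ _ _ z1 TA0) (dist _ _ _ z2 TB0).
  rewrite addeACA ge0_muleDr; last 2 first.
  + by rewrite adde_ge0// mule_ge0// lee_fin.
  + by rewrite -EFinD lee_fin; apply: addr_ge0; apply: mulr_ge0.
  rewrite leeD2l// -EFinD -EFinM lee_fin.
  rewrite (_ : B ^+ p * _ = c * (dl * (2 * K + 1)))%R; last by rewrite /c; ring.
  rewrite (_ : c * (dl * (2 * K + 1)) = e * (c / (c + 1)))%R; last first.
    by rewrite /dl; field; apply/andP; split; rewrite gt_eqF.
  by rewrite ger_pMr// ler_pdivrMr// mul1r lerDl.
- apply: le_trans (absmom2_tri P mY mI mZ) _.
  have h1 := clip_l2_bound Pc nu2 prm levy mX K0 (S k) M0.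
  have {}h1 := le_trans h1 (lee_wpmul2l _ (leeD (lee_wpmul2l _ tail) (lee_wpmul2l _ hD2))).
  apply: (@le_trans _ _ (2%:E * (m2%:E * (2%:E * (e / (16 * (m2 + 1)))%:E + 8%:E * (e / (64 * (m2 + 1)))%:E)) +
    2%:E * (e / 4)%:E)).
    apply: leeD; apply: lee_wpmul2l => //; apply: h1; by rewrite ?lee_fin.
  rewrite -!(EFinM, EFinD) lee_fin.
  have m21 : (0 < m2 + 1)%R by lra.
  have -> : (2 * (m2 * (2 * (e / (16 * (m2 + 1))) + 8 * (e / (64 * (m2 + 1))))) + 2 * (e / 4) =
     e / 2 * (m2 / (m2 + 1)) + e / 2)%R by field; rewrite gt_eqF.
  rewrite [leRHS](splitr e) lerD2r ger_pMr ?divr_gt0//.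
  by rewrite ler_pdivrMr// mul1r lerDl.
Qed.

End ito_window.

(** * The two norms and the final bound *)

Lemma partitions_ge2_gt0 p : (2 <= p)%N -> (0 < partitions_ge2 p)%N.
Proof.
move=> p2; apply/card_gt0P; exists (finset.set1 (finset.setTfor 'I_p)); rewrite !inE.
apply/andP; split; last first.
  by apply/forallP => D; apply/implyP; rewrite finset.in_set1 => /eqP ->; rewrite finset.cardsT card_ord.
apply/and3P; split.
- by rewrite /finset.cover finset.big_set1.
- by apply/finset.trivIsetP => D D'; rewrite !finset.in_set1 => /eqP -> /eqP ->; rewrite eqxx.
- rewrite finset.in_set1; apply/eqP => /setP /(_ (Ordinal (ltnW p2))).
  by rewrite finset.in_set0 finset.in_setT.
Qed.

Lemma exprD_superadd {R : realType} (a b : R) n : (0 < n)%N -> (0 <= a)%R -> (0 <= b)%R ->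
  (a ^+ n + b ^+ n <= (a + b) ^+ n)%R.
Proof.
move=> n0 a0 b0; case: n n0 => // n _; elim: n => [|n IH]; first by rewrite !expr1.
rewrite [leRHS]exprS (le_trans _ (ler_wpM2l (addr_ge0 a0 b0) IH))//.
rewrite mulrDl !mulrDr -!exprS addrACA lerD ?lerDl// ?lerDr ?mulr_ge0 ?exprn_ge0//.
Qed.

Section full_line.
Context {R : realType} {d} {Omega : measurableType d} (P : probability Omega R).
Variables (X : Omega -> R -> R) (p : nat).
Hypotheses (mX : jointly_measurable X) (p2 : (2 <= p)%N) (ep : ~~ odd p).

Let p0 : (0 < p)%N. Proof. exact: leq_trans p2. Qed.

Let line r w : \bar R := absmom (@lebesgue_measure R) r (X w).

Let mline r : measurable_fun setT (line r).
Proof.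
rewrite (_ : line r = fubini_F (@lebesgue_measure R)
  (fun wx : Omega * measurableTypeR R => (`|X wx.1 wx.2| ^+ r)%:E))//.
apply: measurable_fun_fubini_tonelli_F; first exact: jointly_abspow.
by move=> wx; rewrite lee_fin exprn_ge0.
Qed.

Let inner_line K r w : inner K r X w <= line r w.
Proof.
apply: ge0_subset_integral => //; first exact: measurable_window.
- by apply: measurable_abspow; exact: jointly_section.
Qed.

Let pE : (p%:R = 2 * (p./2)%:R :> R)%R.
Proof.
rewrite -natrM mul2n; congr (_%:R); have := odd_double_half p.
by rewrite (negbTE ep) add0n.
Qed.

(** As p is even, the p-th power of the L^2 norm of a path is the power p/2 of the integral of its
    square. *)
Lemma inner_normL2 K : \int[P]_w (inner K 2 X w `^ (p./2)%:R) <=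
  'N[P]_(p%:R%:E)[(fun w => 'N[@lebesgue_measure R]_2%:E[EFin \o X w])] `^ p%:R.
Proof.
rewrite poweR_Lnorm ?pnatr_eq0 -?lt0n//.
have e w : `| 'N[@lebesgue_measure R]_2%:E[EFin \o X w] | `^ p%:R = line 2 w `^ (p./2)%:R.
  rewrite gee0_abs ?Lnorm_ge0// (Lnorm_nat _ _ (ltn0Sn 1)) -poweRrM pE.
  by rewrite mulrA mulVf ?pnatr_eq0// mul1r.
under [leRHS]eq_integral do rewrite e.
apply: ge0_le_integral => //.
- by move=> w _; exact: poweR_ge0.
- exact: (measurableT_comp (measurable_poweR _) (measurable_inner K 2 mX)).
- exact: (measurableT_comp (measurable_poweR _) (mline 2)).
- move=> w _; apply: gt0_ler_poweR => //; rewrite ?in_itv/= ?leey ?andbT.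
  + exact: inner_ge0.
  + exact: absmom_ge0.
Qed.

Lemma inner_normLp K : \int[P]_w inner K p X w <=
  'N[P \x @lebesgue_measure R]_(p%:R%:E)
     [(fun wx : Omega * measurableTypeR R => (X wx.1 wx.2)%:E)] `^ p%:R.
Proof.
rewrite inner_product// (poweR_Lnorm_nat _ (fun wx : Omega * measurableTypeR R => X wx.1 wx.2) p0).
apply: ge0_le_integral => //.
- apply/measurable_EFinP; apply: measurable_funM; first exact: jointly_window.
  by apply/measurable_EFinP; exact: jointly_abspow.
- exact: jointly_abspow.
- move=> wx _; rewrite lee_fin ler_piMl ?exprn_ge0//.
Qed.

(** On a finite window |x|^2 <= 1 + |x|^p suffices, so square integrability follows from the second
    part of [X]_p. *)
Lemma inner2_lty K : (0 <= K)%R -> \int[P]_w inner K p X w < +oo ->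
  \int[P]_w inner K 2 X w < +oo.
Proof.
move=> K0 h; apply: (@le_lt_trans _ _ (\int[P]_w ((1 * (2 * K))%:E + inner K p X w))).
  apply: ge0_le_integral => //.
  - by move=> w _; exact: inner_ge0.
  - exact: measurable_inner.
  - by apply: emeasurable_funD => //; exact: measurable_inner.
  move=> w _.
  apply: (le_trans (le_inner_affine (r := 2) (s := p) (w := w) K0 ler01 (lexx 0%R) ler01 mX mX mX _)).
    move=> x; rewrite mul0r add0r mul1r; have y0 := normr_ge0 (X w x).
    have [y1|y1] := lerP `|X w x|%R 1%R.
      by rewrite (le_trans (exprn_ile1 2 y0 y1))// lerDl exprn_ge0.
    by rewrite (le_trans (ler_weXn2l (ltW y1) p2))// lerDr.
  by rewrite mul0e add0e mul1e.
rewrite ge0_integralD//.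
- by rewrite integral_cst//= probability_setT mule1 lte_add_pinfty// ltry.
- by move=> w _; rewrite lee_fin !mulr_ge0.
- by move=> w _; exact: inner_ge0.
- exact: measurable_inner.
Qed.

End full_line.

Theorem theorem3p4 (R : realType) (d : measure_display)
    (Omega : measurableType d) (P : probability Omega R)
    (nu : {measure set (measurableTypeR R) -> \bar R})
    (N : R.-ker Omega ~> plane R) (L : set R -> Omega -> R)
    (p : nat) (B : R) (X : Omega -> R -> R) (IX : Omega -> R) :
  measure_is_complete P ->
  nu [set 0%R] = 0 ->
  moment nu 2 < +oo ->
  poisson_random_measure P (intensity nu) N ->
  is_levy_noise P nu N L ->
  (2 <= p)%N -> ~~ odd p ->
  moment nu p < +oo ->
  rosenthal_constant p B ->
  X \in Lpstar P N p ->
  is_ito_integral P N L X IX ->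
  'N[P]_(p%:R%:E)[EFin \o IX] <= (constC nu B p)%:E * normp P p X.
Proof.
move=> Pc _ nu2 prm levy p2 ep nup ros; rewrite inE => -[predX Xp] [I [itoI [mIX _ cI]]].
have p0 : (0 < p)%N by exact: leq_trans p2.
have pr0 : (p%:R != 0 :> R)%R by rewrite pnatr_eq0 -lt0n.
have mX := jointly_predictable Pc predX.
have [B0 _] := ros.
move: Xp; rewrite /normp.
set a := 'N[P]_(_)[_]; set b := 'N[P \x _]_(_)[_] => ab.
have a0 : 0 <= a by exact: Lnorm_ge0.
have b0 : 0 <= b by exact: Lnorm_ge0.
have [aoo boo] : a < +oo /\ b < +oo.
  by split; apply: le_lt_trans ab; rewrite ?leeDl ?leeDr.
pose m2 := fine (moment nu 2); pose mp := fine (moment nu p); pose q := p./2.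
have m20 : (0 <= m2)%R by rewrite fine_ge0// momentE// absmom_ge0.
have mp0 : (0 <= mp)%R by rewrite fine_ge0// momentE// absmom_ge0.
have Bp0 : (0 <= B ^+ p)%R by rewrite exprn_ge0// ltW.
have Ibound (K : R) : (0 < K)%R -> absmom P p (I K) <= (B ^+ p)%:E *
    ((m2 ^+ q)%:E * a `^ p%:R + mp%:E * b `^ p%:R).
  move=> K0; have hp := inner_normLp P mX p2 K.
  have h2 := inner2_lty mX p2 (ltW K0) (le_lt_trans hp (poweR_lty _ boo)).
  apply: (le_trans (ito_window_bound Pc nu2 prm levy p2 ep nup ros mX K0 h2 (itoI K K0))).
  apply: lee_wpmul2l; first by rewrite lee_fin.
  apply: leeD; apply: lee_wpmul2l; rewrite ?lee_fin ?exprn_ge0//.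
  exact: (inner_normL2 P mX p2 ep K).
have IXbound : absmom P p IX <= (B ^+ p)%:E *
    ((m2 ^+ q)%:E * a `^ p%:R + mp%:E * b `^ p%:R).
  apply: absmom_lsc => // e e0.
  (* Some K > 0 makes [I K] close to I(X), and the bound on [I K] does not depend on K. *)
  have hI : \forall K \near +oo%R, absmom P 2 (fun w => I K w - IX w)%R <= e%:E.
    exact: (absmom_small (ltn0Sn 1) cI e0).
  have [K [K0 hK]] := filter_ex (filterI (nbhs_pinfty_gt (num_real (0 : R))) hI).
  exists (I K); split => //; first by have [S [_ []]] := itoI K K0.
  by apply: (le_trans (Ibound K K0)); rewrite leeDl// lee_fin ltW.
rewrite (Lnorm_nat _ _ p0).
have aE : a = (fine a)%:E by rewrite fineK// ge0_fin_numE.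
have bE : b = (fine b)%:E by rewrite fineK// ge0_fin_numE.
have {}a0 : (0 <= fine a)%R by exact: fine_ge0.
have {}b0 : (0 <= fine b)%R by exact: fine_ge0.
rewrite aE bE in IXbound *; move: (fine a) (fine b) a0 b0 IXbound => {aE bE aoo boo ab Ibound}x y x0 y0.
rewrite !poweR_EFin !powR_mulrn// -!(EFinM, EFinD) => IXbound.
pose C := (2 * B ^+ p * (partitions_ge2 p)%:R * Num.max (m2 `^ (p%:R / 2)) mp)%R.
(* The real power p/2 in the constant is the integer power q, since p is even. *)
have m2qE : (m2 `^ (p%:R / 2) = m2 ^+ q)%R.
  rewrite -powR_mulrn//; congr (_ `^ _)%R.
  have -> : (p%:R = 2 * q%:R :> R)%R.
    rewrite -natrM mul2n; congr (_%:R); have := odd_double_half p.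
    by rewrite (negbTE ep) add0n.
  by field.
have max0 : (0 <= Num.max (m2 ^+ q) mp)%R by rewrite le_max mp0 orbT.
have part1 : (1 <= (partitions_ge2 p)%:R :> R)%R by rewrite ler1n partitions_ge2_gt0.
have C0 : (0 <= C)%R by rewrite /C m2qE !mulr_ge0.
(* The maximum dominates both weights, x^p + y^p <= (x + y)^p merges the two norms into their sum,
   and twice the number of partitions is at least 1. *)
have bound : (B ^+ p * (m2 ^+ q * x ^+ p + mp * y ^+ p) <= C * (x + y) ^+ p)%R.
  apply: (@le_trans _ _ (B ^+ p * (Num.max (m2 ^+ q) mp * (x ^+ p + y ^+ p)))%R).
    rewrite ler_wpM2l// mulrDr lerD// ler_wpM2r ?exprn_ge0// le_max lexx ?orbT//.
  rewrite /C m2qE (_ : 2 * _ * _ * _ * _ = B ^+ p * (Num.max (m2 ^+ q) mp * (2 * (partitions_ge2 p)%:R * (x + y) ^+ p)))%R; last by ring.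
  rewrite ler_wpM2l// ler_wpM2l// (le_trans (exprD_superadd p0 x0 y0))//.
  by rewrite ler_peMl ?exprn_ge0 ?addr_ge0//; lra.
have CE : (C * (x + y) ^+ p)%:E `^ p%:R^-1 = (constC nu B p * (x + y))%:E.
  rewrite poweR_EFin powRM ?exprn_ge0 ?addr_ge0//; congr (_ * _)%:E.
  by rewrite -powR_mulrn ?addr_ge0// -powRrM divff// powRr1// addr_ge0.
rewrite -CE; apply: gt0_ler_poweR.
- by rewrite invr_ge0.
- by rewrite in_itv/= leey andbT absmom_ge0.
- by rewrite in_itv/= leey andbT lee_fin mulr_ge0// exprn_ge0// addr_ge0.
- by apply: (le_trans IXbound); rewrite lee_fin.
Qed.
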